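(* Assume that $\infty$ is regular or an exit. Let $X$ be a $Q$-process, let $\bar X$ be its Ray-Knight compactification on $\mathbf F=\mathbb N\cup\{\infty\}\cup\{\partial\}$ with Ray semigroup $(\bar P_t)_{t\ge 0}$, let $X^{\min}$ be the minimal $Q$-process, and let $\pi$ be a probability measure on $\mathbb N\cup\{\partial\}$. The following are equivalent: (1) $X$ is the $(Q,\pi)$-Doob process; (2) $X$ is the piecing out of $X^{\min}$ with respect to $\pi$; (3) $\infty$ is a branching point for $\bar X$ and $\bar P_0(\infty,\cdot)=\pi$.
   Context: Setting. $\mathbb N=\{0,1,2,\dots\}$. Let $a_0=0$, $a_k>0$ ($k\ge1$), $b_k>0$ ($k\ge 0$), $q_k=a_k+b_k$, and let $Q=(q_{ij})_{i,j\in\mathbb N}$ be the tridiagonal matrix with $q_{kk}=-q_k$, $q_{k,k+1}=b_k$, $q_{k,k-1}=a_k$, all other entries $0$. A transition matrix $(p_{ij}(t))_{i,j\in\mathbb N,t\ge0}$ is a nonnegative semigroup of matrices with row sums $\le 1$; it is extended to an honest one (row sums $1$) on $\mathbb N\cup\{\partial\}$ by adding a trap $\partial$. It is standard if $\lim_{t\to0}p_{ij}(t)=\delta_{ij}$. A $Q$-process is a continuous-time Markov chain whose transition matrix is standard with $p_{ij}'(0)=q_{ij}$ for all $i,j\in\mathbb N$; two $Q$-processes with the same transition matrix are identified. The minimal $Q$-process $X^{\min}$ has the smallest transition matrix: $p^{\min}_{ij}(t)\le p_{ij}(t)$ for every $Q$-process $(p_{ij}(t))$. Put $\mu_0=1$,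 $\mu_k=\frac{b_0\cdots b_{k-1}}{a_1\cdots a_k}$, $c_0=0$, $c_1=\frac1{2b_0}$, $c_k=\frac1{2b_0}+\sum_{i=2}^k\frac{a_1\cdots a_{i-1}}{2b_0b_1\cdots b_{i-1}}$ ($k\ge2$), $\sigma=\sum_{k\ge0}(c_{k+1}-c_k)\sum_{i=0}^k\mu_i$, $\lambda=\sum_{k\ge0}c_k\mu_k$. The boundary $\infty$ is regular if $\sigma<\infty,\lambda<\infty$; an exit if $\sigma<\infty,\lambda=\infty$. Ray-Knight compactification. For a $Q$-process with transition matrix $(p_{ij}(t))$ on $\mathbb N\cup\{\partial\}$ let $R_\alpha(i,A)=\int_0^\infty e^{-\alpha t}\sum_{j\in A}p_{ij}(t)\,dt$. $\mathbf F=\mathbb N\cup\{\infty\}\cup\{\partial\}$, where $\mathbb N\cup\{\infty\}$ is the Alexandroff compactification of discrete $\mathbb N$ and $\partial$ is isolated. The Ray-Knight compactification $\bar X$ is the càdlàg Ray process on $\mathbf F$ whose Ray resolvent $\bar R_\alpha:C(\mathbf F)\to C(\mathbf F)$ is determined by $\bar R_\alpha f(i)=\sum_{j\in\mathbb N\cup\{\partial\}}R_\alpha(i,\{j\})f(j)$ for $i\in\mathbb N\cup\{\partial\}$ and $\bar R_\alpha f(\infty)=\lim_{i\to\infty}\bar R_\alpha f(i)$. Its Ray semigroup $(\bar P_t)_{t\ge0}$ consists of probability kernels on $\mathbf F$ such that $t\mapsto\bar P_tf(x)$ is right continuous with Laplace transform $\alpha\mapsto\bar R_\alpha f(x)$ for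 $f\in C(\mathbf F)$. A point $x\in\mathbf F$ is non-branching if $\alpha\bar R_\alpha f(x)\to f(x)$ as $\alpha\uparrow\infty$ for all $f\in C(\mathbf F)$, and branching otherwise. Doob process. The $(Q,\pi)$-Doob process is the $Q$-process that behaves as the minimal $Q$-process up to each flying time (a time at which it reaches $\infty$ by infinitely many accumulating jumps), and at each flying time immediately restarts, independently of the past, from a position in $\mathbb N\cup\{\partial\}$ chosen according to $\pi$, until it is trapped at $\partial$. Precisely, it is the $Q$-process with resolvent $$R_\alpha(i,\{j\})=\Phi_{ij}(\alpha)+u_\alpha(i)\frac{\sum_{k\in\mathbb N}\pi_k\Phi_{kj}(\alpha)}{1-\sum_{k\in\mathbb N}\pi_ku_\alpha(k)},\quad i,j\in\mathbb N,\ \alpha>0,$$ where $\pi_k=\pi(\{k\})$, $\Phi_{ij}(\alpha)=\int_0^\infty e^{-\alpha t}p^{\min}_{ij}(t)dt$ and $u_\alpha(i)=\mathbf E_ie^{-\alpha\eta}=1-\alpha\sum_{j\in\mathbb N}\Phi_{ij}(\alpha)$, with $\eta$ the first flying time (the lifetime of the minimal $Q$-process). For $\pi=\delta_\partial$ it is the minimal $Q$-process. Piecing out. Let $S$ be a locally compact Hausdorff space with countable base, $S_\Delta=S\cup\{\Delta\}$ its one-point compactification ($\Delta$ isolated if $S$ is compact), $Y=(\Omega,\mathscr F,\mathscr F_t,Y_t,\theta_t,(\mathbf P_x)_{x\in S_\Delta})$ a right continuous strong Markov process on $S_\Delta$ with lifetime $\zeta$ and trap $\Delta$, and $\pi$ a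 probability measure on $S_\Delta$. Let $\omega_\Delta$ be the path constantly $\Delta$; set $K(\omega,dy)=\pi(dy)$ for $\omega\ne\omega_\Delta$ and $K(\omega_\Delta,dy)=\delta_\Delta(dy)$. On $W=\Omega\times S_\Delta$ put $\mathbf Q_x(d\omega,dy)=\mathbf P_x(d\omega)K(\omega,dy)$ and, for $w=(\omega,y)$, $\dot Y_t(w)=Y_t(\omega)$ if $t<\zeta(\omega)$, $\dot Y_t(w)=y$ if $t\ge\zeta(\omega)$. On $\tilde\Omega=W^{\{1,2,\dots\}}$ let $\tilde{\mathbf P}_x$ be the probability with $\tilde{\mathbf P}_x[dw_1,\dots,dw_n]=\mathbf Q_x[dw_1]\mathbf Q_{y_1}[dw_2]\cdots\mathbf Q_{y_{n-1}}[dw_n]$, $w_i=(\omega_i,y_i)$. The piecing out $\tilde Y=(Y,\pi)$ is $\tilde Y_t=\dot Y_t(w_1)$ for $0\le t\le\zeta(\omega_1)$, $\tilde Y_t=\dot Y_{t-(\zeta(\omega_1)+\dots+\zeta(\omega_n))}(w_{n+1})$ for $\sum_{i\le n}\zeta(\omega_i)<t\le\sum_{i\le n+1}\zeta(\omega_i)$, and $\tilde Y_t=\Delta$ for $t\ge\sum_{i=1}^{N}\zeta(\omega_i)$ with $N=\inf\{i:\zeta(\omega_i)=0\}$ ($\inf\emptyset=\infty$). Here it is applied with $S=\mathbb N$, $Y=X^{\min}$, and $\Delta=\partial$ regarded as the Alexandroff point of $\mathbb N$; ''$X$ is the piecing out'' means equality of transition matrices. *)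

(* Defs.v *)
From HB Require Import structures.
From mathcomp Require Import all_boot all_order all_algebra.
From mathcomp Require Import all_classical all_reals all_analysis.
Set Implicit Arguments.
Unset Strict Implicit.
Unset Printing Implicit Defensive.
Import Order.TTheory GRing.Theory Num.Theory.
Import numFieldNormedType.Exports.
Local Open Scope classical_set_scope.
Local Open Scope ring_scope.

(** State spaces.  [NatCem] is N with the trap as Alexandroff point; [None] is
    the trap.  [RKSpace] is the compact space N u {oo} u {trap}: the inner
    [None] is the Alexandroff point oo of N, and the outer [None] is the trap,
    which is isolated because N u {oo} is already compact. *)

Notation NatCem := (one_point_compactification nat).
Notation RKSpace :=
  (one_point_compactification (one_point_compactification nat)).
Notation NatCemB := (g_sigma_algebraType (@open NatCem)).
Notation RKSpaceB := (g_sigma_algebraType (@open RKSpace)).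

Definition rk_infty : RKSpace := Some None.

Definition rk_incl (x : NatCem) : RKSpace :=
  if x is Some i then Some (Some i) else None.

Section BirthDeath.
Context {R : realType} (a b : nat -> R).

Definition bd_matrix (i j : nat) : R :=
  if j == i then - (a i + b i)
  else if j == i.+1 then b i
  else if j.+1 == i then a i
  else 0.

Definition bd_mu (k : nat) : R :=
  (\prod_(0 <= l < k) b l) / (\prod_(1 <= l < k.+1) a l).

Definition bd_scale (k : nat) : R :=
  if k == 0%N then 0
  else 1 / (2 * b 0%N) +
    \sum_(2 <= i < k.+1) (\prod_(1 <= l < i) a l) / (2 * \prod_(0 <= l < i) b l).

Definition bd_sigma : \bar R :=
  (\sum_(0 <= k <oo)
    ((bd_scale k.+1 - bd_scale k) * \sum_(0 <= i < k.+1) bd_mu i)%:E)%E.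

Definition bd_lambda : \bar R :=
  (\sum_(0 <= k <oo) (bd_scale k * bd_mu k)%:E)%E.

Definition infty_regular : Prop := (bd_sigma < +oo)%E /\ (bd_lambda < +oo)%E.

Definition infty_exit : Prop := (bd_sigma < +oo)%E /\ bd_lambda = +oo%E.

End BirthDeath.

(** The values of [p t i j] at negative [t] are irrelevant. *)

Section TransitionMatrices.
Context {R : realType}.
Implicit Types p : R -> nat -> nat -> R.

Record transition_matrix p : Prop := {
  tm_ge0 : forall (t : R) i j, 0 <= t -> 0 <= p t i j;
  tm_row : forall (t : R) i, 0 <= t -> (\sum_(0 <= j <oo) (p t i j)%:E <= 1)%E;
  tm_semigroup : forall (s t : R) i j, 0 <= s -> 0 <= t ->
    (p (s + t) i j)%:E = (\sum_(0 <= k <oo) (p s i k * p t k j)%:E)%E }.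

Record standard_matrix p : Prop := {
  std_at0 : forall i j, p 0 i j = (i == j)%:R;
  std_lim : forall i j, p t i j @[t --> 0^'+] --> ((i == j)%:R : R) }.

(** Processes with the same transition matrix are identified, so a Q-process is
    its transition matrix. *)
Record Q_process (a b : nat -> R) p : Prop := {
  Qp_transition : transition_matrix p;
  Qp_standard : standard_matrix p;
  Qp_derivative : forall i j,
    (p t i j - p 0 i j) / t @[t --> 0^'+] --> bd_matrix a b i j }.

Definition minimal_Q_process (a b : nat -> R) p : Prop :=
  Q_process a b p /\
  forall p', Q_process a b p' ->
    forall (t : R) i j, 0 <= t -> p t i j <= p' t i j.

Definition honest_ext p (t : R) (x y : NatCem) : R :=
  match x, y with
  | Some i, Some j => p t i j
  | Some i, None => 1 - fine (\sum_(0 <= j <oo) (p t i j)%:E)%E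
  | None, Some _ => 0
  | None, None => 1
  end.

Definition laplace (alpha : R) (g : R -> R) : R :=
  \int[lebesgue_measure]_(t in `[0, +oo[) (expR (- (alpha * t)) * g t).

Definition resolvent p (alpha : R) (x : NatCem) (A : set NatCem) : R :=
  laplace alpha (fun t => fine (\esum_(y in A) (honest_ext p t x y)%:E)%E).

(** [u_alpha(i)], with [pmin] the minimal transition matrix. *)
Definition flying_laplace (pmin : R -> nat -> nat -> R) (alpha : R) (i : nat)
    : R :=
  1 - alpha * limn (series (fun j => laplace alpha (fun t => pmin t i j))).

Definition doob_process (pmin : R -> nat -> nat -> R)
    (pi : probability NatCemB R) p : Prop :=
  let Phi alpha i j := laplace alpha (fun t => pmin t i j) in
  let pi_ (k : nat) := fine (pi [set Some k]) in
  forall (alpha : R) (i j : nat), 0 < alpha ->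
    resolvent p alpha (Some i) [set Some j] =
    Phi alpha i j +
    flying_laplace pmin alpha i *
      (limn (series (fun k => pi_ k * Phi alpha k j)) /
       (1 - limn (series (fun k => pi_ k * flying_laplace pmin alpha k)))).

End TransitionMatrices.

Section RayKnight.
Context {R : realType}.
Implicit Types (p : R -> nat -> nat -> R) (f : RKSpace -> R).

Definition resolvent_fun p (alpha : R) f (x : NatCem) : R :=
  limn (series (fun j =>
    resolvent p alpha x [set Some j] * f (Some (Some j)))) +
  resolvent p alpha x [set None] * f None.

Definition ray_resolvent p (alpha : R) f (x : RKSpace) : R :=
  match x with
  | Some (Some i) => resolvent_fun p alpha f (Some i)
  | Some None => limn (fun i => resolvent_fun p alpha f (Some i))
  | None => resolvent_fun p alpha f None
  end.

(** [rk_resolvent_continuous] says that the limit defining the resolvent at oo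
    exists, i.e. that the Ray resolvent maps C(RKSpace) to itself. *)
Record ray_knight_semigroup p (Pbar : R -> R.-pker RKSpaceB ~> RKSpaceB)
    : Prop := {
  rk_resolvent_continuous : forall (alpha : R) f, 0 < alpha ->
    continuous f -> continuous (ray_resolvent p alpha f);
  rk_right_continuous : forall f (x : RKSpace) (t : R), continuous f ->
    0 <= t ->
    (\int[Pbar s x]_y f y) @[s --> t^'+] --> \int[Pbar t x]_y f y;
  rk_laplace : forall f (x : RKSpace) (alpha : R), continuous f ->
    0 < alpha ->
    laplace alpha (fun t => \int[Pbar t x]_y f y) = ray_resolvent p alpha f x }.

Definition nonbranching_point p (x : RKSpace) : Prop :=
  forall f, continuous f ->
    alpha * ray_resolvent p alpha f x @[alpha --> +oo] --> f x.

Definition branching_point p (x : RKSpace) : Prop := ~ nonbranching_point p x.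

End RayKnight.

Section MarkovProcesses.
Context {R : realType} {d : measure_display} {Omega : measurableType d}.

Record process_data := ProcessData {
  pd_filtration : R -> set_system Omega;
  pd_state : R -> Omega -> NatCem;
  pd_shift : R -> Omega -> Omega;
  pd_law : NatCem -> probability Omega R }.

Implicit Type Y : process_data.

Definition stopping_time Y (T : Omega -> \bar R) : Prop :=
  (forall w, (0 <= T w)%E) /\
  forall t : R, 0 <= t -> pd_filtration Y t [set w | (T w <= t%:E)%E].

Definition event_before Y (T : Omega -> \bar R) (A : set Omega) : Prop :=
  measurable A /\
  forall t : R, 0 <= t -> pd_filtration Y t (A `&` [set w | (T w <= t%:E)%E]).

Record rc_strong_markov Y : Prop := {
  sm_sigma : forall t : R, 0 <= t -> sigma_algebra setT (pd_filtration Y t);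
  sm_sub : forall t : R, 0 <= t -> pd_filtration Y t `<=` measurable;
  sm_mono : forall s t : R, 0 <= s -> s <= t ->
    pd_filtration Y s `<=` pd_filtration Y t;
  sm_adapted : forall (t : R) x, 0 <= t ->
    pd_filtration Y t [set w | pd_state Y t w = x];
  sm_right_continuous : forall w (t : R), 0 <= t ->
    pd_state Y s w @[s --> t^'+] --> pd_state Y t w;
  sm_trap : forall w (s t : R), 0 <= s -> s <= t ->
    pd_state Y s w = None -> pd_state Y t w = None;
  sm_shift : forall w (s t : R), 0 <= s -> 0 <= t ->
    pd_state Y s (pd_shift Y t w) = pd_state Y (s + t) w;
  sm_start : forall x, pd_law Y x [set w | pd_state Y 0 w = x] = 1%E;
  sm_strong_markov : forall (T : Omega -> \bar R) (A : set Omega)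
      (x y : NatCem) (s : R),
    stopping_time Y T -> event_before Y T A -> 0 <= s ->
    let AT := A `&` [set w | (T w < +oo)%E] in
    pd_law Y x
      (AT `&` [set w | pd_state Y s (pd_shift Y (fine (T w)) w) = y]) =
    (\int[pd_law Y x]_(w in AT)
       pd_law Y (pd_state Y (fine (T w)) w) [set w' | pd_state Y s w' = y])%E }.

Definition has_transition_matrix Y (p : R -> nat -> nat -> R) : Prop :=
  forall (t : R) i j, 0 <= t ->
    pd_law Y (Some i) [set w | pd_state Y t w = Some j] = (p t i j)%:E.

Definition lifetime Y (w : Omega) : \bar R :=
  ereal_inf [set t%:E | t in [set t | 0 <= t /\ pd_state Y t w = None]].

End MarkovProcesses.

Arguments process_data R {d} Omega.

Section PiecingOut.
Context {R : realType} {d : measure_display} {Omega : measurableType d}.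
Variables (Y : process_data R Omega) (pi : probability NatCemB R).

Local Notation W := (Omega * NatCemB)%type.

(** [Omega] is abstract: the condition that [w] is the constant path at the trap
    is read off its trajectory. *)
Definition dead_path (w : Omega) : Prop :=
  forall t : R, 0 <= t -> pd_state Y t w = None.

Definition restart_law (w : Omega) : probability NatCemB R :=
  if `[< dead_path w >]
  then [the probability NatCemB R of dirac (None : NatCemB)] else pi.

(** The product sigma-algebra on sequences; the coordinate [w_i], [1 <= i], of
    the usual indexing is [w i.-1]. *)
Definition cylinders : set (set (nat -> W)) :=
  [set B | exists n, exists2 A : set W, measurable A & B = [set w | A (w n)]].

(** [Q_x[dw_1] Q_{y_1}[dw_2] ...] evaluated on the rectangle
    [w_1 \in A_1, w_2 \in A_2, ...]. *)
Fixpoint rectangle_prob (As : seq (set W)) (x : NatCem) : \bar R :=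
  if As is A :: As' then
    (\int[pd_law Y x]_w \int[restart_law w]_y
       ((\1_A (w, y))%:E * rectangle_prob As' y))%E
  else 1%E.

Definition piecing_out_law
    (Pt : NatCem -> probability (g_sigma_algebraType cylinders) R) : Prop :=
  forall (x : NatCem) (As : seq (set W)),
    (forall k, (k < size As)%N -> measurable (nth set0 As k)) ->
    Pt x [set w | forall k, (k < size As)%N -> nth set0 As k (w k)] =
    rectangle_prob As x.

Definition revived_state (t : R) (w : W) : NatCem :=
  if (t%:E < lifetime Y w.1)%E then pd_state Y t w.1 else w.2.

Definition revival_time (w : nat -> W) (n : nat) : \bar R :=
  (\sum_(0 <= i < n) lifetime Y (w i).1)%E.

Definition first_zero_lifetime (w : nat -> W) : \bar R :=
  ereal_inf [set i%:R%:E | i in [set i | lifetime Y (w i).1 = 0%E]].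

Definition final_time (w : nat -> W) : \bar R :=
  (\sum_(0 <= i <oo | i%:R%:E <= first_zero_lifetime w) lifetime Y (w i).1)%E.

(** The number of completed pieces at time [t]; unique when it exists. *)
Definition piece_index (t : R) (w : nat -> W) : nat :=
  xget 0%N [set n | (n = 0%N \/ (revival_time w n < t%:E)%E) /\
                    (t%:E <= revival_time w n.+1)%E].

(** The trapping clause takes precedence; where it overlaps the others they agree
    almost surely. *)
Definition pieced_state (t : R) (w : nat -> W) : NatCem :=
  if (final_time w <= t%:E)%E then None
  else let n := piece_index t w in
       revived_state (t - fine (revival_time w n)) (w n).

Definition is_piecing_out
    (Pt : NatCem -> probability (g_sigma_algebraType cylinders) R)
    (p : R -> nat -> nat -> R) : Prop :=
  forall (t : R) i j, 0 <= t ->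
    Pt (Some i) [set w | pieced_state t w = Some j] = (p t i j)%:E.

End PiecingOut.

(* Main.v *)
Require Import Defs.
From HB Require Import structures.
From mathcomp Require Import all_boot all_order all_algebra.
From mathcomp Require Import all_classical all_reals all_analysis.
From mathcomp Require Import measurable_realfun.
From mathcomp Require Import ring lra.
Set Implicit Arguments.
Unset Strict Implicit.
Unset Printing Implicit Defensive.
Import Order.TTheory GRing.Theory Num.Theory.
Import numFieldNormedType.Exports.
Local Open Scope classical_set_scope.
Local Open Scope ring_scope.

(** Write [R], [Phi] for the resolvents of [p] and [pmin], [u] for the Laplace
    transform of the lifetime of the minimal process and [S_i(t)] for its survival
    probability.  The limit of the truncated semigroups [exp (t Q_N)] is a
    Q-process whose row sums are at most [z_i / t], where [z] is the (finite) mean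
    hitting time of oo; by minimality [t S_i(t) <= z_i], and [z_i -> 0] makes
    [u(i) -> 1] and [Phi(i,j) -> 0] as [i -> oo].  Both [R(.,j) - Phi(.,j)] and [u]
    solve [alpha v = Q v], a one-dimensional space, so
    [R(i,j) = Phi(i,j) + u(i) F(j)], where [F(j) = lim_i R(i,j)] is the Ray
    resolvent at oo.  The Doob formula reads [F = pi R], and this is equivalent to
    [Pbar 0 rk_infty = pi] because [alpha (Rbar_alpha f)(oo)] tends to the integral
    of [f] under [Pbar 0 rk_infty], an integral which fixes [Rbar_alpha f] at oo.

    Conditioning the pieced-out process on its first piece gives the renewal
    equation [g_i(t) = pmin_ij(t) + E_i [(pi g)(t - zeta); zeta <= t]], whose Laplace
    transform is the Doob formula.  Conversely the transition functions of a Doob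
    process satisfy it by uniqueness of Laplace transforms, and it has only one
    bounded solution, being a contraction for the weight [expR (- t)]. *)

(** Minimality of [pmin] is only an inequality against other Q-processes, so any information on its
    lifetime has to come from a competitor; this is why a Q-process is built by truncation, where
    finite linear systems can be compared. Since u(i) tends to 1, a restart is not contracting
    uniformly in the starting point. The contraction appears only after averaging against pi: a
    single charged state brings the mean of u strictly below 1. Hence the fixed point argument
    concerns the averaged function pi g and not g itself. Uniqueness of Laplace transforms
    identifies two functions at every time only if both are right continuous. This is known for
    transition functions but is not established for the state probabilities of the pieced-out
    process; uniqueness for the renewal equation, which holds at each time, bridges the gap. In (3),
    a law without mass at oo forces oo to be branching: at a non-branching point [Pbar 0] would put
    no mass on any state or on the trap. *)

Section NonnegativeSeries.
Context {R : realType}.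
Implicit Types u v : nat -> R.

Lemma cvg_series_bounded_ge0 u (M : R) : (forall k, 0 <= u k) ->
  (forall n, \sum_(0 <= k < n) u k <= M) -> cvgn (series u).
Proof.
move=> u0 uM; apply: nondecreasing_is_cvgn.
  by apply/nondecreasing_seqP => n; rewrite /series/= big_nat_recr//= lerDl.
by exists M => _ [n _ <-]; exact: uM.
Qed.

Lemma lim_series_le u (M : R) : cvgn (series u) ->
  (forall n, \sum_(0 <= k < n) u k <= M) -> limn (series u) <= M.
Proof. by move=> cu uM; apply: limr_le => //; near=> n; exact: uM. Unshelve. all: by end_near. Qed.

Lemma lim_series_ge u n : (forall k, 0 <= u k) -> cvgn (series u) ->
  \sum_(0 <= k < n) u k <= limn (series u).
Proof.
move=> u0 cu; apply: (@nondecreasing_cvgn_le _ (series u)) => //.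
by apply/nondecreasing_seqP => m; rewrite /series/= big_nat_recr//= lerDl.
Qed.

Lemma nneseries_EFin u : cvgn (series u) ->
  (\sum_(0 <= k <oo) (u k)%:E)%E = (limn (series u))%:E.
Proof.
move=> cu; rewrite -EFin_lim//; congr (limn _); apply/funext => n /=.
by rewrite /series/= sumEFin.
Qed.

Lemma nneseries_le u (M : R) : (forall k, 0 <= u k) ->
  (\sum_(0 <= k <oo) (u k)%:E <= M%:E)%E ->
  forall n, \sum_(0 <= k < n) u k <= M.
Proof.
move=> u0 uM n; rewrite -lee_fin -sumEFin; apply: le_trans uM.
by apply: nneseries_lim_ge => k _ _; rewrite lee_fin.
Qed.

Lemma cvg_nneseries u (M : R) : (forall k, 0 <= u k) ->
  (\sum_(0 <= k <oo) (u k)%:E <= M%:E)%E -> cvgn (series u).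
Proof.
by move=> u0 uM; apply: (@cvg_series_bounded_ge0 _ M) => //; exact: nneseries_le.
Qed.

Lemma lim_series_ge0 u : (forall k, 0 <= u k) -> cvgn (series u) ->
  0 <= limn (series u).
Proof.
by move=> u0 cu; have := lim_series_ge 0 u0 cu; rewrite big_geq.
Qed.

End NonnegativeSeries.

Lemma cvg_sum_nat {R : realType} {T : Type} (F : set_system T) {FF : Filter F}
    (N : nat) (f : nat -> T -> R) (l : nat -> R) :
  (forall k, (k < N)%N -> f k x @[x --> F] --> l k) ->
  (\sum_(0 <= k < N) f k x) @[x --> F] --> \sum_(0 <= k < N) l k.
Proof.
elim: N => [|N IH] H.
  by rewrite big_geq//; under eq_fun do rewrite big_geq//; exact: cvg_cst.
rewrite big_nat_recr//=; under eq_fun do rewrite big_nat_recr//=.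
apply: cvgD; last exact: H.
by apply: IH => k kN; apply: H; rewrite ltnS ltnW.
Qed.

(** * Comparison principle for cooperative linear differential inequalities *)

Section Comparison.
Context {R : realType}.

Lemma ge0_derive_ge0 (f df : R -> R) (T : R) :
  (forall t, is_derive t (1 : R) f (df t)) ->
  0 <= f 0 -> (forall t, 0 <= t <= T -> 0 <= df t) ->
  forall t, 0 <= t <= T -> 0 <= f t.
Proof.
move=> fd f0 df0 t /andP[t0 tT]; apply: (le_trans f0).
have cf : continuous f.
  by move=> x; apply/differentiable_continuous/derivable1_diffP; have [] := fd x.
apply: (@ger0_derive1_ndecr _ f 0 t) => //.
- move=> x; rewrite in_itv/= => /andP[x0 xt].
  rewrite derive1E; have [_ ->] := fd x; apply: df0.
  by rewrite (ltW x0) (le_trans (ltW xt)).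
- exact: continuous_subspaceT.
Qed.

Lemma derivable_lower_bound (f df : R -> R) (T : R) :
  (forall t, is_derive t (1 : R) f (df t)) ->
  exists2 M, 0 <= M & forall t, 0 <= t <= T -> - M <= f t.
Proof.
move=> fd.
have cf : continuous f.
  by move=> x; apply/differentiable_continuous/derivable1_diffP; have [] := fd x.
have [T0|T0] := leP 0 T; last first.
  by exists 0 => // t /andP[t0 tT]; have := le_lt_trans (le_trans t0 tT) T0; rewrite ltxx.
have [c _ fc] := EVT_min T0 (continuous_subspaceT cf).
exists `|f c| => // t tT; apply: (@le_trans _ _ (f c)); last exact: fc.
by rewrite lerNl -normrN ler_norm.
Qed.

Lemma is_derive_expRM (c t : R) :
  is_derive t (1 : R) (fun s : R => expR (c * s)) (c * expR (c * t)).
Proof.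
have H : is_derive t (1 : R) (fun s : R => c * s) c.
  have := @is_deriveZ _ _ _ id c t 1 1 (is_derive_id _ _).
  by rewrite [_ *: 1]mulr1.
by rewrite mulrC; exact: (@is_derive1_comp _ expR (fun s => c * s)).
Qed.

(* Each use of the differential inequality halves the lower bound [- M * expR (2 K t)]. *)
Lemma cooperative_nonneg_aux (N : nat) (A : nat -> nat -> R) (x dx : nat -> R -> R) :
  (forall i k, 0 <= A i k) ->
  (forall i, (i < N)%N -> forall t, is_derive t (1 : R) (x i) (dx i t)) ->
  (forall i, (i < N)%N -> forall t, 0 <= t ->
     \sum_(0 <= k < N) A i k * x k t <= dx i t) ->
  (forall i, (i < N)%N -> 0 <= x i 0) ->
  forall i, (i < N)%N -> forall t, 0 <= t -> 0 <= x i t.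
Proof.
move=> A0 xd xA x0.
have [K K0 AK] : exists2 K, 0 <= K & forall i, (i < N)%N -> \sum_(0 <= k < N) A i k <= K.
  exists (\sum_(0 <= i < N) \sum_(0 <= k < N) A i k).
    by apply: sumr_ge0 => i _; exact: sumr_ge0.
  move=> i iN; rewrite [leRHS]big_mkord (bigD1 (Ordinal iN))//= lerDl.
  by apply: sumr_ge0 => j _; exact: sumr_ge0.
have bnd T : exists2 M, 0 <= M & forall i, (i < N)%N -> forall t, 0 <= t <= T -> - M <= x i t.
  have /choice[M HM] : forall i, exists M, 0 <= M /\
      ((i < N)%N -> forall t, 0 <= t <= T -> - M <= x i t).
    move=> i; have [iN|] := boolP (i < N)%N; last by exists 0.
    by have [M M0 HM] := derivable_lower_bound T (xd i iN); exists M.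
  exists (\sum_(0 <= i < N) M i); first by apply: sumr_ge0 => i _; have [] := HM i.
  move=> i iN t tT; have [_ H] := HM i; apply: le_trans (H iN t tT).
  rewrite lerN2 big_mkord (bigD1 (Ordinal iN))//= lerDl.
  by apply: sumr_ge0 => j _; have [] := HM j.
move=> i iN t t0; have [M M0 HM] := bnd t.
have step n : forall i, (i < N)%N -> forall s, 0 <= s <= t ->
    - (M * (2^-1) ^+ n * expR (2 * K * s)) <= x i s.
  elim: n => [j jN s /andP[s0 st]|n IH j jN].
    apply: le_trans (HM _ jN _ _); last by rewrite s0.
    rewrite lerN2 expr0 mulr1 ler_peMr// -expR0 ler_expR.
    by rewrite !mulr_ge0.
  pose c := M * 2^-1 ^+ n.+1.
  have c0 : 0 <= c by rewrite mulr_ge0// exprn_ge0// invr_ge0.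
  have E : M * 2^-1 ^+ n = 2 * c by rewrite /c exprS; field.
  move=> s sT; rewrite lerNl -subr_ge0 opprK addrC.
  (* The rate 2 K is twice the bound on the row sums: the derivative of the added term pays exactly
     for K times the previous bound 2 c expR (2 K r). *)
  pose g (r : R) := x j r + c * expR (2 * K * r).
  rewrite -[leRHS]/(g s); move: s sT.
  apply: (@ge0_derive_ge0 _ (fun r => dx j r + c * (2 * K * expR (2 * K * r)))) => [r||].
  - by apply: is_deriveD; [exact: xd|apply: is_deriveZ; exact: is_derive_expRM].
  - by rewrite /g addr_ge0 ?x0// mulr_ge0// expR_ge0.
  - move=> r /andP[r0 rt].
    apply: (@le_trans _ _ (\sum_(0 <= k < N) A j k * x k r + c * (2 * K * expR (2 * K * r)))); last first.
      by rewrite lerD2r; exact: xA.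
    rewrite -[leLHS](subrr (c * (2 * K * expR (2 * K * r)))) addrC lerD2r.
    apply: (@le_trans _ _ (\sum_(0 <= k < N) A j k * - (2 * c * expR (2 * K * r)))).
      rewrite -mulr_suml mulrN lerN2.
      have := AK j jN; have := expR_ge0 (2 * K * r); set e := expR _ => e0 AKj.
      have -> : c * (2 * K * e) = K * (2 * c * e) by ring.
      by rewrite ler_wpM2r// !mulr_ge0.
    rewrite !big_mkord; apply: ler_sum => k _.
    by rewrite ler_wpM2l// -E; apply: IH => //; rewrite r0.
have L : (- (M * 2^-1 ^+ n * expR (2 * K * t))) @[n --> \oo] --> (0 : R).
  rewrite -oppr0; apply: cvgN.
  rewrite -[X in _ --> X](mul0r (expR (2 * K * t))); apply: cvgM; last exact: cvg_cst.
  rewrite -[X in _ --> X](mulr0 M); apply: cvgM; first exact: cvg_cst.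
  by apply: cvg_expr; rewrite ger0_norm ?invr_ge0// invf_lt1// ltr1n.
rewrite -(cvg_lim _ L)//; apply: limr_le; first by apply/cvg_ex; eexists; exact: L.
by near=> n; apply: step => //; rewrite t0 lexx.
Unshelve. all: by end_near. Qed.

(** Multiplying by [expR (c * t)] preserves signs and adds c to the diagonal, and c is chosen to
    make the diagonal entries below N nonnegative. *)
Lemma cooperative_nonneg (N : nat) (A : nat -> nat -> R) (x dx : nat -> R -> R) :
  (forall i k, i != k -> 0 <= A i k) ->
  (forall i, (i < N)%N -> forall t, is_derive t (1 : R) (x i) (dx i t)) ->
  (forall i, (i < N)%N -> forall t, 0 <= t ->
     \sum_(0 <= k < N) A i k * x k t <= dx i t) ->
  (forall i, (i < N)%N -> 0 <= x i 0) ->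
  forall i, (i < N)%N -> forall t, 0 <= t -> 0 <= x i t.
Proof.
move=> A0 xd xA x0.
pose c := \sum_(0 <= i < N) `|A i i|.
have cA i : (i < N)%N -> 0 <= A i i + c.
  move=> iN; rewrite /c big_mkord (bigD1 (Ordinal iN))//= addrA addr_ge0//.
    by rewrite -lerBlDl sub0r -normrN ler_norm.
  exact: sumr_ge0.
(* Below N the absolute value changes nothing; it makes [B] nonnegative at all indices, as the
   auxiliary lemma asks. *)
pose B i k := if i == k then `|A i i + c| else A i k.
move=> i iN t t0.
have /(_ _ t0) : forall t, 0 <= t -> 0 <= expR (c * t) * x i t.
  move=> s; move: s.
  apply: (@cooperative_nonneg_aux N B (fun i s => expR (c * s) * x i s)
    (fun i s => expR (c * s) * dx i s + x i s * (c * expR (c * s)))) => //.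
  - by move=> j k; rewrite /B; case: eqP => // /eqP; exact: A0.
  - move=> j jN s.
    by apply: is_deriveM; [exact: is_derive_expRM|exact: xd].
  - move=> j jN s s0.
    have -> : x j s * (c * expR (c * s)) = expR (c * s) * (c * x j s) by ring.
    rewrite -mulrDr.
    have -> : \sum_(0 <= k < N) B j k * (expR (c * s) * x k s) =
        expR (c * s) * \sum_(0 <= k < N) B j k * x k s.
      by rewrite mulr_sumr; apply: eq_bigr => k _; ring.
    rewrite ler_wpM2l ?expR_ge0//.
    apply: (@le_trans _ _ (\sum_(0 <= k < N) A j k * x k s + c * x j s)); last by rewrite lerD2r xA.
    rewrite !big_mkord (bigD1 (Ordinal jN))//= [X in _ <= X + _](bigD1 (Ordinal jN))//=.
    rewrite /B eqxx ger0_norm ?cA//.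
    have -> : \sum_(i0 < N | i0 != Ordinal jN) (if j == i0 then A j j + c else A j i0) * x i0 s =
      \sum_(i0 < N | i0 != Ordinal jN) A j i0 * x i0 s.
      apply: eq_bigr => k kj; rewrite ifN//; apply: contra kj => /eqP kj.
      by rewrite -val_eqE /= kj.
    by rewrite mulrDl addrAC.
  - by move=> j jN; rewrite mulr_ge0 ?expR_ge0 ?x0.
by rewrite pmulr_rge0// expR_gt0.
Qed.

End Comparison.

(** * Truncated birth-death generators *)

Section TruncatedExponential.
Context {R : realType}.

(** Exponential generating function of g. When g n is an entry of the n-th power of a matrix, this
    is the entry of the exponential, and shifting g differentiates it. *)
Definition egf (g : nat -> R) (t : R) : R := limn (pseries (fun n => g n / n`!%:R) t).

Lemma cvg_egf (g : nat -> R) (C K t : R) :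
  (forall n, `|g n| <= C * K ^+ n) -> cvgn (pseries (fun n => g n / n`!%:R) t).
Proof.
move=> gCK; apply: normed_cvg.
have := @is_cvg_seriesZ _ _ C (@is_cvg_series_exp_coeff R (`|K| * `|t|)).
apply: series_le_cvg => [n|n|n]; rewrite /normed_series_of ?normr_ge0//=.
  have C0 : 0 <= C by have := le_trans (normr_ge0 _) (gCK 0%N); rewrite expr0 mulr1.
  by rewrite mulr_ge0// exp_coeff_ge0// mulr_ge0.
rewrite /exp_coeff/= normrM normrM normfV normr_nat normrX -!mulrA.
rewrite [X in _ <= X](_ : _ = C * `|K| ^+ n * (n`!%:R^-1 * `|t| ^+ n)).
  rewrite ler_wpM2r// ?mulr_ge0 ?invr_ge0 ?exprn_ge0//.
  apply: (le_trans (gCK n)); apply: (le_trans (ler_norm _)).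
  rewrite normrM normrX ler_wpM2r ?exprn_ge0// ger0_norm//.
  by have := le_trans (normr_ge0 _) (gCK 0%N); rewrite expr0 mulr1.
by rewrite fctE /GRing.scale/= exprMn; ring.
Qed.

Lemma egf0 (g : nat -> R) : egf g 0 = g 0%N.
Proof.
apply: lim_near_cst => //; near=> n; rewrite -[n]prednK; last by near: n; exists 1%N.
rewrite /pseries /series/= big_nat_recl// big1 ?addr0; first by rewrite expr0 mulr1 fact0 divr1.
by move=> i _; rewrite expr0n mulr0.
Unshelve. all: by end_near. Qed.

Lemma is_derive_egf (g : nat -> R) (C K t : R) :
  (forall n, `|g n| <= C * K ^+ n) ->
  is_derive t (1 : R) (egf g) (egf (fun n => g n.+1) t).
Proof.
move=> gCK.
have E h : pseries_diffs (fun n => h n / n`!%:R : R) = (fun n => h n.+1 / n`!%:R).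
  by apply/funext => n; rewrite /pseries_diffs factS natrM invfM mulrCA mulVKf// pnatr_eq0.
(* Termwise differentiation asks for convergence of the series and of its first two derived series
   at a point beyond t. *)
have cK m : cvgn (pseries (fun n => g (n + m)%N / n`!%:R) (`|t| + 1)).
  apply: (@cvg_egf _ (C * K ^+ m) K) => n; apply: le_trans (gCK _) _.
  by rewrite addnC exprD mulrA.
rewrite /egf -E; apply: (@pseries_snd_diffs _ _ (`|t| + 1)).
- by have := cK 0%N; under eq_fun do rewrite addn0.
- by rewrite E; have := cK 1%N; under eq_fun do rewrite addn1.
- by rewrite E (E (fun n => g n.+1)); have := cK 2%N; under eq_fun do rewrite addn2.
- by rewrite [ltRHS]ger0_norm ?addr_ge0// ltrDl.
Qed.

Variables (N : nat) (A : nat -> nat -> R).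

(** Powers of the N-by-N corner of A, indexed by [nat] rather than by ordinals so that truncations
    of different sizes can be compared entrywise. *)
Fixpoint mxpow (n i j : nat) : R :=
  if n is m.+1 then \sum_(0 <= k < N) A i k * mxpow m k j else (i == j)%:R.

Definition mxexp (t : R) (i j : nat) : R := egf (fun n => mxpow n i j) t.

Lemma mxpow_bound : exists K : R, forall n i j, (i < N)%N -> `|mxpow n i j| <= 1 * K ^+ n.
Proof.
exists (\sum_(0 <= i < N) \sum_(0 <= k < N) `|A i k|).
set K := \sum_(_ <= _ < _) _; have K0 : 0 <= K by do 2 (apply: sumr_ge0 => ? _).
have AK i : (i < N)%N -> \sum_(0 <= k < N) `|A i k| <= K.
  move=> iN; rewrite [leRHS]big_mkord (bigD1 (Ordinal iN))//= lerDl.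
  by apply: sumr_ge0 => j _; exact: sumr_ge0.
elim=> [|n IH] i j iN; first by rewrite /= mul1r expr0 normr_nat; case: (i == j).
rewrite /= (le_trans (ler_norm_sum _ _ _))//.
apply: (@le_trans _ _ (\sum_(0 <= k < N) `|A i k| * (1 * K ^+ n))).
  by rewrite !big_mkord; apply: ler_sum => k _; rewrite normrM ler_wpM2l ?IH.
by rewrite -mulr_suml !mul1r exprS ler_wpM2r ?exprn_ge0 ?AK.
Qed.

Lemma mxexp0 i j : mxexp 0 i j = (i == j)%:R.
Proof. by rewrite /mxexp egf0. Qed.

(** The backward form arises because [mxpow] recurses on the left factor: the shifted coefficients
    are A applied to the old ones. *)
Lemma is_derive_mxexp i j t : (i < N)%N ->
  is_derive t (1 : R) (fun s => mxexp s i j) (\sum_(0 <= k < N) A i k * mxexp t k j).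
Proof.
move=> iN; have [K HK] := mxpow_bound.
apply: is_derive_eq; first exact: (@is_derive_egf _ 1 K _ (fun n => HK n i j iN)).
rewrite /mxexp /egf; apply: cvg_lim => //.
have H k : (k < N)%N ->
    (fun m => A i k * pseries (fun n => mxpow n k j / n`!%:R) t m) @ \oo -->
    A i k * limn (pseries (fun n => mxpow n k j / n`!%:R) t).
  move=> kN; apply: cvgM; first exact: cvg_cst.
  by apply: (@cvg_egf _ 1 K t) => n; exact: HK.
rewrite [X in X @ \oo --> _](_ : _ = fun m => \sum_(0 <= k < N)
    A i k * pseries (fun n => mxpow n k j / n`!%:R) t m).
  exact: cvg_sum_nat.
apply/funext => m; rewrite /pseries /series/=.
under [RHS]eq_bigr do rewrite mulr_sumr.
rewrite exchange_big/=; apply: eq_bigr => n _.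
by rewrite !mulr_suml; apply: eq_bigr => k _; ring.
Qed.

End TruncatedExponential.

Lemma is_derive_sum_nat {R : realType} (N : nat) (f df : nat -> R -> R) (t : R) :
  (forall k, (k < N)%N -> is_derive t (1 : R) (f k) (df k t)) ->
  is_derive t (1 : R) (fun s => \sum_(0 <= k < N) f k s) (\sum_(0 <= k < N) df k t).
Proof.
elim: N => [|N IH] H.
  by rewrite big_geq//; under eq_fun do rewrite big_geq//; exact: is_derive_cst.
rewrite big_nat_recr//=; under eq_fun do rewrite big_nat_recr//=.
apply: is_deriveD; last exact: H.
by apply: IH => k kN; apply: H; rewrite ltnS ltnW.
Qed.

Lemma is_derive_shiftr {R : realType} (f df : R -> R) (s t : R) :
  is_derive (t + s) (1 : R) f (df (t + s)) ->
  is_derive t (1 : R) (fun r => f (r + s)) (df (t + s)).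
Proof.
move=> H; rewrite -[df _]mulr1.
have D : is_derive t (1 : R) (fun r : R => r + s) (1 : R).
  by have := is_deriveD (is_derive_id t 1) (is_derive_cst s t 1); rewrite addr0.
exact: (@is_derive1_comp _ f (fun r => r + s)).
Qed.

Lemma cooperative_unique {R : realType} (N : nat) (A : nat -> nat -> R) (x dx y dy : nat -> R -> R) :
  (forall i k, i != k -> 0 <= A i k) ->
  (forall i, (i < N)%N -> forall t, is_derive t (1 : R) (x i) (dx i t)) ->
  (forall i, (i < N)%N -> forall t, is_derive t (1 : R) (y i) (dy i t)) ->
  (forall i t, \sum_(0 <= k < N) A i k * x k t = dx i t) ->
  (forall i t, \sum_(0 <= k < N) A i k * y k t = dy i t) ->
  (forall i, (i < N)%N -> x i 0 = y i 0) ->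
  forall i, (i < N)%N -> forall t, 0 <= t -> x i t = y i t.
Proof.
move=> A0 xd yd xA yA xy0 i iN t t0.
apply/eqP; rewrite eq_le; apply/andP; split; rewrite -subr_ge0.
- apply: (@cooperative_nonneg _ N A (fun k r => y k r - x k r) (fun k r => dy k r - dx k r)) => //.
  + by move=> k kN r; apply: is_deriveB; [exact: yd|exact: xd].
  + move=> k kN r _; under eq_bigr do rewrite mulrBr.
    by rewrite sumrB xA yA.
  + by move=> k kN; rewrite xy0// subrr.
- apply: (@cooperative_nonneg _ N A (fun k r => x k r - y k r) (fun k r => dx k r - dy k r)) => //.
  + by move=> k kN r; apply: is_deriveB; [exact: xd|exact: yd].
  + move=> k kN r _; under eq_bigr do rewrite mulrBr.
    by rewrite sumrB xA yA.
  + by move=> k kN; rewrite xy0// subrr.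
Qed.

Section TruncatedBirthDeath.
Context {R : realType} (a b : nat -> R).
Hypothesis a0 : a 0%N = 0.
Hypothesis a_gt0 : forall k, (0 < k)%N -> 0 < a k.
Hypothesis b_gt0 : forall k, 0 < b k.

Let a_ge0 k : 0 <= a k.
Proof. by case: k => [|k]; [rewrite a0|rewrite ltW// a_gt0]. Qed.

Lemma bd_matrix_ge0 i k : i != k -> 0 <= bd_matrix a b i k.
Proof.
rewrite /bd_matrix eq_sym => /negPf ->.
by case: ifP => _; [exact: ltW|case: ifP].
Qed.

Lemma sum_nat_delta (N m : nat) (c : R) (v : nat -> R) :
  \sum_(0 <= k < N) (if k == m then c else 0) * v k = (m < N)%:R * (c * v m).
Proof.
rewrite big_mkord; case: ltnP => mN.
  rewrite (bigD1 (Ordinal mN))//= eqxx mul1r big1 ?addr0// => k.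
  by rewrite -val_eqE/= => /negPf ->; rewrite mul0r.
rewrite mul0r big1// => k _; rewrite ifF ?mul0r//.
by apply/negbTE; rewrite neq_ltn (leq_trans (ltn_ord k)).
Qed.

(** Difference form of a row of the truncated generator. The factor [(i.+1 < N)] removes the jump
    from N - 1 to N, so the truncated chain is killed when it leaves the first N states. *)
Lemma bd_matrix_sum (N i : nat) (v : nat -> R) : (i < N)%N ->
  \sum_(0 <= k < N) bd_matrix a b i k * v k =
  a i * (v i.-1 - v i) + b i * ((i.+1 < N)%:R * v i.+1 - v i).
Proof.
move=> iN.
(* For i = 0 the indices i and [i.-1] coincide, and [a 0 = 0] makes the overlap harmless. *)
have E k : bd_matrix a b i k * v k = (if k == i then - (a i + b i) else 0) * v k +
   (if k == i.+1 then b i else 0) * v k + (if k == i.-1 then a i else 0) * v k.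
  rewrite /bd_matrix; case: (eqVneq k i) => [->|ki].
    rewrite ifF; last by rewrite eqn_leq ltnn andbF.
    case: ifP => [|_]; last by ring.
    by case: (i) => [|n]; rewrite ?a0 ?eqn_leq ?ltnn//= => _; ring.
  case: (eqVneq k i.+1) => [->|ki1].
    rewrite ifF; first by ring.
    by apply/negbTE; rewrite neq_ltn ltnS leq_pred orbT.
  have -> : (k.+1 == i) = (k == i.-1).
    case: (i) ki => [|n]//=; by move=> /negPf ->.
  by case: ifP => _; ring.
under eq_bigr do rewrite E.
rewrite !big_split/= !sum_nat_delta iN (leq_ltn_trans (leq_pred _) iN) !mul1r.
by ring.
Qed.

Local Notation P N t i j := (mxexp N (bd_matrix a b) t i j).

Lemma mxexp_bd_ge0 (N i j : nat) (t : R) : (i < N)%N -> 0 <= t -> 0 <= P N t i j.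
Proof.
move=> iN t0; pose x k s := P N s k j.
pose dx i s := \sum_(0 <= k < N) bd_matrix a b i k * P N s k j.
apply: (@cooperative_nonneg _ N _ x dx bd_matrix_ge0) => //.
- by move=> k kN s; exact: is_derive_mxexp.
- by move=> k kN; rewrite /x mxexp0.
Qed.

(** The truncated generator maps the constant 1 to a nonpositive vector, its last row having lost
    the rate of the jump to N. Hence the defect, which starts at 0, satisfies the comparison
    principle. *)
Lemma mxexp_bd_row (N i : nat) (t : R) : (i < N)%N -> 0 <= t ->
  \sum_(0 <= j < N) P N t i j <= 1.
Proof.
move=> iN t0; rewrite -subr_ge0.
pose x k s := 1 - \sum_(0 <= j < N) P N s k j.
pose dx i s := 0 - \sum_(0 <= j < N) \sum_(0 <= k < N) bd_matrix a b i k * P N s k j.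
apply: (@cooperative_nonneg _ N _ x dx bd_matrix_ge0) => //.
- move=> k kN s; apply: is_deriveB.
  apply: (@is_derive_sum_nat _ N (fun j s => P N s k j)
     (fun j s => \sum_(0 <= l < N) bd_matrix a b k l * P N s l j)) => j jN.
  exact: is_derive_mxexp.
- move=> k kN s s0; rewrite /dx exchange_big/= -subr_ge0.
  have -> : \sum_(0 <= l < N) bd_matrix a b k l * x l s =
    \sum_(0 <= l < N) bd_matrix a b k l * 1 -
    \sum_(0 <= l < N) \sum_(0 <= j < N) bd_matrix a b k l * P N s l j.
    rewrite -sumrB; apply: eq_bigr => l _; rewrite /x mulrBr; congr (_ - _).
    by rewrite mulr_sumr.
  rewrite opprB sub0r addrA [X in _ <= X - _]addrC subrr sub0r bd_matrix_sum//.
  rewrite subrr mulr0 add0r mulr1.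
  by rewrite -mulrN opprB mulr_ge0 ?(ltW (b_gt0 _))// subr_ge0; case: (k.+1 < N)%N; rewrite ?mul1r ?mul0r.
- move=> k kN; rewrite /x subr_ge0 big_mkord (bigD1 (Ordinal kN))//= mxexp0 eqxx.
  rewrite big1 ?addr0// => l; rewrite -val_eqE/= mxexp0 eq_sym.
  by move=> /negPf ->.
Qed.

(** As functions of s both sides solve the same linear system with the same initial values. *)
Lemma mxexp_bd_semigroup (N i j : nat) (s t : R) : (i < N)%N -> 0 <= s -> 0 <= t ->
  P N (s + t) i j = \sum_(0 <= k < N) P N s i k * P N t k j.
Proof.
move=> iN s0 t0.
pose y k r := \sum_(0 <= l < N) P N r k l * P N t l j.
pose dy i r := \sum_(0 <= l < N) (\sum_(0 <= k < N) bd_matrix a b i k * P N r k l) * P N t l j.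
pose x k r := P N (r + t) k j.
pose dx i r := \sum_(0 <= k < N) bd_matrix a b i k * P N (r + t) k j.
have xd k : (k < N)%N -> forall r, is_derive r (1 : R) (x k) (dx k r).
  move=> kN r; apply: (@is_derive_shiftr _ (fun r => P N r k j)
    (fun r => \sum_(0 <= l < N) bd_matrix a b k l * P N r l j)).
  exact: is_derive_mxexp.
have yd k : (k < N)%N -> forall r, is_derive r (1 : R) (y k) (dy k r).
  move=> kN r; apply: (@is_derive_sum_nat _ N (fun l r => P N r k l * P N t l j)
    (fun l r => (\sum_(0 <= m < N) bd_matrix a b k m * P N r m l) * P N t l j)) => l lN.
  rewrite [X in is_derive _ _ _ X]mulrC.
  under eq_fun do rewrite mulrC.
  exact: is_deriveZ (is_derive_mxexp (bd_matrix a b) l r kN).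
have xA k r : \sum_(0 <= l < N) bd_matrix a b k l * x l r = dx k r by [].
have yA k r : \sum_(0 <= l < N) bd_matrix a b k l * y l r = dy k r.
  rewrite /y /dy; under eq_bigr do rewrite mulr_sumr; rewrite exchange_big/=.
  by apply: eq_bigr => l _; rewrite mulr_suml; apply: eq_bigr => m _; rewrite mulrA.
have xy0 k : (k < N)%N -> x k 0 = y k 0.
  move=> kN; rewrite /x /y add0r.
  under eq_bigr do rewrite mxexp0.
  have := sum_nat_delta N k 1 (fun l => P N t l j); rewrite kN !mul1r => <-.
  by apply: eq_bigr => l _; rewrite eq_sym; case: eqP.
rewrite -[LHS]/(x i s) -[RHS]/(y i s).
exact: (cooperative_unique bd_matrix_ge0 xd yd).
Qed.

(** The difference solves the smaller system with a nonnegative source, namely the contribution of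
    state N to the larger one. *)
Lemma mxexp_bd_mono (N i j : nat) (t : R) : (i < N)%N -> 0 <= t ->
  P N t i j <= P N.+1 t i j.
Proof.
move=> iN t0; rewrite -subr_ge0.
pose x k s := P N.+1 s k j - P N s k j.
pose dx i s := \sum_(0 <= k < N.+1) bd_matrix a b i k * P N.+1 s k j -
  \sum_(0 <= k < N) bd_matrix a b i k * P N s k j.
apply: (@cooperative_nonneg _ N _ x dx bd_matrix_ge0) => //.
- move=> k kN s; apply: is_deriveB; first by apply: is_derive_mxexp; rewrite ltnS ltnW.
  exact: is_derive_mxexp.
- move=> k kN s s0; rewrite /dx big_nat_recr//= /x.
  under eq_bigr do rewrite mulrBr.
  rewrite sumrB addrAC lerDl mulr_ge0//; first by rewrite bd_matrix_ge0// neq_ltn kN.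
  exact: mxexp_bd_ge0.
- by move=> k kN; rewrite /x !mxexp0 subrr.
Qed.

(** This is Markov's inequality for the exit time, obtained by comparison. With S the row sum, the
    truncated generator maps z to at most -1, because dropping [z N] in the last row only lowers it,
    and -1 is at most -S; so z - s S satisfies the differential inequality. *)
Lemma mxexp_bd_potential (z : nat -> R) (N i : nat) (t : R) :
  (forall k, 0 <= z k) ->
  (forall k, b k * (z k - z k.+1) = 1 + a k * (z k.-1 - z k)) ->
  (i < N)%N -> 0 <= t ->
  t * \sum_(0 <= j < N) P N t i j <= z i.
Proof.
move=> z0 zQ iN t0; rewrite -subr_ge0.
pose S k s := \sum_(0 <= j < N) P N s k j.
pose dS k s := \sum_(0 <= j < N) \sum_(0 <= l < N) bd_matrix a b k l * P N s l j.
pose x k s := z k - s * S k s.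
rewrite -[leRHS]/(x i t).
apply: (@cooperative_nonneg _ N _ x (fun k s => 0 - (s * dS k s + S k s * 1)) bd_matrix_ge0) => //.
- move=> k kN s; apply: is_deriveB.
  have H : is_derive s (1 : R) (S k) (dS k s).
    apply: (@is_derive_sum_nat _ N (fun j s => P N s k j)
     (fun j s => \sum_(0 <= l < N) bd_matrix a b k l * P N s l j)) => j jN.
    exact: is_derive_mxexp.
  exact: is_deriveM.
- move=> k kN s s0.
  have -> : \sum_(0 <= l < N) bd_matrix a b k l * x l s =
    \sum_(0 <= l < N) bd_matrix a b k l * z l - s * dS k s.
    rewrite /dS exchange_big/= mulr_sumr -sumrB; apply: eq_bigr => l _.
    by rewrite /x mulrBr mulrCA; congr (_ - s * _); rewrite /S mulr_sumr.
  rewrite sub0r opprD mulr1 [leRHS]addrC lerD2r bd_matrix_sum//.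
  have := zQ k; have := mxexp_bd_row kN s0; rewrite -/(S k s).
  have := ltW (b_gt0 k); have := z0 k.+1.
  case: (k.+1 < N)%N => /=; rewrite ?mul1r ?mul0r; first by lra.
  by move=> zk bk; have := mulr_ge0 bk zk; lra.
- by move=> k kN; rewrite /x mul0r subr0.
Qed.

End TruncatedBirthDeath.

(** * Survival of the minimal process *)

Section Potential.
Context {R : realType} (a b : nat -> R).
Hypothesis a0 : a 0%N = 0.
Hypothesis a_gt0 : forall k, (0 < k)%N -> 0 < a k.
Hypothesis b_gt0 : forall k, 0 < b k.

Let PA k := \prod_(1 <= l < k.+1) a l.
Let PB k := \prod_(0 <= l < k) b l.

Let PA_gt0 k : 0 < PA k.
Proof. by rewrite /PA big_nat; apply: prodr_gt0 => l /andP[l0 _]; exact: a_gt0. Qed.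

Let PB_gt0 k : 0 < PB k.
Proof. by apply: prodr_gt0. Qed.

Lemma bd_scaleB k : bd_scale a b k.+1 - bd_scale a b k = PA k / (2 * PB k.+1).
Proof.
case: k => [|k].
  by rewrite /bd_scale/= /PA /PB big_geq// addr0 subr0 big_geq// big_nat1.
rewrite /bd_scale [LHS]/= [X in _ + X - _]big_nat_recr//=.
by rewrite addrA [X in X - _]addrC addrK.
Qed.

(* [z k] is the mean hitting time of oo from [k]; it solves Q z = -1. *)
Lemma bd_potential : (bd_sigma a b < +oo)%E ->
  exists z : nat -> R, [/\ forall k, 0 <= z k, z @ \oo --> 0 &
    forall k, b k * (z k - z k.+1) = 1 + a k * (z k.-1 - z k)].
Proof.
move=> sfin.
pose d k := (bd_scale a b k.+1 - bd_scale a b k) * \sum_(0 <= i < k.+1) bd_mu a b i.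
have mu0 k : 0 <= bd_mu a b k by rewrite /bd_mu divr_ge0// ltW// -/(PA k) -/(PB k).
have d0 k : 0 <= d k.
  rewrite /d bd_scaleB mulr_ge0// ?sumr_ge0// divr_ge0// ?mulr_ge0 ?ltW//.
have dfin : (\sum_(0 <= k <oo) (d k)%:E)%E \is a fin_num.
  by rewrite ge0_fin_numE// nneseries_ge0// => k _ _; rewrite lee_fin.
have cd : cvgn (series d).
  apply: (@cvg_nneseries _ _ (fine (\sum_(0 <= k <oo) (d k)%:E)%E)) => //.
  by rewrite fineK.
(* Twice the tail of the series defining sigma: the factor 2 undoes the halves built into
   [bd_scale], and being a tail gives the limit 0. *)
pose z k := 2 * (limn (series d) - series d k).
have dz k : z k - z k.+1 = 2 * d k.
  by rewrite /z /series/= big_nat_recr//=; ring.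
exists z; split.
- by move=> k; rewrite mulr_ge0// subr_ge0; exact: lim_series_ge.
- have -> : 0 = 2 * (limn (series d) - limn (series d)) by rewrite subrr mulr0.
  by apply: cvgM; [exact: cvg_cst|apply: cvgB; [exact: cvg_cst|]].
- move=> k; rewrite dz /d bd_scaleB big_nat_recr//= /bd_mu -/(PA k) -/(PB k).
  have -> : PB k.+1 = PB k * b k by rewrite /PB big_nat_recr.
  have bk := lt0r_neq0 (b_gt0 k).
  have PAk := lt0r_neq0 (PA_gt0 k); have PBk := lt0r_neq0 (PB_gt0 k).
  case: k bk PAk PBk => [|k] bk PAk PBk.
    rewrite a0 mul0r addr0 [\sum_(_ <= _ < _) _]big_geq// add0r.
    by field; rewrite bk PAk PBk.
  rewrite /= dz /d bd_scaleB.
  have -> : PA k.+1 = PA k * a k.+1 by rewrite /PA big_nat_recr.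
  have ak := lt0r_neq0 (a_gt0 (ltn0Sn k)).
  have PAk' := lt0r_neq0 (PA_gt0 k).
  by field; rewrite bk PAk' PBk ak.
Qed.

End Potential.

Section ExplodingProcess.
Context {R : realType} (a b : nat -> R).
Hypothesis a0 : a 0%N = 0.
Hypothesis a_gt0 : forall k, (0 < k)%N -> 0 < a k.
Hypothesis b_gt0 : forall k, 0 < b k.

(** Extended by 0 outside the N-by-N corner, where [mxexp] has no probabilistic meaning; this makes
    the family monotone in N at every entry. *)
Definition trunc_bd (N : nat) (t : R) (i j : nat) : R :=
  if (i < N)%N && (j < N)%N then mxexp N (bd_matrix a b) t i j else 0.

(** The chain killed at its explosion, as an increasing limit. It is the competitor against which
    the minimality of [pmin] is used. *)
Definition killed_bd (t : R) (i j : nat) : R := limn (fun N => trunc_bd N t i j).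

Local Notation pN := trunc_bd.
Local Notation p := killed_bd.

Lemma trunc_bd_ge0 N t i j : 0 <= t -> 0 <= pN N t i j.
Proof.
by move=> t0; rewrite /trunc_bd; case: ifP => // /andP[iN jN]; exact: mxexp_bd_ge0.
Qed.

Lemma trunc_bd_row N M t i : 0 <= t -> (M <= N)%N -> \sum_(0 <= j < M) pN N t i j <= 1.
Proof.
move=> t0 MN; have [iN|iN] := boolP (i < N)%N; last first.
  by rewrite big1// => j _; rewrite /trunc_bd (negbTE iN).
apply: (@le_trans _ _ (\sum_(0 <= j < N) pN N t i j)).
  rewrite (big_cat_nat (n := M) (p := N))//= lerDl; apply: sumr_ge0 => j _; exact: trunc_bd_ge0.
rewrite (eq_big_nat _ _ (F2 := fun j => mxexp N (bd_matrix a b) t i j)).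
  exact: mxexp_bd_row.
by move=> j /andP[_ jN]; rewrite /trunc_bd iN jN.
Qed.

Lemma trunc_bd_nd t i j : 0 <= t -> {homo (fun N => pN N t i j) : n m / (n <= m)%N >-> n <= m}.
Proof.
move=> t0; apply/nondecreasing_seqP => N.
rewrite {1}/trunc_bd; case: ifP => [/andP[iN jN]|_]; last exact: trunc_bd_ge0.
by rewrite /trunc_bd ltnS (ltnW iN) ltnS (ltnW jN)/=; exact: mxexp_bd_mono.
Qed.

Lemma trunc_bd_le1 N t i j : 0 <= t -> pN N t i j <= 1.
Proof.
move=> t0; have [jN|jN] := boolP (j < N)%N; last by rewrite /trunc_bd (negbTE jN) andbF.
apply: le_trans (trunc_bd_row i t0 (leqnn N)).
rewrite big_mkord (bigD1 (Ordinal jN))//= lerDl; apply: sumr_ge0 => k _; exact: trunc_bd_ge0.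
Qed.

Lemma trunc_bd_cvg t i j : 0 <= t -> (fun N => pN N t i j) @ \oo --> p t i j.
Proof.
move=> t0; apply: nondecreasing_is_cvgn; first exact: trunc_bd_nd.
by exists 1 => _ [N _ <-]; exact: trunc_bd_le1.
Qed.

Lemma trunc_bd_le N t i j : 0 <= t -> pN N t i j <= p t i j.
Proof.
move=> t0; apply: (nondecreasing_cvgn_le (trunc_bd_nd i j t0)).
by apply/cvg_ex; eexists; exact: trunc_bd_cvg.
Qed.

Lemma killed_bd_le (c : R) (M : nat) t i :
  0 <= t -> (forall N, (M <= N)%N -> \sum_(0 <= j < M) pN N t i j <= c) ->
  \sum_(0 <= j < M) p t i j <= c.
Proof.
move=> t0 H.
have L : (fun N => \sum_(0 <= j < M) pN N t i j) @ \oo --> \sum_(0 <= j < M) p t i j.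
  by apply: cvg_sum_nat => k _; exact: trunc_bd_cvg.
rewrite -(cvg_lim _ L)//; apply: limr_le; first by apply/cvg_ex; eexists; exact: L.
by near=> N; apply: H; near: N; exists M.
Unshelve. all: by end_near. Qed.

Lemma killed_bd_ge0 t i j : 0 <= t -> 0 <= p t i j.
Proof. by move=> t0; apply: le_trans (trunc_bd_le 0 _ _ t0); exact: trunc_bd_ge0. Qed.

Lemma killed_bd_row t i M : 0 <= t -> \sum_(0 <= j < M) p t i j <= 1.
Proof. by move=> t0; apply: killed_bd_le => // N MN; exact: trunc_bd_row. Qed.

Lemma killed_bd_le1 t i j : 0 <= t -> p t i j <= 1.
Proof.
move=> t0; apply: le_trans (killed_bd_row i j.+1 t0).
by rewrite big_nat_recr//= lerDr; apply: sumr_ge0 => k _; exact: killed_bd_ge0.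
Qed.

(** The semigroup identity is proved as two inequalities: the truncated identity is dominated
    termwise by the full series, and conversely each finite partial sum is a limit of truncated
    ones. *)
Lemma killed_bd_transition : transition_matrix killed_bd.
Proof.
split=> [t i j t0|t i t0|s t i j s0 t0].
- exact: killed_bd_ge0.
- have c1 := cvg_series_bounded_ge0 (fun j => killed_bd_ge0 i j t0) (killed_bd_row i ^~ t0).
  by rewrite nneseries_EFin// lee_fin; apply: lim_series_le => // n; exact: killed_bd_row.
- have pp0 k : 0 <= p s i k * p t k j by rewrite mulr_ge0 ?killed_bd_ge0.
  have cpp : cvgn (series (fun k => p s i k * p t k j)).
    apply: (@cvg_series_bounded_ge0 _ _ 1) => // n.
    apply: le_trans (killed_bd_row i n s0); rewrite !big_mkord; apply: ler_sum => k _.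
    by rewrite ler_piMr ?killed_bd_ge0 ?killed_bd_le1.
  have st0 := addr_ge0 s0 t0.
  have pNsg N k : (k <= N)%N ->
    \sum_(0 <= k < k) pN N s i k * pN N t k j <= pN N (s + t) i j.
    move=> kN; have [/andP[iN jN]|ij] := boolP ((i < N)%N && (j < N)%N); last first.
      rewrite big1 ?trunc_bd_ge0// => l _; move: ij; rewrite negb_and /trunc_bd.
      by case/orP => /negPf ->; rewrite ?andbF ?mul0r ?mulr0.
    rewrite [leRHS]/trunc_bd iN jN/= mxexp_bd_semigroup//.
    apply: (@le_trans _ _ (\sum_(0 <= l < N) pN N s i l * pN N t l j)).
      rewrite (big_cat_nat (n := k) (p := N))//= lerDl; apply: sumr_ge0 => l _.
      by rewrite mulr_ge0 ?trunc_bd_ge0.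
    by rewrite !big_mkord; apply: ler_sum => l _; rewrite /trunc_bd iN jN ltn_ord.
  rewrite nneseries_EFin//; congr EFin; apply/eqP; rewrite eq_le; apply/andP; split.
    have L := @trunc_bd_cvg (s + t) i j st0.
    rewrite -(cvg_lim _ L)//; apply: limr_le; first by apply/cvg_ex; eexists; exact: L.
    near=> N; apply: le_trans (lim_series_ge N pp0 cpp).
    have iN : (i < N)%N by near: N; exists i.+1.
    have jN : (j < N)%N by near: N; exists j.+1.
    rewrite [leLHS]/trunc_bd iN jN/= mxexp_bd_semigroup// !big_mkord; apply: ler_sum => l _.
    have E u m n : (m < N)%N -> (n < N)%N -> mxexp N (bd_matrix a b) u m n = pN N u m n.
      by move=> mN nN; rewrite /trunc_bd mN nN.
    by rewrite !E// ler_pM ?trunc_bd_ge0 ?trunc_bd_le.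
  apply: lim_series_le => // n.
  have L : (fun N => \sum_(0 <= k < n) pN N s i k * pN N t k j) @ \oo -->
      \sum_(0 <= k < n) p s i k * p t k j.
    by apply: cvg_sum_nat => k _; apply: cvgM; exact: trunc_bd_cvg.
  rewrite -(cvg_lim _ L)//; apply: limr_le; first by apply/cvg_ex; eexists; exact: L.
  near=> N; apply: le_trans (trunc_bd_le N _ _ st0); apply: pNsg.
  by near: N; exists n.
Unshelve. all: by end_near. Qed.

Lemma killed_bd0 i j : p 0 i j = (i == j)%:R.
Proof.
apply: lim_near_cst => //; near=> N.
have iN : (i < N)%N by near: N; exists i.+1.
have jN : (j < N)%N by near: N; exists j.+1.
by rewrite /trunc_bd iN jN mxexp0.
Unshelve. all: by end_near. Qed.

Lemma is_derive_cvg_right (f : R -> R) (l : R) : is_derive (0 : R) (1 : R) f l ->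
  (f h - f 0) / h @[h --> 0^'+] --> l.
Proof.
move=> [D <-]; have := cvg_dnbhs_at_right D; apply: cvg_trans.
apply: near_eq_cvg; near=> h.
by rewrite /= addr0 [h *: 1]mulr1 /GRing.scale/= mulrC.
Unshelve. all: by end_near. Qed.

(* The upper bound on the increment of [p h i j] comes from the row sum. *)
Lemma killed_bd_derivative i j :
  (p t i j - p 0 i j) / t @[t --> 0^'+] --> bd_matrix a b i j.
Proof.
(* The first M states contain j and all neighbours of i, so row i of Q already sums to 0 over
   them. *)
pose M := (maxn i j).+2.
have iM : (i.+1 < M)%N by rewrite /M !ltnS leq_maxl.
have jM : (j < M)%N by rewrite /M ltnS leqW// leq_maxr.
pose L k t := (pN M t i k - (i == k)%:R) / t.
have Lq k : (k < M)%N -> L k t @[t --> 0^'+] --> bd_matrix a b i k.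
  move=> kM; rewrite /L /trunc_bd (ltnW iM) kM/=.
  have := is_derive_mxexp (bd_matrix a b) k 0 (ltnW iM).
  move/is_derive_cvg_right; rewrite mxexp0.
  suff -> : \sum_(0 <= k0 < M) bd_matrix a b i k0 * mxexp M (bd_matrix a b) 0 k0 k =
     bd_matrix a b i k by [].
  rewrite big_mkord (bigD1 (Ordinal kM))//= mxexp0 eqxx mulr1 big1 ?addr0// => l.
  by rewrite -val_eqE/= mxexp0 => /negPf ->; rewrite mulr0.
have Q0 : \sum_(0 <= k < M) bd_matrix a b i k = 0.
  have := @bd_matrix_sum _ a b a0 M i (fun=> 1) (ltnW iM).
  by rewrite iM mul1r !subrr !mulr0 addr0; under eq_bigr do rewrite mulr1.
apply: (@squeeze_cvgr _ _ _ _ (L j) (fun t => L j t - \sum_(0 <= k < M) L k t)) => //.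
- near=> t; have t0 : 0 < t by [].
  rewrite killed_bd0 /L -mulr_suml -mulrBl !ler_pM2r ?invr_gt0//.
  rewrite lerB ?trunc_bd_le ?(ltW t0)//=.
  have := killed_bd_row i M (ltW t0); have := trunc_bd_le M i j (ltW t0).
  rewrite sumrB.
  have -> : \sum_(0 <= k < M) (i == k)%:R = 1 :> R.
    rewrite big_mkord (bigD1 (Ordinal (ltnW iM)))//= eqxx big1 ?addr0// => l.
    by rewrite -val_eqE/= eq_sym => /negPf ->.
  rewrite ![in X in _ -> X -> _]big_mkord ![in X in _ -> X]big_mkord.
  rewrite (bigD1 (Ordinal jM))//= [X in _ -> _ -> _ <= _ - (X - _)](bigD1 (Ordinal jM))//=.
  have : \sum_(k < M | k != Ordinal jM) pN M t i k <= \sum_(k < M | k != Ordinal jM) p t i k.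
    by apply: ler_sum => k _; rewrite trunc_bd_le ?(ltW t0).
  by lra.
- exact: Lq.
- rewrite -[X in _ --> X]subr0 -[X in _ --> _ - X]Q0; apply: cvgB; first exact: Lq.
  by apply: cvg_sum_nat => k kM; exact: Lq.
Unshelve. all: by end_near. Qed.

Lemma killed_bd_Q_process : Q_process a b killed_bd.
Proof.
split; [exact: killed_bd_transition| |exact: killed_bd_derivative].
split => i j; first exact: killed_bd0.
(* A difference quotient with a finite limit forces right continuity at 0. *)
have D := @killed_bd_derivative i j.
rewrite -killed_bd0 -[X in _ --> X]addr0 -[X in _ --> _ + X](mul0r (bd_matrix a b i j)).
have : p 0 i j + t * ((p t i j - p 0 i j) / t) @[t --> 0^'+] -->
    p 0 i j + 0 * bd_matrix a b i j.
  apply: cvgD; first exact: cvg_cst.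
  by apply: cvgM => //; apply: cvg_at_right_filter; exact: cvg_id.
apply: cvg_trans; apply: near_eq_cvg; near=> t.
by rewrite mulrCA divff ?mulr1 ?subrKC// gt_eqF.
Unshelve. all: by end_near. Qed.

Lemma minimal_row_bound (pmin : R -> nat -> nat -> R) :
  (bd_sigma a b < +oo)%E -> minimal_Q_process a b pmin ->
  exists z : nat -> R, [/\ forall k, 0 <= z k, z @ \oo --> 0 &
    forall i t n, 0 <= t -> t * \sum_(0 <= j < n) pmin t i j <= z i].
Proof.
move=> sfin [_ pmin_le]; have [z [z0 zoo zQ]] := bd_potential a0 a_gt0 b_gt0 sfin.
exists z; split=> // i t n t0.
apply: (@le_trans _ _ (t * \sum_(0 <= j < n) p t i j)).
  rewrite ler_wpM2l// !big_mkord; apply: ler_sum => j _.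
  exact: pmin_le killed_bd_Q_process _ _ _ t0.
have [->|t_neq0] := eqVneq t 0; first by rewrite mul0r.
have tgt0 : 0 < t by rewrite lt_neqAle eq_sym t_neq0.
rewrite mulrC -ler_pdivlMr//; apply: killed_bd_le => // N nN.
rewrite ler_pdivlMr// mulrC.
have [iN|iN] := boolP (i < N)%N; last first.
  by rewrite big1 ?mulr0// => j _; rewrite /trunc_bd (negbTE iN).
apply: le_trans (mxexp_bd_potential a0 a_gt0 b_gt0 z0 zQ iN t0); rewrite ler_wpM2l//.
rewrite [leRHS](big_cat_nat (n := n) (p := N))//=.
rewrite -[leLHS]addr0 lerD//; last by apply: sumr_ge0 => j _; exact: mxexp_bd_ge0.
by rewrite !big_mkord; apply: ler_sum => j _; rewrite /trunc_bd iN (leq_trans (ltn_ord j)).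
Qed.

End ExplodingProcess.

(** * Laplace transforms on the half-line *)

Section RightContinuous.
Context {R : realType} {d : measure_display} {T : measurableType d}.

(** The grid point is strictly beyond t, since a right limit does not see the point t itself. *)
Let grid (n : nat) (t : R) : R := (Num.truncn (t * n.+1%:R)).+1%:R / n.+1%:R.

Let grid_gt n t : 0 <= t -> t < grid n t.
Proof.
move=> t0; rewrite /grid ltr_pdivlMr//.
by have /andP[] := truncn_itv (mulr_ge0 t0 (ler0n R n.+1)).
Qed.

Let grid_le n t : 0 <= t -> grid n t <= t + n.+1%:R^-1.
Proof.
move=> t0; rewrite /grid -[X in _ <= _ + X]div1r ler_pdivrMr// mulrDl divfK//.
by rewrite -natr1 lerD2r; have /andP[] := truncn_itv (mulr_ge0 t0 (ler0n R n.+1)).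
Qed.

(* A right-continuous function is the limit of its values at the next point of the grid of mesh 1/(n+1). *)
Lemma right_continuous_measurable (f : R -> T -> R) :
  (forall t, 0 <= t -> measurable_fun setT (f t)) ->
  (forall x t, 0 <= t -> f s x @[s --> t^'+] --> f t x) ->
  measurable_fun (`[(0:R), +oo[%classic `*` setT) (fun z : R * T => f z.1 z.2).
Proof.
move=> mf cf.
apply: (@measurable_realfun.measurable_fun_cvg _ _ _ _ (fun n z => f (grid n z.1) z.2)); last first.
  move=> [t x] [/= + _]; rewrite in_itv/= andbT => t0.
  move/cvg_at_rightP : (cf x t t0); apply; split => [n|]; first exact: grid_gt.
  apply: (@squeeze_cvgr _ _ _ _ (fun=> t) (fun n => t + n.+1%:R^-1)).
  - by near=> n; rewrite ltW ?grid_gt//= grid_le.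
  - exact: cvg_cst.
  - rewrite -[X in _ --> X]addr0; apply: cvgD; first exact: cvg_cst.
    exact: cvg_harmonic.
move=> n mD B mB.
(* On the cell [A k] the grid point is constant, so the preimage is a countable union of measurable
   rectangles. *)
pose A k := `[k%:R / n.+1%:R, k.+1%:R / n.+1%:R[%classic : set R.
rewrite [X in measurable X](_ : _ = \bigcup_k (A k `*` (f (k.+1%:R / n.+1%:R) @^-1` B))).
  apply: bigcupT_measurable => k; apply: measurableX; first exact: measurable_itv.
  by rewrite -[X in measurable X]setTI; apply: mf.
apply/seteqP; split => [[t x] [[/= + _] fB]|[t x] [k _ [/=]]].
  rewrite in_itv/= andbT => t0; exists (Num.truncn (t * n.+1%:R)) => //; split => //=.
  rewrite /A/= in_itv/= ler_pdivrMr// ltr_pdivlMr//.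
  exact: truncn_itv (mulr_ge0 t0 (ler0n R n.+1)).
rewrite /A/= in_itv/= ler_pdivrMr// ltr_pdivlMr// => /andP[kt tk] fB.
have t0 : 0 <= t by rewrite -(pmulr_lge0 t (ltr0Sn R n)) (le_trans _ kt).
split; first by split=> //=; rewrite in_itv/= andbT.
rewrite /= /grid; suff -> : Num.truncn (t * n.+1%:R) = k by [].
by apply: truncn_def; rewrite kt tk.
Unshelve. all: by end_near. Qed.

End RightContinuous.

Lemma right_continuous_measurable1 {R : realType} (f : R -> R) :
  (forall t, 0 <= t -> f s @[s --> t^'+] --> f t) ->
  measurable_fun `[(0:R), +oo[%classic f.
Proof.
move=> cf.
have := @right_continuous_measurable R _ unit (fun t _ => f t).
move=> /(_ (fun t _ => measurable_cst _) (fun _ t t0 => cf t t0)) H.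
apply: (@measurable_comp _ _ _ _ _ _ (`[(0:R), +oo[%classic `*` [set: unit]) (fun z : R * unit => f z.1) _ (fun t : R => (t, tt))) => //.
- by apply: measurableX => //; exact: measurable_itv.
- by move=> _ [t t0 <-]; split.
- exact: measurable_funS (measurable_pair2 tt).
Qed.

Section Shift.
Context {R : realType}.
Notation mu := (@lebesgue_measure R).

(** The image of Lebesgue measure under the translation agrees with it on half-open intervals, hence
    everywhere. *)
Lemma ge0_integral_shift (c : R) (f : R -> \bar R) :
  measurable_fun (`[0, +oo[%classic : set (measurableTypeR R)) f ->
  (forall t, 0 <= t -> (0 <= f t)%E) ->
  (\int[mu]_(t in `[c, +oo[) f (t - c)%R = \int[mu]_(t in `[0%R, +oo[) f t)%E.
Proof.
move=> mf f0.
have mphi : measurable_fun [set: R] (fun t : R => t - c) by exact: measurable_funB.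
have E A : measurable A -> mu A = pushforward mu (fun t : measurableTypeR R => (t - c : measurableTypeR R)) A.
  apply: lebesgue_measure_unique => _ [[x y] xy <-].
  transitivity (mu `]x + c, y + c]%classic); last first.
    congr (mu _); apply/seteqP; split => t /=; rewrite !in_itv/= ltrBrDr lerBlDr//.
  rewrite !lebesgue_measure_itv/= !lte_fin ltrD2r; case: ifPn => // _.
  by rewrite -!EFinB; congr EFin; ring.
rewrite [RHS](eq_measure_integral (pushforward mu (fun t : measurableTypeR R => (t - c : measurableTypeR R)))); last first.
  by move=> A mA _; exact: E.
rewrite ge0_integral_pushforward//=.
  by congr (integral _ _ _); apply/seteqP; split => t /=; rewrite !in_itv/= !andbT subr_ge0.
by move=> t; rewrite inE/= in_itv/= andbT; exact: f0.
Qed.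

End Shift.

Section LaplaceTransform.
Context {R : realType}.
Notation mu := (@lebesgue_measure R).
Local Notation D := (`[(0:R), +oo[%classic : set (measurableTypeR R)).
Implicit Types (alpha t M : R) (f g : R -> R).

(** The class on which the real-valued [laplace] is linear and monotone; the explicit bound supplies
    the integrability behind these rules. *)
Definition bounded_on_half_line M g :=
  measurable_fun D g /\ (forall t, 0 <= t -> `|g t| <= M).

Lemma measurable_half_line : measurable D.
Proof. exact: measurable_itv. Qed.
Local Notation mD := measurable_half_line.

Lemma measurable_laplace_kernel alpha : measurable_fun D (fun t => expR (- (alpha * t))).
Proof.
apply: measurable_funTS; apply: measurableT_comp => //.
by apply: measurableT_comp => //; exact: measurable_funM.
Qed.

Lemma integral_expRN alpha : 0 < alpha ->
  (\int[mu]_(t in D) (expR (- (alpha * t)))%:E = (alpha^-1)%:E)%E.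
Proof.
move=> a0; have := integral_exponential_pdf a0.
rewrite [X in X = _ -> _](_ : _ =
    \int[mu]_(t in D) (alpha%:E * (expR (- (alpha * t)))%:E))%E; last first.
  rewrite [RHS]integral_mkcond; apply: eq_integral => t _.
  by rewrite /exponential_pdf !patchE; case: ifP => // _; rewrite EFinM mulNr.
rewrite ge0_integralZl_EFin//; last 2 first.
- by apply/measurable_EFinP; exact: measurable_laplace_kernel.
- exact: ltW.
set I := (X in (_ * X = _)%E -> _) => /(congr1 (fun x => alpha^-1%:E * x)%E).
by rewrite mule1 muleA -EFinM mulVf ?gt_eqF// mul1e.
Qed.

Lemma integrable_expRN alpha : 0 < alpha ->
  mu.-integrable D (EFin \o (fun t => expR (- (alpha * t)))).
Proof.
move=> a0; apply/integrableP; split.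
  by apply/measurable_EFinP; exact: measurable_laplace_kernel.
under eq_integral => t _ do rewrite /= ger0_norm ?expR_ge0//.
by rewrite integral_expRN// ltry.
Qed.

Lemma integrable_laplace alpha M g : 0 < alpha -> bounded_on_half_line M g ->
  mu.-integrable D (EFin \o (fun t => expR (- (alpha * t)) * g t)).
Proof.
move=> a0 [mg gM].
apply: (@le_integrable _ _ _ _ _ mD _ (fun t => M%:E * (expR (- (alpha * t)))%:E)%E).
- by apply/measurable_EFinP; apply: measurable_funM => //; exact: measurable_laplace_kernel.
- move=> t; rewrite /= in_itv/= andbT => t0.
  rewrite lee_fin !normrM mulrC.
  by rewrite ler_wpM2r// (le_trans (gM t t0))// ler_norm.
- by apply: (@integrableZl _ _ _ mu D mD M); exact: integrable_expRN.
Qed.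

Lemma laplaceE alpha M g : 0 < alpha -> bounded_on_half_line M g ->
  ((laplace alpha g)%:E = \int[mu]_(t in D) (expR (- (alpha * t)) * g t)%:E)%E.
Proof.
move=> a0 gM; rewrite /laplace fineK//.
exact: integrable_fin_num (integrable_laplace a0 gM).
Qed.

Lemma eq_laplace alpha f g : (forall t, 0 <= t -> f t = g t) ->
  laplace alpha f = laplace alpha g.
Proof.
move=> fg; apply: eq_Rintegral => t; rewrite inE/= in_itv/= andbT => t0.
by rewrite fg.
Qed.

Lemma bounded_cst c : bounded_on_half_line `|c| (fun=> c).
Proof. by split => //; exact: measurable_cst. Qed.

Lemma boundedD M f M' g : bounded_on_half_line M f -> bounded_on_half_line M' g ->
  bounded_on_half_line (M + M') (fun t => f t + g t).
Proof.
move=> [mf fM] [mg gM]; split; first exact: measurable_funD.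
by move=> t t0; rewrite (le_trans (ler_normD _ _))// lerD ?fM ?gM.
Qed.

Lemma boundedB M f M' g : bounded_on_half_line M f -> bounded_on_half_line M' g ->
  bounded_on_half_line (M + M') (fun t => f t - g t).
Proof.
move=> [mf fM] [mg gM]; split; first exact: measurable_funB.
by move=> t t0; rewrite (le_trans (ler_normB _ _))// lerD ?fM ?gM.
Qed.

Lemma boundedZ M c g : bounded_on_half_line M g ->
  bounded_on_half_line (`|c| * M) (fun t => c * g t).
Proof.
move=> [mg gM]; split; first exact: measurable_funM.
by move=> t t0; rewrite normrM ler_wpM2l ?gM.
Qed.

Lemma boundedM M f M' g : bounded_on_half_line M f -> bounded_on_half_line M' g ->
  bounded_on_half_line (M * M') (fun t => f t * g t).
Proof.
move=> [mf fM] [mg gM]; split; first exact: measurable_funM.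
by move=> t t0; rewrite normrM ler_pM ?fM ?gM.
Qed.

Lemma laplaceD alpha M f M' g : 0 < alpha ->
  bounded_on_half_line M f -> bounded_on_half_line M' g ->
  laplace alpha (fun t => f t + g t) = laplace alpha f + laplace alpha g.
Proof.
move=> a0 fM gM; rewrite /laplace -RintegralD//; last 2 first.
- exact: integrable_laplace fM.
- exact: integrable_laplace gM.
by apply: eq_Rintegral => t _; rewrite mulrDr.
Qed.

Lemma laplaceZ alpha M c g : 0 < alpha -> bounded_on_half_line M g ->
  laplace alpha (fun t => c * g t) = c * laplace alpha g.
Proof.
move=> a0 gM; rewrite /laplace -RintegralZl//; last exact: integrable_laplace gM.
by apply: eq_Rintegral => t _; rewrite mulrCA.
Qed.

Lemma laplaceB alpha M f M' g : 0 < alpha ->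
  bounded_on_half_line M f -> bounded_on_half_line M' g ->
  laplace alpha (fun t => f t - g t) = laplace alpha f - laplace alpha g.
Proof.
move=> a0 fM gM; rewrite -[in RHS]mulN1r -(laplaceZ _ a0 gM).
rewrite -(laplaceD a0 fM (boundedZ (-1) gM)).
by apply: eq_laplace => t _; rewrite mulN1r.
Qed.

Lemma laplace_cst alpha c : 0 < alpha -> laplace alpha (fun=> c) = c / alpha.
Proof.
move=> a0; have B1 := bounded_cst 1.
have -> : laplace alpha (fun=> c) = laplace alpha (fun=> c * 1).
  by apply: eq_laplace => t _; rewrite mulr1.
rewrite (laplaceZ c a0 B1); congr (_ * _).
by rewrite /laplace /Rintegral; under eq_integral do rewrite mulr1; rewrite integral_expRN.
Qed.

Lemma ler_laplace alpha M f M' g : 0 < alpha ->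
  bounded_on_half_line M f -> bounded_on_half_line M' g ->
  (forall t, 0 <= t -> f t <= g t) -> laplace alpha f <= laplace alpha g.
Proof.
move=> a0 fM gM fg; apply: le_Rintegral => //.
- exact: integrable_laplace fM.
- exact: integrable_laplace gM.
by move=> t; rewrite /= in_itv/= andbT => t0; rewrite ler_wpM2l ?expR_ge0// fg.
Qed.

Lemma laplace_ge0 alpha M g : 0 < alpha -> bounded_on_half_line M g ->
  (forall t, 0 <= t -> 0 <= g t) -> 0 <= laplace alpha g.
Proof.
move=> a0 gM g0; have <- : laplace alpha (fun=> 0) = 0 by rewrite laplace_cst// mul0r.
exact: (ler_laplace a0 (bounded_cst 0) gM).
Qed.

Lemma laplace_le_cst alpha M g c : 0 < alpha -> bounded_on_half_line M g ->
  (forall t, 0 <= t -> g t <= c) -> laplace alpha g <= c / alpha.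
Proof. by move=> a0 gM gc; rewrite -laplace_cst//; exact: (ler_laplace a0 gM (bounded_cst c)). Qed.

Lemma laplace_norm alpha M f M' g : 0 < alpha -> bounded_on_half_line M f ->
  bounded_on_half_line M' g -> (forall t, 0 <= t -> `|f t| <= g t) ->
  `|laplace alpha f| <= laplace alpha g.
Proof.
move=> a0 fM gM' fg; rewrite ler_norml; apply/andP; split.
  rewrite -mulN1r -(laplaceZ _ a0 gM').
  apply: (ler_laplace a0 (boundedZ _ gM') fM) => t t0.
  by rewrite mulN1r; have := fg t t0; rewrite ler_norml => /andP[].
apply: (ler_laplace a0 fM gM') => t t0.
by have := fg t t0; rewrite ler_norml => /andP[].
Qed.

Section Series.
Variables (M : R) (g : nat -> R -> R).
Hypothesis mg : forall k, measurable_fun D (g k).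
Hypothesis g0 : forall k t, 0 <= t -> 0 <= g k t.
Hypothesis gM : forall n t, 0 <= t -> \sum_(0 <= k < n) g k t <= M.

Lemma bounded_series_term k : bounded_on_half_line M (g k).
Proof.
split => // t t0; rewrite ger0_norm ?g0//.
apply: le_trans (gM k.+1 t0); rewrite big_nat_recr//= lerDr.
by apply: sumr_ge0 => i _; exact: g0.
Qed.

Lemma cvg_series_half_line t : 0 <= t -> cvgn (series (fun k => g k t)).
Proof. by move=> t0; apply: (@cvg_series_bounded_ge0 _ _ M) => [k|n]; [exact: g0|exact: gM]. Qed.

Lemma bounded_series : bounded_on_half_line M (fun t => limn (series (fun k => g k t))).
Proof.
split.
  apply: (@measurable_fun_cvg _ _ _ _ (fun n t => \sum_(0 <= k < n) g k t)).
    elim=> [|n IH].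
      by rewrite (_ : (fun=> _) = cst 0)//; apply/funext => t; rewrite big_geq.
    rewrite (_ : (fun=> _) = (fun t => \sum_(0 <= k < n) g k t) \+ g n).
      exact: (measurable_funD IH (mg n)).
    by apply/funext => t; rewrite big_nat_recr.
  by move=> t; rewrite /= in_itv/= andbT => t0; exact: cvg_series_half_line.
move=> t t0; have ct := cvg_series_half_line t0.
rewrite ger0_norm; first by apply: lim_series_le => // n; exact: gM.
by apply: lim_series_ge0 => // k; exact: g0.
Qed.

(** Monotone convergence in the extended reals; the uniform bound M on partial sums then makes both
    sides real. *)
Lemma laplace_series alpha : 0 < alpha ->
  series (fun k => laplace alpha (g k)) @ \oo -->
  laplace alpha (fun t => limn (series (fun k => g k t))).
Proof.
move=> a0.
have E : (\sum_(0 <= k <oo) (laplace alpha (g k))%:E =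
    (laplace alpha (fun t => limn (series (fun k => g k t))))%:E)%E.
  rewrite (laplaceE a0 bounded_series).
  under eq_eseriesr do rewrite (laplaceE a0 (bounded_series_term _)).
  rewrite -integral_nneseries//; last 2 first.
  - move=> k; apply/measurable_EFinP; apply: measurable_funM => //; exact: measurable_laplace_kernel.
  - by move=> k t; rewrite /= in_itv/= andbT => t0; rewrite lee_fin mulr_ge0 ?expR_ge0 ?g0.
  apply: eq_integral => t; rewrite inE/= in_itv/= andbT => t0.
  under eq_eseriesr do rewrite EFinM.
  rewrite nneseriesZl; last by move=> k _; rewrite lee_fin g0.
  rewrite nneseries_EFin//; exact: cvg_series_half_line.
have Lg0 k : 0 <= laplace alpha (g k).
  by apply: (laplace_ge0 a0 (bounded_series_term k)) => t; exact: g0.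
have C : cvgn (series (fun k => laplace alpha (g k))).
  by apply: (cvg_nneseries Lg0); rewrite E; exact: lexx.
by move: E; rewrite nneseries_EFin// => -[<-].
Qed.

End Series.

End LaplaceTransform.

(** * Shifts, tails and the initial value theorem *)

Section LaplaceShift.
Context {R : realType}.
Notation mu := (@lebesgue_measure R).
Local Notation D := (`[(0:R), +oo[%classic : set (measurableTypeR R)).
Implicit Types (alpha t h M : R) (f g : R -> R).

Lemma measurable_shift h g : 0 <= h -> measurable_fun D g -> measurable_fun D (fun t => g (t + h)).
Proof.
move=> h0 mg.
apply: (@measurable_comp _ _ _ _ _ _ D g _ (fun t : R => t + h)) => //.
- move=> _ [t t0 <-]; move: t0; rewrite /= !in_itv/= !andbT => t0; exact: addr_ge0.
- by apply: measurable_funD => //; exact: measurable_id.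
Qed.

Lemma bounded_shift M h g : 0 <= h -> bounded_on_half_line M g ->
  bounded_on_half_line M (fun t => g (t + h)).
Proof.
move=> h0 [mg gM]; split; first exact: measurable_shift.
by move=> t t0; apply: gM; exact: addr_ge0.
Qed.

Lemma bounded_tail h : bounded_on_half_line 1 (fun t => (h <= t)%R%:R : R).
Proof.
split; last by move=> t _; rewrite normr_nat; case: (h <= t).
rewrite (_ : (fun=> _) = \1_(`[h, +oo[%classic : set (measurableTypeR R))).
  exact: measurable_indic.
apply/funext => t; rewrite indicE; congr (nat_of_bool _)%:R.
by apply/idP/idP => [ht|]; rewrite inE/= in_itv/= andbT.
Qed.

Lemma laplace_tail alpha M h g : 0 < alpha -> 0 <= h -> bounded_on_half_line M g ->
  (forall t, 0 <= t -> 0 <= g t) ->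
  laplace alpha (fun t => (h <= t)%R%:R * g t) = expR (- (alpha * h)) * laplace alpha (fun t => g (t + h)).
Proof.
move=> a0 h0 gM g0; apply: EFin_inj.
have Bh := bounded_shift h0 gM.
rewrite -(laplaceZ _ a0 Bh) (laplaceE a0 (boundedM (bounded_tail h) gM)).
rewrite (laplaceE a0 (boundedZ _ Bh)).
pose F t := (expR (- (alpha * t)) * (expR (- (alpha * h)) * g (t + h)))%:E.
rewrite -[RHS]/(\int[mu]_(t in D) F t)%E.
rewrite -(@ge0_integral_shift _ h F); last 2 first.
- apply/measurable_EFinP; apply: measurable_funM; first exact: measurable_laplace_kernel.
  by have [] := boundedZ (expR (- (alpha * h))) Bh.
- by move=> t t0; rewrite lee_fin !mulr_ge0 ?expR_ge0 ?g0 ?addr_ge0.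
have -> : (`[h, +oo[%classic : set (measurableTypeR R)) = D `&` `[h, +oo[%classic.
  apply/seteqP; split => t /=; rewrite !in_itv/= !andbT; last by case.
  by move=> ht; split => //; exact: le_trans ht.
rewrite integral_mkcondr; apply: eq_integral => t _.
rewrite patchE /F; case: ifPn => [|th].
  rewrite inE/= in_itv/= andbT => ->; rewrite mul1r subrK mulrA -expRD.
  by congr (expR _ * _)%:E; ring.
have /negPf -> : ~~ (h <= t).
  by apply: contra th => ht; rewrite inE/= in_itv/= andbT.
by rewrite mul0r mulr0.
Qed.

Lemma laplace_tail1 alpha h : 0 < alpha -> 0 <= h ->
  laplace alpha (fun t => (h <= t)%R%:R) = expR (- (alpha * h)) / alpha.
Proof.
move=> a0 h0.
have B1 : bounded_on_half_line 1 (fun=> 1 : R) by have := bounded_cst (1 : R); rewrite normr1.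
have := laplace_tail a0 h0 B1 (fun _ _ => ler01).
rewrite laplace_cst// div1r => <-; apply: eq_laplace => t _; by rewrite mulr1.
Qed.

Lemma right_near_le (g : R -> R) t e : 0 < e -> g s @[s --> t^'+] --> g t ->
  exists2 dlt, 0 < dlt & forall s, t <= s < t + dlt -> `|g t - g s| <= e.
Proof.
move=> e0 /cvgrPdist_le /(_ e e0) [dlt/= d0 H]; exists dlt => // s /andP[].
rewrite le_eqVlt => /orP[/eqP <- _|ts sd]; first by rewrite subrr normr0 ltW.
by apply: H => //=; rewrite ltr_distlC sd andbT ltrBlDr (lt_le_trans ts)// lerDl ltW.
Qed.

(** The density alpha expR (- alpha t) concentrates at 0: on [0, dlt) g is close to g 0, and the
    rest costs at most 2 M expR (- alpha dlt). *)
Lemma laplace_abelian M g : bounded_on_half_line M g -> g s @[s --> 0^'+] --> g 0 ->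
  alpha * laplace alpha g @[alpha --> +oo] --> g 0.
Proof.
move=> gM cg; apply/cvgrPdist_le => e e0.
have [dlt d0 Hd] := right_near_le (divr_gt0 e0 (ltr0Sn R 1)) cg.
have M0 : 0 <= M by apply: le_trans (gM.2 0 (lexx _)).
near=> alpha.
have a0 : 0 < alpha by [].
have -> : g 0 - alpha * laplace alpha g = alpha * laplace alpha (fun t => g 0 - g t).
  rewrite (laplaceB a0 (bounded_cst (g 0)) gM) laplace_cst// mulrBr mulrCA divff ?gt_eqF//.
  by rewrite mulr1.
have B1 := boundedB (bounded_cst (g 0)) gM.
have B2 := boundedD (bounded_cst (e / 2)) (boundedZ (2 * M) (bounded_tail dlt)).
rewrite normrM gtr0_norm//.
have : `|laplace alpha (fun t => g 0 - g t)| <=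
    laplace alpha (fun t => e / 2 + 2 * M * (dlt <= t)%R%:R).
  apply: (laplace_norm a0 B1 B2) => t t0.
  case: (leP dlt t) => [td|td].
    rewrite mulr1 (le_trans (ler_normB _ _))// (le_trans (lerD (gM.2 0 (lexx _)) (gM.2 t t0)))//.
    by have := ltW e0; lra.
  by rewrite mulr0 addr0; apply: Hd; rewrite t0 add0r.
rewrite (laplaceD a0 (bounded_cst (e / 2)) (boundedZ (2 * M) (bounded_tail dlt))).
rewrite laplace_cst// (laplaceZ _ a0 (bounded_tail dlt)) laplace_tail1//; last exact: ltW.
move=> H; rewrite -(ler_pM2l a0) in H.
apply: (le_trans H); rewrite mulrDr mulrCA divff ?gt_eqF// mulr1.
have -> : alpha * (2 * M * (expR (- (alpha * dlt)) / alpha)) = 2 * M * expR (- (alpha * dlt)).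
  by field; rewrite gt_eqF.
rewrite [leRHS](splitr e) lerD2l.
(* Since expR (- x) is at most 1 / x, the tail is at most 2 M / (alpha dlt), which this threshold
   brings below e / 2. *)
have big : 4 * M / (e * dlt) <= alpha by near: alpha; apply: nbhs_pinfty_ge; exact: num_real.
have ad0 : 0 < alpha * dlt by rewrite mulr_gt0.
apply: (@le_trans _ _ (2 * M * (alpha * dlt)^-1)).
  rewrite ler_wpM2l ?mulr_ge0// expRN lef_pV2 ?posrE ?expR_gt0//.
  by apply: le_trans (expR_ge1Dx _); rewrite lerDr.
rewrite ler_pdivrMr//; move: big; rewrite ler_pdivrMr ?mulr_gt0//.
have -> : alpha * (e * dlt) = alpha * dlt * e by ring.
by lra.
Unshelve. all: by end_near. Qed.
End LaplaceShift.

(** * Uniqueness of Laplace transforms, and derivatives of shifted functions *)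

Section LaplaceUniqueness.
Context {R : realType}.
Local Notation D := (`[(0:R), +oo[%classic : set (measurableTypeR R)).
Implicit Types (alpha t h M : R) (f g : R -> R).

Lemma bounded_expRN alpha : 0 <= alpha ->
  bounded_on_half_line 1 (fun t => expR (- (alpha * t))).
Proof.
move=> a0; split; first exact: measurable_laplace_kernel.
by move=> t t0; rewrite ger0_norm ?expR_ge0// -expR0 ler_expR oppr_le0 mulr_ge0.
Qed.

(** Multiplication by expR (- t) raises alpha by 1, so the vanishing of all transforms is inherited
    by polynomials in expR (- t) times g. *)
Lemma laplace_poly M g (P : {poly R}) : bounded_on_half_line M g ->
  (forall alpha, 0 < alpha -> laplace alpha g = 0) ->
  (exists M', bounded_on_half_line M' (fun t => P.[expR (- t)] * g t)) /\
  forall alpha, 0 < alpha -> laplace alpha (fun t => P.[expR (- t)] * g t) = 0.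
Proof.
move=> gM gL; elim/poly_ind: P => [|P c [[M' BP] LP]].
  split => [|alpha a0].
    by exists `|0 : R|; under eq_fun do rewrite horner0 mul0r; exact: bounded_cst.
  by under eq_laplace do rewrite horner0 mul0r; rewrite laplace_cst// mul0r.
have E t : ('X * 0 + P * 'X + c%:P).[expR (- t)] * g t =
    expR (- (1 * t)) * (P.[expR (- t)] * g t) + c * g t.
  by rewrite mulr0 add0r hornerMXaddC mul1r; ring.
rewrite mulr0 add0r in E.
have B1 := boundedM (bounded_expRN ler01) BP.
have B2 := boundedZ c gM.
split => [|alpha a0].
  by exists (1 * M' + `|c| * M); under eq_fun do rewrite E; exact: boundedD.
under eq_laplace do rewrite E; rewrite (laplaceD a0 B1 B2) (laplaceZ c a0 gM) gL// mulr0 addr0.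
rewrite -(LP (alpha + 1)) ?addr_gt0// /laplace; apply: eq_Rintegral => t _.
by rewrite mulrA -expRD; congr (expR _ * _); ring.
Qed.

Lemma expRN_lipschitz t s : 0 <= t -> t <= s -> expR (- t) - expR (- s) <= s - t.
Proof.
move=> t0 ts; have -> : expR (- s) = expR (- t) * expR (- (s - t)).
  by rewrite -expRD; congr expR; ring.
have := expR_ge1Dx (- (s - t)); set e := expR (- (s - t)) => He.
have e1 : expR (- t) <= 1 by rewrite -expR0 ler_expR oppr_le0.
rewrite -{1}[expR (- t)]mulr1 -mulrBr.
apply: (@le_trans _ _ (expR (- t) * (s - t))); first by rewrite ler_wpM2l ?expR_ge0//; lra.
by rewrite ler_piMl// subr_ge0.
Qed.

(** If g t1 > 0, then g is bounded below by e > 0 on an interval to the right of t1. In the variable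
    x = expR (- t), the powers of 1 - (x - x0)^2 peak inside that interval; against them the
    integral of g would become positive, contradicting [laplace_poly]. *)
Lemma laplace_eq0_le0 M g t1 : bounded_on_half_line M g -> 0 <= t1 ->
  g s @[s --> t1^'+] --> g t1 ->
  (forall alpha, 0 < alpha -> laplace alpha g = 0) -> g t1 <= 0.
Proof.
move=> gM t10 cg gL; rewrite leNgt; apply/negP => g0.
have [dlt d0 Hd] := right_near_le (divr_gt0 g0 (ltr0Sn R 1)) cg.
pose e := g t1 / 2; have e0 : 0 < e by rewrite divr_gt0.
have ge t : t1 <= t < t1 + dlt -> e <= g t.
  by move/Hd; rewrite ler_distlC -/e => /andP[+ _]; rewrite {1}(splitr (g t1)) -/e addrK.
have M0 : 0 <= M by apply: le_trans (gM.2 0 (lexx _)).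
(* The peak is placed at the image of the midpoint of the interval. *)
pose m := t1 + dlt / 2; pose x0 := expR (- m).
have m0 : 0 <= m by rewrite addr_ge0// divr_ge0// ltW.
(* The distance from x0 to the nearer end of the image of the interval: outside the interval the
   kernel is at most r = 1 - eta^2, while within eta / 2 of x0 it is at least q > r. *)
pose eta := Num.min (x0 - expR (- (t1 + dlt))) (expR (- t1) - x0).
have eta0 : 0 < eta.
  by rewrite lt_min !subr_gt0 !ltr_expR !ltrN2 /m; apply/andP; split; lra.
pose K (x : R) := 1 - (x - x0) ^+ 2.
pose q := 1 - (eta / 2) ^+ 2; pose r := 1 - eta ^+ 2.
have x001 : 0 < x0 <= 1 by rewrite expR_gt0/= -expR0 ler_expR oppr_le0.
have eta1 : eta <= 1.
  rewrite ge_min; apply/orP; right; rewrite lerBlDr.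
  apply: (@le_trans _ _ 1); last by rewrite lerDl; case/andP: x001 => /ltW.
  by rewrite -expR0 ler_expR oppr_le0.
have r0 : 0 <= r by rewrite subr_ge0 expr_le1// ltW.
have rq : r < q by rewrite /r /q ltrD2l ltrN2 ltrXn2r// ?nnegrE; lra.
have q0 : 0 < q by exact: le_lt_trans rq.
have x01 t : 0 <= t -> 0 < expR (- t) <= 1.
  by move=> t0; rewrite expR_gt0/= -expR0 ler_expR oppr_le0.
have K01 t : 0 <= t -> 0 <= K (expR (- t)) <= 1.
  move=> t0; have /andP[e1 e2] := x01 t t0; have /andP[e3 e4] := x001.
  have S0 := sqr_ge0 (expR (- t) - x0).
  have S1 : (expR (- t) - x0) ^+ 2 <= 1.
    by rewrite -real_normK ?num_real// expr_le1// ler_norml; apply/andP; split; lra.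
  by rewrite /K; apply/andP; split; lra.
have Kout t : 0 <= t -> ~~ (t1 <= t < t1 + dlt) -> K (expR (- t)) <= r.
  move=> t0; rewrite negb_and -ltNge -leNgt => H.
  rewrite /K /r lerD2l lerN2 -[leRHS]real_normK ?num_real//.
  rewrite lerXn2r ?nnegrE ?normr_ge0 ?(ltW eta0)//.
  case/orP: H => H.
    apply: le_trans (ler_norm _); rewrite ge_min; apply/orP; right.
    by rewrite lerD2r ler_expR lerN2 ltW.
  rewrite distrC; apply: le_trans (ler_norm _); rewrite ge_min; apply/orP; left.
  by rewrite lerD2l lerN2 ler_expR lerN2.
(* As t |-> expR (- t) is 1-Lipschitz on the half-line, [m, h) is mapped within eta / 2 of x0. [J]
   below is the indicator of [m, h). *)
pose h := m + eta / 2.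
have mh : m <= h by rewrite /h lerDl divr_ge0// ltW.
have h0 : 0 <= h by exact: le_trans mh.
pose J t : R := (m <= t)%R%:R - (h <= t)%R%:R.
have BJ := boundedB (bounded_tail m) (bounded_tail h).
have Jin t : 0 <= t -> m <= t -> t < h -> q <= K (expR (- t)).
  move=> t0 mt th; rewrite /K /q lerD2l lerN2 -[leLHS]real_normK ?num_real//.
  rewrite lerXn2r ?nnegrE ?normr_ge0 ?divr_ge0 ?(ltW eta0)//.
  rewrite distrC ger0_norm ?subr_ge0 ?ler_expR ?lerN2//.
  apply: (le_trans (expRN_lipschitz m0 mt)); move: th; rewrite /h; lra.
pose PK : {poly R} := 1 - ('X - x0%:P) ^+ 2.
have PKE n x : (PK ^+ n).[x] = K x ^+ n by rewrite horner_exp /PK !hornerE /K.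
pose c := laplace 1 J.
have c0 : 0 < c.
  rewrite /c /J (laplaceB ltr01 (bounded_tail m) (bounded_tail h)) !laplace_tail1//.
  by rewrite !divr1 !mul1r subr_gt0 ltr_expR ltrN2 /h ltrDl divr_gt0.
(* The test function times g is at least e q^n on [m, h), at least 0 on the rest of the interval and
   at least - M r^n elsewhere. As r < q, letting n grow gives e c <= 0. *)
have main n : e * q ^+ n * c <= M * r ^+ n.
  have [[M' BK] /(_ 1 ltr01)] := laplace_poly (PK ^+ n) gM gL.
  move=> LK.
  have B := boundedB (boundedZ (e * q ^+ n) BJ) (bounded_cst (M * r ^+ n)).
  have : laplace 1 (fun t => e * q ^+ n * J t - M * r ^+ n) <=
      laplace 1 (fun t => (PK ^+ n).[expR (- t)] * g t).
    apply: (ler_laplace ltr01 B BK) => t t0; rewrite PKE.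
    have /andP[K0 K1] := K01 t t0.
    have Kn0 : 0 <= K (expR (- t)) ^+ n by exact: exprn_ge0.
    have rn0 : 0 <= M * r ^+ n by rewrite mulr_ge0// exprn_ge0.
    have qn0 : 0 <= q ^+ n by rewrite exprn_ge0// ltW.
    have [tin|tout] := boolP (t1 <= t < t1 + dlt).
      have gt := ge t tin.
      have gpos : 0 <= K (expR (- t)) ^+ n * g t.
        by rewrite mulr_ge0// (le_trans _ gt)// ltW.
      rewrite /J; case: (leP m t) => mt; case: (leP h t) => ht /=.
      - by rewrite subrr mulr0 sub0r; lra.
      - rewrite subr0 mulr1; apply: (@le_trans _ _ (e * q ^+ n)); first by lra.
        rewrite mulrC ler_pM// ?(ltW e0)//.
        by rewrite lerXn2r ?nnegrE ?(ltW q0)// Jin.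
      - by have := le_lt_trans (le_trans mh ht) mt; rewrite ltxx.
      - by rewrite subrr mulr0 sub0r; lra.
    (* Outside the interval the kernel is at most r, on [m, h) at least q; so the two sets are
       disjoint. *)
    have Jt : J t = 0.
      rewrite /J; case: (leP m t) => mt; case: (leP h t) => ht /=; rewrite ?subrr//.
        have := Kout t t0 tout; have := Jin t t0 mt ht; move: rq; lra.
      by have := le_lt_trans (le_trans mh ht) mt; rewrite ltxx.
    rewrite -/(J t) Jt mulr0 sub0r lerNl.
    apply: (@le_trans _ _ (K (expR (- t)) ^+ n * M)).
      rewrite -mulrN ler_wpM2l// lerNl; have := gM.2 t t0.
      by rewrite ler_norml => /andP[].
    by rewrite mulrC ler_wpM2l// lerXn2r ?nnegrE// Kout.
  rewrite LK (laplaceB ltr01 (boundedZ (e * q ^+ n) BJ) (bounded_cst (M * r ^+ n))).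
  by rewrite laplace_cst// (laplaceZ _ ltr01 BJ) divr1 subr_le0.
have : e * c <= 0.
  have L : M * (r / q) ^+ n @[n --> \oo] --> 0.
    rewrite -[X in _ --> X](mulr0 M); apply: cvgM; first exact: cvg_cst.
    apply: cvg_expr; rewrite ger0_norm ?divr_ge0 ?(ltW q0)//.
    by rewrite ltr_pdivrMr ?mul1r.
  rewrite -(cvg_lim _ L)//; apply: limr_ge; first by apply/cvg_ex; eexists; exact: L.
  near=> n; rewrite expr_div_n mulrA ler_pdivlMr ?exprn_gt0//.
  by have := main n; rewrite mulrAC.
by rewrite leNgt mulr_gt0.
Unshelve. all: by end_near. Qed.

Lemma laplace_inj M f M' g : bounded_on_half_line M f -> bounded_on_half_line M' g ->
  (forall t, 0 <= t -> f s @[s --> t^'+] --> f t) ->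
  (forall t, 0 <= t -> g s @[s --> t^'+] --> g t) ->
  (forall alpha, 0 < alpha -> laplace alpha f = laplace alpha g) ->
  forall t, 0 <= t -> f t = g t.
Proof.
move=> fM gM cf cg fg t t0; apply/eqP; rewrite eq_le -subr_le0 -[X in _ && X]subr_le0.
apply/andP; split.
- apply: (@laplace_eq0_le0 _ (fun t => f t - g t) t (boundedB fM gM)) => //.
    by apply: cvgB; [exact: cf|exact: cg].
  by move=> a a0; rewrite (laplaceB a0 fM gM) fg// subrr.
- apply: (@laplace_eq0_le0 _ (fun t => g t - f t) t (boundedB gM fM)) => //.
    by apply: cvgB; [exact: cg|exact: cf].
  by move=> a a0; rewrite (laplaceB a0 gM fM) fg// subrr.
Qed.

Let I alpha g h := laplace alpha (fun t => (1 - (h <= t)%R%:R) * g t).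

Lemma bounded_head h : bounded_on_half_line (1 + 1) (fun t => 1 - (h <= t)%R%:R : R).
Proof. by have := boundedB (bounded_cst (1 : R)) (bounded_tail h); rewrite normr1. Qed.

Lemma laplace_head1 alpha h : 0 < alpha -> 0 <= h ->
  laplace alpha (fun t => 1 - (h <= t)%R%:R : R) = (1 - expR (- (alpha * h))) / alpha.
Proof.
move=> a0 h0; rewrite (laplaceB a0 (bounded_cst 1) (bounded_tail h)) laplace_cst// laplace_tail1//.
by rewrite -mulrBl.
Qed.

Lemma head_le alpha h : 0 < alpha -> 0 <= h -> (1 - expR (- (alpha * h))) / alpha <= h.
Proof.
move=> a0 h0; rewrite ler_pdivrMr//; have := expR_ge1Dx (- (alpha * h)); lra.
Qed.

Lemma laplace_shift alpha M g h : 0 < alpha -> 0 <= h -> bounded_on_half_line M g ->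
  (forall t, 0 <= t -> 0 <= g t) ->
  laplace alpha (fun t => g (t + h)) =
  expR (alpha * h) * (laplace alpha g - laplace alpha (fun t => (1 - (h <= t)%R%:R) * g t)).
Proof.
move=> a0 h0 gM g0.
have -> : laplace alpha g = laplace alpha (fun t => (h <= t)%R%:R * g t + (1 - (h <= t)%R%:R) * g t).
  by apply: eq_laplace => t _; ring.
rewrite (laplaceD a0 (boundedM (bounded_tail h) gM) (boundedM (bounded_head h) gM)) addrK.
by rewrite (laplace_tail a0 h0 gM g0) mulrA -expRD subrr expR0 mul1r.
Qed.

Lemma laplace_shift_bounds alpha g h : 0 < alpha -> 0 <= h -> bounded_on_half_line 1 g ->
  (forall t, 0 <= t -> 0 <= g t) ->
  0 <= expR (alpha * h) * laplace alpha g - laplace alpha (fun t => g (t + h))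
    <= expR (alpha * h) * h.
Proof.
move=> a0 h0 gM g0; rewrite (laplace_shift a0 h0 gM g0) mulrBr subKr -/(I alpha g h).
have B := boundedM (bounded_head h) gM.
have I0 : 0 <= I alpha g h.
  by apply: (laplace_ge0 a0 B) => t t0; rewrite mulr_ge0 ?g0// subr_ge0; case: (h <= t).
rewrite mulr_ge0 ?expR_ge0//= ler_wpM2l ?expR_ge0//.
apply: le_trans (head_le a0 h0); rewrite -laplace_head1//.
apply: (ler_laplace a0 B (bounded_head h)) => t t0.
rewrite ler_piMr//; first by rewrite subr_ge0; case: (h <= t).
by apply: le_trans (gM.2 t t0); exact: ler_norm.
Qed.

Lemma cvg_expRM_right alpha : (expR (alpha * h) - 1) / h @[h --> 0^'+] --> alpha.
Proof.
have /is_derive_cvg_right := is_derive_expRM alpha 0.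
by rewrite mulr0 expR0 mulr1.
Qed.

(* The Laplace-transform counterpart of differentiating [h |-> g (t + h)] at [h = 0]. *)
Lemma laplace_derive alpha M g : 0 < alpha -> bounded_on_half_line M g ->
  (forall t, 0 <= t -> 0 <= g t) -> g s @[s --> 0^'+] --> g 0 ->
  (laplace alpha (fun t => g (t + h)) - laplace alpha g) / h @[h --> 0^'+] -->
  alpha * laplace alpha g - g 0.
Proof.
move=> a0 gM g0 cg.
pose K h := (1 - expR (- (alpha * h))) / alpha.
have K1 : K h / h @[h --> 0^'+] --> (1 : R).
  have -> : 1 = - alpha^-1 * - alpha by rewrite mulrNN mulVf// gt_eqF.
  have : - alpha^-1 * ((expR (- alpha * h) - 1) / h) @[h --> 0^'+] --> - alpha^-1 * - alpha.
    by apply: cvgM; [exact: cvg_cst|exact: cvg_expRM_right].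
  apply: cvg_trans; apply: near_eq_cvg; near=> h.
  have h0 : 0 < h by [].
  by rewrite /K/= (mulNr alpha); field; rewrite !gt_eqF.
(* [I alpha g h] is the part of the transform over [0, h), where g is within e of g 0, and [K h] is
   the same part for the constant 1, at most h. *)
have I1 : (I alpha g h - g 0 * K h) / h @[h --> 0^'+] --> (0 : R).
  apply/cvgrPdist_le => e e0.
  have [dlt d0 Hd] := right_near_le e0 cg.
  near=> h.
  have h0 : 0 < h by [].
  have hd : h <= dlt by near: h; exact: nbhs_right_le.
  rewrite sub0r normrN normrM [`|h^-1|]gtr0_norm ?invr_gt0// ler_pdivrMr//.
  have B := boundedM (bounded_head h) gM.
  have Bc := boundedZ (g 0) (bounded_head h).
  rewrite /K -laplace_head1 ?(ltW h0)// -(laplaceZ _ a0 (bounded_head h)) /I -(laplaceB a0 B Bc).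
  apply: (@le_trans _ _ (e * K h)); last by rewrite ler_wpM2l ?(ltW e0)// head_le ?(ltW h0).
  rewrite /K -laplace_head1 ?(ltW h0)// -(laplaceZ _ a0 (bounded_head h)).
  apply: (laplace_norm a0 (boundedB B Bc) (boundedZ e (bounded_head h))) => t t0.
  case: (leP h t) => ht /=; first by rewrite subrr mul0r !mulr0 subrr normr0.
  rewrite subr0 mul1r !mulr1 distrC; apply: Hd; rewrite t0 add0r.
  exact: lt_le_trans hd.
have E1 : expR (alpha * h) @[h --> 0^'+] --> (1 : R).
  rewrite -expR0 -[X in expR X](mulr0 alpha).
  apply: cvg_at_right_filter; apply: continuous_comp; last exact: continuous_expR.
  by apply: cvgM; [exact: cvg_cst|exact: cvg_id].
have II : I alpha g h / h @[h --> 0^'+] --> g 0.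
  have : (I alpha g h - g 0 * K h) / h + g 0 * (K h / h) @[h --> 0^'+] --> 0 + g 0 * 1.
    by apply: cvgD => //; apply: cvgM => //; exact: cvg_cst.
  rewrite add0r mulr1.
  apply: cvg_trans; apply: near_eq_cvg; near=> h.
  by rewrite /= [X in _ + X]mulrA -mulrDl subrK.
have : (expR (alpha * h) - 1) / h * laplace alpha g - expR (alpha * h) * (I alpha g h / h)
    @[h --> 0^'+] --> alpha * laplace alpha g - 1 * g 0.
  apply: cvgB; last exact: cvgM.
  by apply: cvgM; [exact: cvg_expRM_right|exact: cvg_cst].
rewrite mul1r; apply: cvg_trans; apply: near_eq_cvg; near=> h.
have h0 : 0 < h by [].
by rewrite /= (laplace_shift a0 (ltW h0) gM g0) -/(I alpha g h); field; rewrite gt_eqF.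
Unshelve. all: by end_near. Qed.

End LaplaceUniqueness.

(** * Resolvents of Q-processes *)

Lemma cvg_right_translate {R : realType} (f : R -> R) (t l : R) :
  f h @[h --> 0^'+] --> l -> f (s - t) @[s --> t^'+] --> l.
Proof.
move=> /cvg_at_rightP fl; apply/cvg_at_rightP => u [ut ucv].
apply: (fl (fun n => u n - t)); split; first by move=> n; rewrite subr_gt0.
by rewrite -(subrr t); apply: cvgB => //; exact: cvg_cst.
Qed.

Section StandardTransition.
Context {R : realType}.
Local Notation D := (`[(0:R), +oo[%classic : set (measurableTypeR R)).
Variable p : R -> nat -> nat -> R.
Hypothesis tp : transition_matrix p.
Hypothesis sp : standard_matrix p.

Let p0 t i j : 0 <= t -> 0 <= p t i j := @tm_ge0 _ _ tp t i j.

Lemma tm_sum_le1 t i n : 0 <= t -> \sum_(0 <= j < n) p t i j <= 1.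
Proof. by move=> t0; apply: nneseries_le => [k|]; [exact: p0|exact: tm_row]. Qed.

Lemma tm_cvg t i : 0 <= t -> cvgn (series (p t i)).
Proof.
by move=> t0; apply: (@cvg_series_bounded_ge0 _ _ 1) => [k|n]; [exact: p0|exact: tm_sum_le1].
Qed.

Lemma tm_le_sum t i j n : 0 <= t -> (j < n)%N -> p t i j <= \sum_(0 <= k < n) p t i k.
Proof.
move=> t0 jn; rewrite big_mkord (bigD1 (Ordinal jn))//= lerDl.
by apply: sumr_ge0 => k _; exact: p0.
Qed.

Lemma tm_le1 t i j : 0 <= t -> p t i j <= 1.
Proof. by move=> t0; apply: le_trans (tm_le_sum i t0 (ltnSn j)) (tm_sum_le1 i _ t0). Qed.

Definition tm_mass t i : R := limn (series (p t i)).

Lemma tm_massE t i : 0 <= t -> (\sum_(0 <= j <oo) (p t i j)%:E)%E = (tm_mass t i)%:E.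
Proof. by move=> t0; rewrite nneseries_EFin//; exact: tm_cvg. Qed.

Lemma tm_mass_le1 t i : 0 <= t -> tm_mass t i <= 1.
Proof. by move=> t0; apply: lim_series_le; [exact: tm_cvg|move=> n; exact: tm_sum_le1]. Qed.

Lemma tm_sum_le_mass t i n : 0 <= t -> \sum_(0 <= j < n) p t i j <= tm_mass t i.
Proof. by move=> t0; apply: lim_series_ge; [move=> k; exact: p0|exact: tm_cvg]. Qed.

Lemma tm_mass_ge0 t i : 0 <= t -> 0 <= tm_mass t i.
Proof. by move=> t0; apply: le_trans (tm_sum_le_mass i 0 t0); rewrite big_geq. Qed.

Lemma tm_le_mass t i j : 0 <= t -> p t i j <= tm_mass t i.
Proof. by move=> t0; exact: le_trans (tm_le_sum i t0 (ltnSn j)) (tm_sum_le_mass i _ t0). Qed.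

Section Average.
Variables (v : nat -> R) (C : R).
Hypothesis v0 : forall k, 0 <= v k.
Hypothesis vC : forall k, v k <= C.

Lemma tm_avg_sum_le t i n : 0 <= t -> \sum_(0 <= k < n) p t i k * v k <= C.
Proof.
move=> t0; apply: (@le_trans _ _ (\sum_(0 <= k < n) p t i k * C)).
  by rewrite !big_mkord; apply: ler_sum => k _; rewrite ler_wpM2l ?p0.
by rewrite -mulr_suml ler_piMl ?tm_sum_le1// (le_trans (v0 0%N)).
Qed.

Lemma tm_avg_cvg t i : 0 <= t -> cvgn (series (fun k => p t i k * v k)).
Proof.
move=> t0; apply: (@cvg_series_bounded_ge0 _ _ C) => [k|n]; first by rewrite mulr_ge0 ?p0.
exact: tm_avg_sum_le.
Qed.

(** The states from M on carry mass at most 1 minus the first row sum, and v is at most C there. *)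
Lemma tm_avg_tail t i M : 0 <= t ->
  \sum_(0 <= k < M) p t i k * v k <= limn (series (fun k => p t i k * v k)) <=
  \sum_(0 <= k < M) p t i k * v k + C * (1 - \sum_(0 <= k < M) p t i k).
Proof.
move=> t0; have pv0 k : 0 <= p t i k * v k by rewrite mulr_ge0 ?p0.
have C0 : 0 <= C by exact: le_trans (vC 0%N).
rewrite lim_series_ge ?andTb//=; last exact: tm_avg_cvg.
apply: lim_series_le; first exact: tm_avg_cvg.
move=> n; apply: (@le_trans _ _ (\sum_(0 <= k < M + n) p t i k * v k)).
  rewrite [leRHS](big_cat_nat (n := n))//= ?leq_addl// lerDl.
  by apply: sumr_ge0 => k _.
rewrite [leLHS](big_cat_nat (n := M))//= ?leq_addr// lerD2l.
have := tm_sum_le1 i (M + n) t0; rewrite (big_cat_nat (n := M))//= ?leq_addr//.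
set s := \sum_(0 <= k < M) _ => H.
apply: (@le_trans _ _ (C * \sum_(M <= k < M + n) p t i k)).
  by rewrite mulr_sumr; apply: ler_sum => k _; rewrite mulrC ler_wpM2r ?p0.
by rewrite ler_wpM2l//; lra.
Qed.

End Average.

Lemma tm_semigroupE s t i j : 0 <= s -> 0 <= t ->
  p (s + t) i j = limn (series (fun k => p s i k * p t k j)).
Proof.
move=> s0 t0; have := tm_semigroup tp i j s0 t0.
rewrite nneseries_EFin; first by move=> [].
by apply: (@tm_avg_cvg (fun k => p t k j) 1) => // k; [exact: p0|exact: tm_le1].
Qed.

(** In the semigroup identity only the term through i is kept; the other intermediate states have
    total mass at most [1 - p s i i]. This turns standardness at 0 into right continuity
    everywhere. *)
Lemma tm_diag_le s t i j : 0 <= s -> 0 <= t ->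
  p s i i * p t i j <= p (s + t) i j <= p s i i * p t i j + (1 - p s i i).
Proof.
move=> s0 t0; rewrite tm_semigroupE//.
have v0 k : 0 <= p t k j by exact: p0.
have v1 k : p t k j <= 1 by exact: tm_le1.
have /andP[A B] := @tm_avg_tail _ 1 v0 v1 s i i.+1 s0.
have E f : \sum_(0 <= k < i.+1) f k = f i + \sum_(0 <= k < i) f k :> R.
  by rewrite big_nat_recr//= addrC.
rewrite !E in A B.
have L0 : 0 <= \sum_(0 <= k < i) p s i k * p t k j.
  by apply: sumr_ge0 => k _; rewrite mulr_ge0 ?p0.
have L1 : \sum_(0 <= k < i) p s i k * p t k j <= \sum_(0 <= k < i) p s i k.
  by apply: ler_sum => k _; rewrite ler_piMr ?p0 ?tm_le1.
apply/andP; split; lra.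
Qed.

Lemma tm_right_continuous i j t : 0 <= t -> p s i j @[s --> t^'+] --> p t i j.
Proof.
move=> t0.
have d1 : p (s - t) i i @[s --> t^'+] --> (1 : R).
  apply: (@cvg_right_translate _ (fun h => p h i i)).
  by have := @std_lim _ _ sp i i; rewrite eqxx.
apply: (@squeeze_cvgr _ _ _ _ (fun s => p (s - t) i i * p t i j)
  (fun s => p (s - t) i i * p t i j + (1 - p (s - t) i i))).
- near=> s; have st : t < s by [].
  by have := @tm_diag_le (s - t) t i j; rewrite subrK; apply => //; rewrite subr_ge0 ltW.
- rewrite -[X in _ --> X]mul1r; apply: cvgM => //; exact: cvg_cst.
- rewrite -[X in _ --> X]addr0 -(subrr (1 : R)) -[X in _ --> X + _]mul1r.
  apply: cvgD; first by apply: cvgM => //; exact: cvg_cst.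
  by apply: cvgB => //; exact: cvg_cst.
Unshelve. all: by end_near. Qed.

Lemma tm_measurable i j : measurable_fun D (fun t => p t i j).
Proof. by apply: right_continuous_measurable1 => t; exact: tm_right_continuous. Qed.

Lemma tm_bounded i j : bounded_on_half_line 1 (fun t => p t i j).
Proof. by split; [exact: tm_measurable|move=> t t0; rewrite ger0_norm ?p0 ?tm_le1]. Qed.

Lemma tm_mass_bounded i : bounded_on_half_line 1 (fun t => tm_mass t i).
Proof.
apply: (@bounded_series _ 1 (fun j t => p t i j)).
- by move=> k; exact: tm_measurable.
- by move=> k t; exact: p0.
- by move=> n t; exact: tm_sum_le1.
Qed.

Lemma tm_mass_right0 i : tm_mass s i @[s --> 0^'+] --> tm_mass 0 i.
Proof.
have -> : tm_mass 0 i = 1.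
  apply/eqP; rewrite eq_le tm_mass_le1//= -[X in X <= _](_ : p 0 i i = 1) ?tm_le_mass//.
  by rewrite (std_at0 sp) eqxx.
apply: (@squeeze_cvgr _ _ _ _ (fun s => p s i i) (fun=> 1)).
- by near=> s; rewrite tm_le_mass ?tm_mass_le1.
- by have := @std_lim _ _ sp i i; rewrite eqxx.
- exact: cvg_cst.
Unshelve. all: by end_near. Qed.

Lemma tm_mass_diag s t i : 0 <= s -> 0 <= t -> p s i i * tm_mass t i <= tm_mass (s + t) i.
Proof.
move=> s0 t0; have st0 := addr_ge0 s0 t0.
have -> : p s i i * tm_mass t i = limn (fun n => p s i i * series (p t i) n).
  by apply/esym/cvg_lim => //; apply: cvgM; [exact: cvg_cst|exact: tm_cvg].
apply: limr_le; first by apply: is_cvgM; [exact: is_cvg_cst|exact: tm_cvg].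
near=> n; apply: le_trans (tm_sum_le_mass i n st0).
rewrite /series/= mulr_sumr !big_mkord; apply: ler_sum => j _.
by have /andP[] := tm_diag_le i j s0 t0.
Unshelve. all: by end_near. Qed.

Definition resv alpha i j : R := laplace alpha (fun t => p t i j).

Lemma resolvent_some alpha i j : resolvent p alpha (Some i) [set Some j] = resv alpha i j.
Proof.
rewrite /resolvent /resv; apply: eq_laplace => t t0.
by rewrite esum_set1//= lee_fin p0.
Qed.

Lemma resolvent_some_none alpha i : 0 < alpha ->
  resolvent p alpha (Some i) [set None] =
  alpha^-1 - laplace alpha (fun t => tm_mass t i).
Proof.
move=> a0; rewrite -div1r -laplace_cst// -(laplaceB a0 (bounded_cst 1) (tm_mass_bounded i)).
rewrite /resolvent; apply: eq_laplace => t t0.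
by rewrite esum_set1/= ?tm_massE//= lee_fin subr_ge0 tm_mass_le1.
Qed.

Lemma resolvent_none_some alpha j : 0 < alpha -> resolvent p alpha None [set Some j] = 0.
Proof.
move=> a0; rewrite -[RHS](mul0r alpha^-1) -laplace_cst// /resolvent; apply: eq_laplace => t t0.
by rewrite esum_set1/=.
Qed.

Lemma resv_ge0 alpha i j : 0 < alpha -> 0 <= resv alpha i j.
Proof. by move=> a0; apply: (laplace_ge0 a0 (tm_bounded i j)) => t; exact: p0. Qed.

Lemma resv_le alpha i j : 0 < alpha -> resv alpha i j <= alpha^-1.
Proof.
move=> a0; rewrite -div1r; apply: (laplace_le_cst a0 (tm_bounded i j)) => t; exact: tm_le1.
Qed.

Lemma resv_series alpha i : 0 < alpha ->
  series (resv alpha i) @ \oo --> laplace alpha (fun t => tm_mass t i).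
Proof.
move=> a0; apply: (@laplace_series _ 1 (fun j t => p t i j)) => //.
- by move=> k; exact: tm_measurable.
- by move=> k t; exact: p0.
- by move=> n t; exact: tm_sum_le1.
Qed.

(** Lets [p h] act on the resolvent as a time shift under the integral; differentiating at h = 0
    yields the backward equation. *)
Lemma resv_shift alpha h i j : 0 < alpha -> 0 <= h ->
  series (fun k => p h i k * resv alpha k j) @ \oo --> laplace alpha (fun t => p (t + h) i j).
Proof.
move=> a0 h0.
have -> : laplace alpha (fun t => p (t + h) i j) =
    laplace alpha (fun t => limn (series (fun k => p h i k * p t k j))).
  by apply: eq_laplace => t t0; rewrite addrC tm_semigroupE.
have -> : (fun k => p h i k * resv alpha k j) = (fun k => laplace alpha (fun t => p h i k * p t k j)).
  by apply/funext => k; rewrite (laplaceZ _ a0 (tm_bounded k j)).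
apply: (@laplace_series _ 1 (fun k t => p h i k * p t k j)) => //.
- by move=> k; apply: measurable_funM; [exact: measurable_cst|exact: tm_measurable].
- by move=> k t t0; rewrite mulr_ge0 ?p0.
- by move=> n t t0; apply: (@tm_avg_sum_le (fun k => p t k j)) => // k; [exact: p0|exact: tm_le1].
Qed.

End StandardTransition.

(** * Solutions of alpha v = Q v *)

Section Harmonic.
Context {R : realType} (a b : nat -> R) (alpha : R).
Hypothesis b_gt0 : forall k, 0 < b k.

Definition bd_harmonic (v : nat -> R) : Prop := forall i,
  alpha * v i = a i * (v i.-1 - v i) + b i * (v i.+1 - v i).

Lemma bd_harmonic_lin (c c' : R) v w : bd_harmonic v -> bd_harmonic w ->
  bd_harmonic (fun i => c * v i + c' * w i).
Proof.
move=> hv hw i; rewrite mulrDr mulrCA hv (mulrCA alpha) hw; ring.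
Qed.

(** As [b i] is nonzero, the equation at i determines [v i.+1] from [v i] and [v i.-1]; at 0 the
    predecessor is 0 itself, so a single initial value fixes the solution. *)
Lemma bd_harmonic_eq0 v : bd_harmonic v -> v 0%N = 0 -> forall i, v i = 0.
Proof.
move=> hv v0 i; suff [] : v i = 0 /\ v i.+1 = 0 by [].
have step k : v k = 0 -> v k.-1 = 0 -> v k.+1 = 0.
  move=> vi vi1; have := hv k; rewrite vi vi1 !subrr !mulr0 subr0 add0r => /esym/eqP.
  by rewrite mulf_eq0 gt_eqF//= => /eqP.
by elim: i => [|i [IH1 IH2]]; split=> //; apply: step.
Qed.

(** The combination of v and w that vanishes at 0 vanishes identically. *)
Lemma bd_harmonic_prop v w : bd_harmonic v -> bd_harmonic w ->
  forall i, w 0%N * v i = v 0%N * w i.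
Proof.
move=> hv hw i.
have := bd_harmonic_eq0 (bd_harmonic_lin (w 0%N) (- v 0%N) hv hw).
by rewrite mulNr mulrC subrr => /(_ erefl i)/eqP; rewrite mulNr subr_eq0 => /eqP.
Qed.

End Harmonic.

(** * The backward equation for resolvents *)

Section BackwardEquation.
Context {R : realType} (a b : nat -> R).
Hypothesis a0 : a 0%N = 0.
Variable p : R -> nat -> nat -> R.
Hypothesis Qp : Q_process a b p.
Let tp := Qp_transition Qp.
Let sp := Qp_standard Qp.

Let q_avg (v : nat -> R) (i : nat) : R := a i * (v i.-1 - v i) + b i * (v i.+1 - v i).

(** The derivative acts on an infinite sum, but row i of Q lives on the neighbours of i and sums to
    0: the mass missing from the first i + 2 states is o(h), and v is bounded. *)
Lemma Q_process_generator (v : nat -> R) (C : R) (i : nat) :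
  (forall k, 0 <= v k) -> (forall k, v k <= C) ->
  (limn (series (fun k => p h i k * v k)) - v i) / h @[h --> 0^'+] --> q_avg v i.
Proof.
move=> v0 vC; pose M := i.+2.
have iM : (i < M)%N by rewrite /M ltnS leqW.
have d k : (p h i k - (i == k)%:R) / h @[h --> 0^'+] --> bd_matrix a b i k.
  by have := @Qp_derivative _ _ _ _ Qp i k; rewrite (std_at0 sp).
have delta w : \sum_(0 <= k < M) (i == k)%:R * w k = w i :> R.
  rewrite big_mkord (bigD1 (Ordinal iM))//= eqxx mul1r big1 ?addr0// => l.
  by rewrite -val_eqE/= eq_sym => /negPf ->; rewrite mul0r.
have L w : (\sum_(0 <= k < M) p h i k * w k - w i) / h @[h --> 0^'+] --> q_avg w i.
  have : \sum_(0 <= k < M) (p h i k - (i == k)%:R) / h * w k @[h --> 0^'+] -->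
      \sum_(0 <= k < M) bd_matrix a b i k * w k.
    apply: (@cvg_sum_nat _ _ _ _ M (fun k h => (p h i k - (i == k)%:R) / h * w k)) => k _.
    by apply: cvgM; [exact: d|exact: cvg_cst].
  rewrite bd_matrix_sum// /M ltnS leqnn mul1r.
  apply: cvg_trans; apply: near_eq_cvg; near=> h.
  rewrite -[X in _ = (_ - X) / _](delta w) -sumrB mulr_suml.
  by apply: eq_bigr => k _; rewrite -mulrBl mulrAC.
(* The case v = 1 of [L], where conservativity of Q makes the limit 0. *)
have L1 : C * ((\sum_(0 <= k < M) p h i k * 1 - 1) / h) @[h --> 0^'+] --> C * 0.
  apply: cvgM; first exact: cvg_cst.
  by have := L (fun=> 1); rewrite /q_avg subrr !mulr0 addr0.
rewrite mulr0 in L1.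
apply: (@squeeze_cvgr _ _ _ _ (fun h => (\sum_(0 <= k < M) p h i k * v k - v i) / h)
  (fun h => (\sum_(0 <= k < M) p h i k * v k - v i) / h -
     C * ((\sum_(0 <= k < M) p h i k * 1 - 1) / h))).
- near=> h; have h0 : 0 < h by [].
  have /andP[A B] := tm_avg_tail tp v0 vC i M (ltW h0).
  rewrite ler_pM2r ?invr_gt0// lerD2r A/= mulrA -mulrBl ler_pM2r ?invr_gt0//.
  have -> : \sum_(0 <= k < M) p h i k * 1 = \sum_(0 <= k < M) p h i k.
    by apply: eq_bigr => k _; rewrite mulr1.
  by lra.
- exact: L.
- rewrite -[X in _ --> X]subr0; apply: cvgB; first exact: L.
  exact: L1.
Unshelve. all: by end_near. Qed.

(** The derivative at h = 0 of the transform of [p (t + h)] is computed twice: by [laplace_derive],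
    and by applying the generator to the resolvent through [resv_shift]. *)
Lemma resv_backward alpha i j : 0 < alpha ->
  alpha * resv p alpha i j - (i == j)%:R =
  q_avg (fun k => resv p alpha k j) i.
Proof.
move=> al0.
have v0 k : 0 <= resv p alpha k j by exact: resv_ge0.
have vC k : resv p alpha k j <= alpha^-1 by exact: resv_le.
have L1 := @Q_process_generator _ _ i v0 vC.
have L2 : (laplace alpha (fun t => p (t + h) i j) - resv p alpha i j) / h @[h --> 0^'+]
    --> alpha * resv p alpha i j - (i == j)%:R.
  rewrite -(std_at0 sp); apply: (laplace_derive al0 (tm_bounded tp sp i j)).
    by move=> t; exact: tm_ge0.
  by apply: (tm_right_continuous tp sp).
rewrite -(cvg_lim _ L2)//; apply: cvg_lim => //; apply: cvg_trans L1; apply: near_eq_cvg; near=> h.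
have h0 : 0 < h by [].
by rewrite (cvg_lim _ (@resv_shift _ _ tp sp alpha h i j al0 (ltW h0))).
Unshelve. all: by end_near. Qed.

Lemma flying_laplaceE alpha i : 0 < alpha ->
  flying_laplace p alpha i = 1 - alpha * laplace alpha (fun t => tm_mass p t i).
Proof.
by move=> al0; rewrite /flying_laplace (cvg_lim _ (@resv_series _ _ tp sp alpha i al0)).
Qed.

Lemma flying_laplace_ge0 alpha i : 0 < alpha -> 0 <= flying_laplace p alpha i.
Proof.
move=> al0; rewrite flying_laplaceE// subr_ge0 mulrC -ler_pdivlMr//.
apply: (laplace_le_cst al0 (tm_mass_bounded tp sp i)) => t; exact: tm_mass_le1.
Qed.

Lemma flying_laplace_le1 alpha i : 0 < alpha -> flying_laplace p alpha i <= 1.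
Proof.
move=> al0; rewrite flying_laplaceE// lerBlDl lerDr mulr_ge0 ?(ltW al0)//.
apply: (laplace_ge0 al0 (tm_mass_bounded tp sp i)) => t; exact: tm_mass_ge0.
Qed.

(** Summing the backward equation over the target j gives alpha L - 1 = Q L for the transform L of
    the survival probability; then substitute u = 1 - alpha L. *)
Lemma flying_laplace_harmonic alpha : 0 < alpha ->
  bd_harmonic a b alpha (flying_laplace p alpha).
Proof.
move=> al0 i; rewrite !flying_laplaceE//.
set L := fun k => laplace alpha (fun t => tm_mass p t k).
rewrite -/(L i) -/(L i.-1) -/(L i.+1).
have cL k : series (resv p alpha k) @ \oo --> L k by exact: resv_series.
have H : alpha * L i - 1 = q_avg L i.
  have C1 : alpha * series (resv p alpha i) n - 1 @[n --> \oo] --> alpha * L i - 1.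
    by apply: cvgB; [apply: cvgM; [exact: cvg_cst|exact: cL]|exact: cvg_cst].
  have C2 : q_avg (fun k => series (resv p alpha k) n) i @[n --> \oo] --> q_avg L i.
    apply: cvgD; apply: cvgM; try exact: cvg_cst; apply: cvgB; exact: cL.
  rewrite -(cvg_lim _ C1)//; apply: cvg_lim => //; apply: cvg_trans C2; apply: near_eq_cvg; near=> n.
  have ni : (i < n)%N by near: n; exists i.+1.
  have -> : 1 = \sum_(0 <= j < n) (i == j)%:R :> R.
    rewrite big_mkord (bigD1 (Ordinal ni))//= eqxx big1 ?addr0// => l.
    by rewrite -val_eqE/= eq_sym => /negPf ->.
  rewrite /series/= mulr_sumr -sumrB.
  under [RHS]eq_bigr do rewrite resv_backward//.
  by rewrite /q_avg big_split/= -!mulr_sumr !sumrB.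
rewrite /q_avg in H; rewrite mulrBr mulr1 mulrA -mulrA -[LHS]opprB.
have -> : alpha * (alpha * L i) - alpha = alpha * (alpha * L i - 1) by ring.
by rewrite H; ring.
Unshelve. all: by end_near. Qed.

End BackwardEquation.

(** * Averages against a subprobability weight *)

Section WeightedSeries.
Context {R : realType} (w : nat -> R).
Hypothesis w0 : forall k, 0 <= w k.
Hypothesis w1 : forall n, \sum_(0 <= k < n) w k <= 1.
Implicit Types (x : nat -> R) (C : R).

Lemma weighted_sum_le x C n : (forall k, 0 <= x k <= C) ->
  \sum_(0 <= k < n) w k * x k <= C.
Proof.
move=> xC; have C0 : 0 <= C by have /andP[/le_trans] := xC 0%N; apply.
apply: (@le_trans _ _ (\sum_(0 <= k < n) w k * C)).
  by rewrite !big_mkord; apply: ler_sum => k _; rewrite ler_wpM2l//; have /andP[] := xC k.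
by rewrite -mulr_suml ler_piMl.
Qed.

Lemma weighted_cvg x C : (forall k, 0 <= x k <= C) -> cvgn (series (fun k => w k * x k)).
Proof.
move=> xC; apply: (@cvg_series_bounded_ge0 _ _ C) => [k|n].
  by rewrite mulr_ge0//; have /andP[] := xC k.
exact: weighted_sum_le.
Qed.

Lemma weight_cvg : cvgn (series w).
Proof. exact: cvg_series_bounded_ge0 w1. Qed.

Lemma weighted_ge0 x C : (forall k, 0 <= x k <= C) -> 0 <= limn (series (fun k => w k * x k)).
Proof.
move=> xC; apply: lim_series_ge0; last exact: weighted_cvg xC.
by move=> k; rewrite mulr_ge0//; have /andP[] := xC k.
Qed.

Lemma weighted_le x C : (forall k, 0 <= x k <= C) -> limn (series (fun k => w k * x k)) <= C.
Proof.
by move=> xC; apply: lim_series_le => [|n]; [exact: weighted_cvg xC|exact: weighted_sum_le].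
Qed.

Lemma weighted_lin x C y C' (c : R) : (forall k, 0 <= x k <= C) -> (forall k, 0 <= y k <= C') ->
  limn (series (fun k => w k * (x k + c * y k))) =
  limn (series (fun k => w k * x k)) + c * limn (series (fun k => w k * y k)).
Proof.
move=> xC yC; apply: cvg_lim => //.
rewrite (_ : series _ = fun n => series (fun k => w k * x k) n + c * series (fun k => w k * y k) n).
  apply: cvgD; first exact: weighted_cvg xC.
  by apply: cvgM; [exact: cvg_cst|exact: weighted_cvg yC].
apply/funext => n; rewrite /series/= mulr_sumr -big_split/=.
by apply: eq_bigr => k _; ring.
Qed.

(** No uniform gap below 1 is available: one state k with positive weight already gives the deficit
    [w k * (1 - x k)], and without such a state the sum is 0. *)
Lemma weighted_lt1 x : (forall k, 0 <= x k < 1) -> limn (series (fun k => w k * x k)) < 1.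
Proof.
move=> x1; have xle k : 0 <= x k <= 1 by have /andP[-> /ltW ->] := x1 k.
have [[k wk]|/forallNP wN] := pselect (exists k, 0 < w k).
  apply: (@le_lt_trans _ _ (1 - w k * (1 - x k))); last first.
    by rewrite ltrBlDr ltrDl mulr_gt0// subr_gt0; have /andP[] := x1 k.
  apply: lim_series_le; first exact: weighted_cvg xle.
  move=> n; apply: (@le_trans _ _ (\sum_(0 <= l < k.+1 + n) w l * x l)).
    rewrite [leRHS](big_cat_nat (n := n))//= ?leq_addl// lerDl.
    by apply: sumr_ge0 => l _; rewrite mulr_ge0//; have /andP[] := x1 l.
  have kn : (k < k.+1 + n)%N by rewrite ltn_addr.
  have E (f : nat -> R) : \sum_(0 <= l < k.+1 + n) f l = f k + \sum_(l < k.+1 + n | l != Ordinal kn) f l.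
    by rewrite big_mkord (bigD1 (Ordinal kn)).
  have := w1 (k.+1 + n)%N; rewrite !E.
  have : \sum_(i < k.+1 + n | i != Ordinal kn) w i * x i <=
    \sum_(i < k.+1 + n | i != Ordinal kn) w i.
    by apply: ler_sum => i _; rewrite ler_piMr//; have /andP[] := xle i.
  by lra.
have -> : (fun k => w k * x k) = fun=> 0.
  by apply/funext => k; have /negP := wN k; rewrite -leNgt => wk; rewrite (_ : w k = 0) ?mul0r//; apply/le_anti; rewrite wk w0.
rewrite (_ : series _ = cst 0) ?lim_cst//.
by apply/funext => n; rewrite /series/= big1.
Qed.

Lemma weighted_tail x C K : (forall k, 0 <= x k <= C) ->
  \sum_(0 <= k < K) w k * x k <= limn (series (fun k => w k * x k)) <=
  \sum_(0 <= k < K) w k * x k + C * (limn (series w) - \sum_(0 <= k < K) w k).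
Proof.
move=> xC; have C0 : 0 <= C by have /andP[/le_trans] := xC 0%N; apply.
have wx0 k : 0 <= w k * x k by rewrite mulr_ge0//; have /andP[] := xC k.
rewrite lim_series_ge ?andTb//=; last exact: weighted_cvg xC.
apply: lim_series_le; first exact: weighted_cvg xC.
move=> n; apply: (@le_trans _ _ (\sum_(0 <= k < K + n) w k * x k)).
  rewrite [leRHS](big_cat_nat (n := n))//= ?leq_addl// lerDl.
  by apply: sumr_ge0 => k _.
rewrite [leLHS](big_cat_nat (n := K))//= ?leq_addr// lerD2l.
have := lim_series_ge (K + n) w0 weight_cvg; rewrite (big_cat_nat (n := K))//= ?leq_addr//.
set s := \sum_(0 <= k < K) _ => H.
apply: (@le_trans _ _ (C * \sum_(K <= k < K + n) w k)).
  rewrite mulr_sumr; apply: ler_sum => k _; rewrite mulrC ler_wpM2r//.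
  by have /andP[] := xC k.
by rewrite ler_wpM2l//; lra.
Qed.

(** Dominated convergence along an arbitrary filter: beyond K the error is at most C times the
    remaining weight, uniformly in t. *)
Lemma weighted_dominated {T : Type} (F : set_system T) {FF : Filter F}
    (x : T -> nat -> R) (y : nat -> R) C :
  (\forall t \near F, forall k, 0 <= x t k <= C) -> (forall k, 0 <= y k <= C) ->
  (forall k, x t k @[t --> F] --> y k) ->
  limn (series (fun k => w k * x t k)) @[t --> F] --> limn (series (fun k => w k * y k)).
Proof.
move=> xC yC xy; have C0 : 0 <= C by have /andP[/le_trans] := yC 0%N; apply.
apply/cvgrPdist_le => e e0.
have [K HK] : exists K, C * (limn (series w) - \sum_(0 <= k < K) w k) <= e / 2.
  have : C * (limn (series w) - series w n) @[n --> \oo] --> C * (limn (series w) - limn (series w)).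
    by apply: cvgM; [exact: cvg_cst|apply: cvgB; [exact: cvg_cst|exact: weight_cvg]].
  rewrite subrr mulr0 => /cvgrPdist_le/(_ _ (divr_gt0 e0 (ltr0Sn R 1)))[K _ /(_ K (leqnn K))].
  rewrite sub0r normrN => H; exists K; apply: le_trans (ler_norm _) _.
  exact: H.
have fin : \sum_(0 <= k < K) w k * x t k @[t --> F] --> \sum_(0 <= k < K) w k * y k.
  apply: (@cvg_sum_nat _ _ F _ K (fun k t => w k * x t k)) => k _.
  by apply: cvgM; [exact: cvg_cst|exact: xy].
move/cvgrPdist_le/(_ _ (divr_gt0 e0 (ltr0Sn R 1))) : fin => fin.
near=> t.
have xtC : forall k, 0 <= x t k <= C by near: t.
have /andP[A1 A2] := weighted_tail K xtC; have /andP[B1 B2] := weighted_tail K yC.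
have : `|\sum_(0 <= k < K) w k * y k - \sum_(0 <= k < K) w k * x t k| <= e / 2 by near: t.
rewrite !ler_norml => /andP[H1 H2]; apply/andP; split; lra.
Unshelve. all: by end_near. Qed.

(** A partial sum in j is the average of the partial sums of the rows, which converge and are
    dominated by C. *)
Lemma weighted_exchange (x : nat -> nat -> R) C : (forall k j, 0 <= x k j) ->
  (forall k n, \sum_(0 <= j < n) x k j <= C) ->
  series (fun j => limn (series (fun k => w k * x k j))) @ \oo -->
  limn (series (fun k => w k * limn (series (x k)))).
Proof.
move=> x0 xC.
have xkjC k j : 0 <= x k j <= C.
  rewrite x0/=; apply: le_trans (xC k j.+1); rewrite big_nat_recr//= lerDr.
  by apply: sumr_ge0.
have xc k : cvgn (series (x k)) by exact: cvg_series_bounded_ge0 (xC k).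
have sE n : series (fun j => limn (series (fun k => w k * x k j))) n =
    limn (series (fun k => w k * series (x k) n)).
  apply/esym/cvg_lim => //.
  rewrite (_ : series _ = fun m => \sum_(0 <= j < n) series (fun k => w k * x k j) m).
    apply: cvg_sum_nat => j _; exact: weighted_cvg (xkjC ^~ j).
  apply/funext => m; rewrite /series/= exchange_big/=; apply: eq_bigr => k _.
  by rewrite mulr_sumr.
rewrite (funext sE).
apply: (@weighted_dominated _ _ _ (fun n k => series (x k) n) _ C) => //.
- by near=> n => k; rewrite xC andbT sumr_ge0.
- move=> k; rewrite lim_series_ge0//=; exact: lim_series_le.
Unshelve. all: by end_near. Qed.

End WeightedSeries.

(** * Behaviour of the resolvents as the starting point tends to oo *)

Section MinimalResolvent.
Context {R : realType} (a b : nat -> R).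
Hypothesis a0 : a 0%N = 0.
Hypothesis a_gt0 : forall k, (0 < k)%N -> 0 < a k.
Hypothesis b_gt0 : forall k, 0 < b k.
Hypothesis sfin : (bd_sigma a b < +oo)%E.
Variable pmin : R -> nat -> nat -> R.
Hypothesis pmin_min : minimal_Q_process a b pmin.
Let Qmin := pmin_min.1.
Let tmin := Qp_transition Qmin.
Let smin := Qp_standard Qmin.

(** The survival probability is at most 1 before time e / 2, which costs at most e / 2, and at most
    z_i / (e / 2) afterwards. *)
Lemma laplace_mass_cvg0 alpha : 0 < alpha ->
  laplace alpha (fun t => tm_mass pmin t i) @[i --> \oo] --> 0.
Proof.
move=> al0; have [z [z0 zoo zb]] := minimal_row_bound a0 a_gt0 b_gt0 sfin pmin_min.
have zS i t : 0 <= t -> t * tm_mass pmin t i <= z i.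
  move=> t0; have -> : t * tm_mass pmin t i = limn (fun n => t * series (pmin t i) n).
    by apply/esym/cvg_lim => //; apply: cvgM; [exact: cvg_cst|exact: tm_cvg].
  apply: limr_le; first by apply: is_cvgM; [exact: is_cvg_cst|exact: tm_cvg].
  by near=> n; exact: zb.
apply/cvgrPdist_le => e e0.
have e20 : 0 < e / 2 by rewrite divr_gt0.
(* The constant z_i / (e / 2) has transform z_i / (e / 2) / alpha, which is to be at most e / 2. *)
move/cvgrPdist_le : zoo => /(_ _ (mulr_gt0 e20 (mulr_gt0 e20 al0))) zoo.
near=> i; rewrite sub0r normrN.
have B := tm_mass_bounded tmin smin i.
rewrite ger0_norm; last by apply: (laplace_ge0 al0 B) => t; exact: tm_mass_ge0.
have B2 := boundedD (bounded_head (e / 2)) (bounded_cst (z i / (e / 2))).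
apply: (@le_trans _ _ (laplace alpha (fun t => (1 - (e / 2 <= t)%R%:R) + z i / (e / 2)))).
  apply: (ler_laplace al0 B B2) => t t0; case: (leP (e / 2) t) => et /=.
    rewrite subrr add0r ler_pdivlMr// mulrC; apply: le_trans (zS i t t0).
    by rewrite ler_wpM2r ?tm_mass_ge0.
  by rewrite subr0 (le_trans (tm_mass_le1 tmin i t0))// lerDl divr_ge0// ltW.
rewrite (laplaceD al0 (bounded_head (e / 2)) (bounded_cst (z i / (e / 2)))) laplace_cst//.
rewrite [leRHS]splitr lerD//.
  by rewrite laplace_head1 ?head_le ?(ltW e20).
rewrite !ler_pdivrMr//.
have : `|0 - z i| <= e / 2 * (e / 2 * alpha) by near: i.
rewrite sub0r normrN ger0_norm// => H; apply: (le_trans H).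
by rewrite le_eqVlt; apply/orP; left; apply/eqP; ring.
Unshelve. all: by end_near. Qed.

Lemma flying_laplace_cvg1 alpha : 0 < alpha ->
  flying_laplace pmin alpha i @[i --> \oo] --> (1 : R).
Proof.
move=> al0; rewrite (_ : flying_laplace _ _ = fun i => 1 - alpha * laplace alpha (fun t => tm_mass pmin t i)).
  rewrite -[X in _ --> X]subr0 -(mulr0 alpha); apply: cvgB; first exact: cvg_cst.
  by apply: cvgM; [exact: cvg_cst|exact: laplace_mass_cvg0].
by apply/funext => i; rewrite (flying_laplaceE Qmin).
Qed.

(** A harmonic function vanishing at 0 vanishes everywhere, against the limit 1 at oo. *)
Lemma flying_laplace0_gt0 alpha : 0 < alpha -> 0 < flying_laplace pmin alpha 0.
Proof.
move=> al0; rewrite lt_neqAle eq_sym (flying_laplace_ge0 Qmin)// andbT; apply/eqP => u0.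
have /(_ _)H := bd_harmonic_eq0 b_gt0 (flying_laplace_harmonic a0 Qmin al0) u0.
have : limn (flying_laplace pmin alpha) = 1 by apply: cvg_lim => //; exact: flying_laplace_cvg1.
rewrite (_ : flying_laplace pmin alpha = cst 0) ?lim_cst//; last exact/funext.
by move/eqP; rewrite eq_sym oner_eq0.
Qed.

(** By standardness the chain is still at i with probability at least 1/2 throughout some interval
    [0, dlt), so the transform of the survival probability is positive. *)
Lemma flying_laplace_lt1 alpha i : 0 < alpha -> flying_laplace pmin alpha i < 1.
Proof.
move=> al0; rewrite (flying_laplaceE Qmin)// ltrBlDl ltrDr mulr_gt0//.
have cg := @tm_right_continuous _ _ tmin smin i i 0 (lexx 0).
have [dlt d0 Hd] := right_near_le (@divr_gt0 _ 1 2 ltr01 (ltr0Sn R 1)) cg.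
rewrite (std_at0 smin) eqxx add0r in Hd.
apply: (@lt_le_trans _ _ (2^-1 * ((1 - expR (- (alpha * dlt))) / alpha))).
  rewrite mulr_gt0 ?invr_gt0// divr_gt0// subr_gt0 -expR0 ltr_expR oppr_lt0.
  by rewrite mulr_gt0.
rewrite -laplace_head1 ?(ltW d0)// -(laplaceZ _ al0 (bounded_head dlt)).
apply: (ler_laplace al0 (boundedZ _ (bounded_head dlt)) (tm_mass_bounded tmin smin i)) => t t0.
apply: le_trans (tm_le_mass tmin i i t0).
case: (leP dlt t) => dt /=; first by rewrite subrr mulr0 (tm_ge0 tmin).
rewrite subr0 mulr1; have := Hd t; rewrite t0 dt => /(_ erefl).
by rewrite (_ : true%:R = 1)// ler_distlC => /andP[+ _]; lra.
Qed.

Variable p : R -> nat -> nat -> R.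
Hypothesis Qp : Q_process a b p.
Let tp := Qp_transition Qp.
Let sp := Qp_standard Qp.

(** The common ratio of two proportional harmonic functions, read off at state 0 where the
    denominator is positive; [boundary_resv_cvg] identifies it with the limit of the resolvent at
    oo. *)
Definition boundary_resv alpha j : R :=
  (resv p alpha 0 j - resv pmin alpha 0 j) / flying_laplace pmin alpha 0.

(* Both [resv p alpha ^~ j - resv pmin alpha ^~ j] and [flying_laplace] solve alpha v = Q v, a one-dimensional space. *)
Lemma resv_decomposition alpha i j : 0 < alpha ->
  resv p alpha i j = resv pmin alpha i j + flying_laplace pmin alpha i * boundary_resv alpha j.
Proof.
move=> al0.
have hd : bd_harmonic a b alpha (fun k => resv p alpha k j - resv pmin alpha k j).
  move=> k; have := resv_backward a0 Qp k j al0; have := resv_backward a0 Qmin k j al0.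
  set e := (k == j)%:R => H1 H2.
  have -> : alpha * (resv p alpha k j - resv pmin alpha k j) =
    (alpha * resv p alpha k j - e) - (alpha * resv pmin alpha k j - e) by ring.
  by rewrite H1 H2; ring.
have := bd_harmonic_prop b_gt0 hd (flying_laplace_harmonic a0 Qmin al0) i.
rewrite /boundary_resv => H.
have u0 := flying_laplace0_gt0 al0; apply: (mulfI (lt0r_neq0 u0)).
set X := resv p alpha 0 j - _ in H *; set u := flying_laplace pmin alpha i in H *.
set v := flying_laplace pmin alpha 0 in u0 H *.
have -> : v * (resv pmin alpha i j + u * (X / v)) = v * resv pmin alpha i j + X * u.
  by field; rewrite gt_eqF.
by rewrite -H; ring.
Qed.

Lemma boundary_resv_cvg alpha j : 0 < alpha ->
  resv p alpha i j @[i --> \oo] --> boundary_resv alpha j.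
Proof.
move=> al0.
rewrite (_ : (fun i => _) = fun i => resv pmin alpha i j + flying_laplace pmin alpha i * boundary_resv alpha j).
  rewrite -[X in _ --> X]add0r -[X in _ --> _ + X]mul1r; apply: cvgD; last first.
    by apply: cvgM; [exact: flying_laplace_cvg1|exact: cvg_cst].
  apply: (@squeeze_cvgr _ _ _ _ (fun=> 0) (fun i => laplace alpha (fun t => tm_mass pmin t i))).
  - near=> i; rewrite (resv_ge0 tmin smin)//=.
    apply: (ler_laplace al0 (tm_bounded tmin smin i j) (tm_mass_bounded tmin smin i)) => t.
    exact: tm_le_mass.
  - exact: cvg_cst.
  - exact: laplace_mass_cvg0.
by apply/funext => i; exact: resv_decomposition.
Unshelve. all: by end_near. Qed.

End MinimalResolvent.

(** * Countable state spaces *)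

Section CountableSpaces.

Lemma natcem_some_open (k : nat) : @open NatCem [set Some k].
Proof.
have := @one_point_compactification_open_some nat [set k] (discrete_open _).
by rewrite image_set1.
Qed.

Lemma rk_some_open (k : nat) : @open RKSpace [set Some (Some k)].
Proof.
have := @one_point_compactification_open_some _ _ (@natcem_some_open k).
by rewrite image_set1.
Qed.

(** The trap is isolated because the inner compactification is itself a closed compact set, whose
    complement leaves only the added point. *)
Lemma rk_none_open : @open RKSpace [set None].
Proof.
rewrite openE => _ ->; exists setT.
  by split; [exact: one_point_compactification_compact|exact: closedT].
by rewrite setCT image_set0 set0U.
Qed.

(** Both spaces are countable with discrete sigma-algebra, so measures and integrals on them become
    series along these enumerations. *)
Definition natcem_enum (n : nat) : NatCem := if n is m.+1 then Some m else None.
Definition rk_enum (n : nat) : RKSpace :=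
  if n is m.+1 then if m is l.+1 then Some (Some l) else Some None else None.

Lemma natcem_enum_inj : injective natcem_enum.
Proof. by case=> [|m] [|n] //= [->]. Qed.

Lemma rk_enum_inj : injective rk_enum.
Proof. by case=> [|[|m]] [|[|n]] //= [->]. Qed.

Lemma natcem_enum_surj x : exists n, natcem_enum n = x.
Proof. by case: x => [k|]; [exists k.+1|exists 0%N]. Qed.

Lemma rk_enum_surj x : exists n, rk_enum n = x.
Proof. by case: x => [[k|]|]; [exists k.+2|exists 1%N|exists 0%N]. Qed.

Lemma natcem_measurable (A : set NatCemB) : measurable A.
Proof.
have m1 k : measurable ([set Some k] : set NatCemB) by apply: sub_sigma_algebra; exact: natcem_some_open.
have m0 : measurable ([set None] : set NatCemB).
  rewrite (_ : [set None] = ~` \bigcup_k [set Some k]).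
    by apply: measurableC; apply: bigcupT_measurable.
  apply/seteqP; split=> [_ -> [k _]|[k|//]]; first by [].
  by move=> H; exfalso; apply: H; exists k.
rewrite (_ : A = \bigcup_n (A `&` [set natcem_enum n])).
  apply: bigcupT_measurable => n; have [An|An] := pselect (A (natcem_enum n)).
    rewrite setIidr; last by move=> _ ->.
    by case: n {An}.
  by rewrite (_ : _ `&` _ = set0)//; apply/seteqP; split=> // x [Ax xn]; apply: An; rewrite -xn.
apply/seteqP; split=> [x Ax|x [n _ []]//].
by have [n nx] := natcem_enum_surj x; exists n => //; split.
Qed.

Lemma rk_measurable (A : set RKSpaceB) : measurable A.
Proof.
have m1 k : measurable ([set Some (Some k)] : set RKSpaceB) by apply: sub_sigma_algebra; exact: rk_some_open.
have m0 : measurable ([set None] : set RKSpaceB) by apply: sub_sigma_algebra; exact: rk_none_open.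
have m2 : measurable ([set Some None] : set RKSpaceB).
  rewrite (_ : [set Some None] = ~` ([set None] `|` \bigcup_k [set Some (Some k)])).
    by apply: measurableC; apply: measurableU => //; apply: bigcupT_measurable.
  apply/seteqP; split=> [_ -> [//|[k _]]|[[k|//]|]]; first by [].
    by move=> H; exfalso; apply: H; right; exists k.
  by move=> H; exfalso; apply: H; left.
rewrite (_ : A = \bigcup_n (A `&` [set rk_enum n])).
  apply: bigcupT_measurable => n; have [An|An] := pselect (A (rk_enum n)).
    rewrite setIidr; last by move=> _ ->.
    case: n {An} => [|[|n]]; [exact: m0|exact: m2|exact: m1].
  by rewrite (_ : _ `&` _ = set0)//; apply/seteqP; split=> // x [Ax xn]; apply: An; rewrite -xn.
apply/seteqP; split=> [x Ax|x [n _ []]//].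
by have [n nx] := rk_enum_surj x; exists n => //; split.
Qed.

Context {R : realType}.

Lemma measurable_fun_discrete d d' (T : measurableType d) (T' : measurableType d') (D : set T)
  (f : T -> T') : (forall A : set T, measurable A) -> measurable_fun D f.
Proof. by move=> mA _ Y _; exact: mA. Qed.

Section Enumerated.
Context {d : measure_display} {T : measurableType d} (e : nat -> T).
Hypothesis mT : forall A : set T, measurable A.
Hypothesis e_inj : injective e.
Hypothesis e_surj : forall x, exists n, e n = x.

Let cover (A : set T) : A = \bigcup_n (A `&` [set e n]).
Proof.
apply/seteqP; split=> [x Ax|x [n _ []]//].
by have [n nx] := e_surj x; exists n => //; split.
Qed.

Let disj (A : set T) : trivIset setT (fun n => A `&` [set e n]).
Proof.
apply/trivIsetP => m n _ _ mn; apply/seteqP; split=> // x [[_ xm] [_ xn]].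
by move/eqP: mn; apply; apply: e_inj; rewrite -xm -xn.
Qed.

Lemma enum_measureE (mu : {measure set T -> \bar R}) (A : set T) :
  mu A = (\sum_(0 <= n <oo) mu (A `&` [set e n]))%E.
Proof.
by rewrite {1}(cover A) measure_semi_bigcup//; exact: disj.
Qed.

Lemma enum_integral (mu : {measure set T -> \bar R}) (f : T -> \bar R) :
  (forall x, (0 <= f x)%E) ->
  (\int[mu]_x f x = \sum_(0 <= n <oo) (f (e n) * mu [set e n]))%E.
Proof.
move=> f0; rewrite {1}(cover setT) ge0_integral_bigcup//.
  apply: eq_eseriesr => n _; rewrite setTI.
  rewrite (eq_integral (cst (f (e n)))); last by move=> x; rewrite inE => ->.
  by rewrite integral_cst.
Qed.

End Enumerated.

Lemma nneseries_recl (u : nat -> \bar R) : (forall n, (0 <= u n)%E) ->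
  (\sum_(0 <= n <oo) u n = u 0%N + \sum_(0 <= n <oo) u n.+1)%E.
Proof.
move=> u0; rewrite (nneseries_split 0 1)//= big_nat1; congr (_ + _)%E.
by rewrite -(@nneseries_addn _ u 1)//; apply: eq_eseriesr => n _; rewrite addn1.
Qed.

Lemma natcem_integral (mu : {measure set NatCemB -> \bar R}) (f : NatCem -> \bar R) :
  (forall x, (0 <= f x)%E) ->
  (\int[mu]_x f x = f None * mu [set None] + \sum_(0 <= k <oo) (f (Some k) * mu [set Some k]))%E.
Proof.
move=> f0; rewrite (enum_integral natcem_measurable natcem_enum_inj natcem_enum_surj)//.
by rewrite nneseries_recl// => n; rewrite mule_ge0.
Qed.

Lemma rk_integral (mu : {measure set RKSpaceB -> \bar R}) (f : RKSpace -> \bar R) :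
  (forall x, (0 <= f x)%E) ->
  (\int[mu]_x f x = f None * mu [set None] + (f rk_infty * mu [set rk_infty] +
    \sum_(0 <= k <oo) (f (Some (Some k)) * mu [set Some (Some k)])))%E.
Proof.
move=> f0; rewrite (enum_integral rk_measurable rk_enum_inj rk_enum_surj)//.
rewrite nneseries_recl => [|n]; last by rewrite mule_ge0.
by rewrite nneseries_recl// => n; rewrite mule_ge0.
Qed.

(** All points except oo are isolated, and being constant near oo settles continuity there.
    Indicators of a state or of the trap are of this kind and suffice as test functions. *)
Lemma rk_continuous (f : RKSpace -> R) (N : nat) :
  (forall k, (N <= k)%N -> f (Some (Some k)) = f rk_infty) -> continuous f.
Proof.
move=> fN [[k|]|].
- have H : nbhs (Some (Some k) : RKSpace) [set Some (Some k)].
    exact: (open_nbhs_nbhs (conj (@rk_some_open k) erefl)).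
  apply: cvg_near_cst; near=> y; suff -> : y = Some (Some k) by [].
  by near: y; exact: H.
- apply: cvg_near_cst.
  have : nbhs (None : NatCem) (fun x : NatCem => f (Some x) = f rk_infty).
    exists `I_N; first by split; [exact: finite_compact|exact: discrete_closed].
    move=> x [[k /negP]|->//]; rewrite -leqNgt => Nk <-.
    exact: fN.
  by [].
- have H : nbhs (None : RKSpace) [set None].
    exact: (open_nbhs_nbhs (conj rk_none_open erefl)).
  move=> B /nbhs_singleton fB.
  by apply: (@filterS RKSpace _ (nbhs_filter (None : RKSpace)) [set None] _ _ H) => y ->.
Unshelve. all: by end_near. Qed.

End CountableSpaces.

(** * The Ray resolvent at oo *)

Section RestartWeights.
Context {R : realType} (pi : probability NatCemB R).

Definition restart_weight (k : nat) : R := fine (pi [set Some k]).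

Lemma restart_weightE k : (restart_weight k)%:E = pi [set Some k].
Proof. by rewrite fineK// fin_num_measure//; exact: natcem_measurable. Qed.

Lemma restart_weight_ge0 k : 0 <= restart_weight k.
Proof. exact: fine_ge0. Qed.

Lemma restart_weight_total :
  (pi [set None] + \sum_(0 <= k <oo) (restart_weight k)%:E = 1)%E.
Proof.
have := natcem_integral pi (f := fun=> 1%E) (fun _ => lee01).
have -> : (\int[pi]_x 1 = 1)%E by rewrite integral_cst//= mul1e; exact: probability_setT.
rewrite mul1e => ->; congr (_ + _)%E.
by apply: eq_eseriesr => k _; rewrite mul1e restart_weightE.
Qed.

Lemma restart_weight_sum n : \sum_(0 <= k < n) restart_weight k <= 1.
Proof.
apply: nneseries_le; first exact: restart_weight_ge0.
by rewrite -[leRHS]restart_weight_total leeDr.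
Qed.

Lemma restart_trapE :
  pi [set None] = (1 - limn (series restart_weight))%:E.
Proof.
have := restart_weight_total; rewrite nneseries_EFin; last first.
  exact: (weight_cvg restart_weight_ge0 restart_weight_sum).
have : pi [set None] \is a fin_num by rewrite fin_num_measure//; exact: natcem_measurable.
by case: (pi [set None]) => // r _; rewrite -EFinD => -[<-]; rewrite addrK.
Qed.

End RestartWeights.

(** A neighbourhood of oo omits only a compact set of the discrete space N, which is finite. *)
Lemma rk_cvg_infty : ((fun i : nat => Some (Some i)) : nat -> RKSpace) @ \oo --> rk_infty.
Proof.
move=> B [C [cC _] CB].
move: cC; rewrite compact_cover => /(_ nat setT (fun k => [set k])) [].
- by move=> k _; exact: discrete_open.
- by move=> k Ck; exists k.
move=> D _ CD; exists (\max_(k <- finmap.enum_fset D) k).+1 => // i Di; apply: CB; left.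
exists i => // /CD [k /= kD ik]; move: Di; rewrite /= ik ltnNge.
by move/negP; apply; exact: (@leq_bigmax_seq _ _ predT id k kD isT).
Qed.

Section RayProcess.
Context {R : realType} (p : R -> nat -> nat -> R).
Hypothesis tp : transition_matrix p.
Hypothesis sp : standard_matrix p.
Variable Pbar : R -> R.-pker RKSpaceB ~> RKSpaceB.
Hypothesis Pbar_ray : ray_knight_semigroup p Pbar.

Lemma ray_kernel_fin t A : Pbar t rk_infty A \is a fin_num.
Proof.
rewrite ge0_fin_numE//; apply: (@le_lt_trans _ _ 1%E) (ltry _).
rewrite -(@prob_kernel _ _ _ _ _ (Pbar t) rk_infty); apply: le_measure; rewrite ?inE//; exact: rk_measurable.
Qed.

Lemma ray_integral_bounds (t : R) (f : RKSpace -> R) (C : R) : (forall x, 0 <= f x <= C) ->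
  0 <= \int[Pbar t rk_infty]_y f y <= C.
Proof.
move=> fC; have f0 x : (0 <= (f x)%:E)%E by rewrite lee_fin; have /andP[] := fC x.
rewrite /Rintegral fine_ge0 ?integral_ge0//=.
have H : (\int[Pbar t rk_infty]_y (f y)%:E <= C%:E)%E.
  apply: (@le_trans _ _ (\int[Pbar t rk_infty]_y (cst C%:E y))%E).
    apply: ge0_le_integral => //.
    - exact: measurable_fun_discrete rk_measurable.
    - by move=> x _; rewrite lee_fin; have /andP[] := fC x.
  by rewrite integral_cst// prob_kernel mule1.
rewrite -lee_fin fineK// ge0_fin_numE ?integral_ge0//; exact: le_lt_trans H (ltry _).
Qed.

(** The initial value theorem for the right continuous function t |-> [Pbar t] f at oo; it makes the
    law at time 0 accessible through resolvents. *)
Lemma ray_limit (f : RKSpace -> R) (C : R) : continuous f -> (forall x, 0 <= f x <= C) ->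
  alpha * ray_resolvent p alpha f rk_infty @[alpha --> +oo] --> \int[Pbar 0 rk_infty]_y f y.
Proof.
move=> cf fC; pose phi t := \int[Pbar t rk_infty]_y f y.
have cphi t : 0 <= t -> phi s @[s --> t^'+] --> phi t by exact: (rk_right_continuous Pbar_ray).
have B : bounded_on_half_line C phi.
  split; first exact: right_continuous_measurable1.
  by move=> t t0; rewrite ger0_norm; have /andP[] := ray_integral_bounds t fC.
apply: cvg_trans (laplace_abelian B (cphi 0 (lexx _))).
apply: near_eq_cvg; near=> alpha; congr (_ * _).
by apply: (rk_laplace Pbar_ray).
Unshelve. all: by end_near. Qed.

Definition rk_point (j : nat) (x : RKSpace) : R :=
  if x is Some (Some k) then (k == j)%:R else 0.

Definition rk_trap (x : RKSpace) : R := if x is None then 1 else 0.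

Lemma rk_point_continuous j : continuous (rk_point j).
Proof.
apply: (@rk_continuous _ _ j.+1) => k jk /=.
by rewrite (_ : (k == j) = false)//; apply/negbTE; rewrite neq_ltn jk orbT.
Qed.

Lemma rk_trap_continuous : continuous rk_trap.
Proof. exact: (@rk_continuous _ _ 0). Qed.

Lemma rk_point_bounds j x : 0 <= rk_point j x <= 1.
Proof. by case: x => [[k|]|] /=; rewrite ?lexx ?ler01//; case: (k == j); rewrite ?lexx ?ler01. Qed.

Lemma rk_trap_bounds x : 0 <= rk_trap x <= 1.
Proof. by case: x => [x|] /=; rewrite ?lexx ?ler01. Qed.

Lemma integral_rk_point t j :
  (\int[Pbar t rk_infty]_y rk_point j y)%:E = Pbar t rk_infty [set Some (Some j)].
Proof.
have -> : rk_point j = \1_[set Some (Some j)].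
  apply/funext => x; rewrite indicE; case: x => [[k|]|] /=.
  - by congr (nat_of_bool _)%:R; apply/eqP/idP => [->|]; rewrite inE//= => -[->].
  - by rewrite memNset.
  - by rewrite memNset.
by rewrite /Rintegral integral_indic ?setIT ?fineK ?ray_kernel_fin//; exact: rk_measurable.
Qed.

Lemma integral_rk_trap t :
  (\int[Pbar t rk_infty]_y rk_trap y)%:E = Pbar t rk_infty [set None].
Proof.
have -> : rk_trap = \1_[set None].
  apply/funext => x; rewrite indicE; case: x => [x|] /=; first by rewrite memNset.
  by rewrite mem_set.
by rewrite /Rintegral integral_indic ?setIT ?fineK ?ray_kernel_fin//; exact: rk_measurable.
Qed.

Lemma lim_series_delta (v : nat -> R) j : limn (series (fun k => v k * (k == j)%:R)) = v j.
Proof.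
apply: lim_near_cst => //; near=> n; have jn : (j < n)%N by near: n; exists j.+1.
rewrite /series/= big_mkord (bigD1 (Ordinal jn))//= eqxx mulr1 big1 ?addr0// => l.
by rewrite -val_eqE/= => /negPf ->; rewrite mulr0.
Unshelve. all: by end_near. Qed.

Lemma lim_series0 : limn (series (fun=> 0 : R)) = 0.
Proof.
rewrite (_ : series _ = cst 0) ?lim_cst//.
by apply/funext => n; rewrite /series/= big1.
Qed.

Lemma ray_resolvent_point alpha i j : ray_resolvent p alpha (rk_point j) (Some (Some i)) = resv p alpha i j.
Proof.
rewrite /= /resolvent_fun/= mulr0 addr0.
by under eq_fun do rewrite (resolvent_some tp); rewrite lim_series_delta.
Qed.

Lemma ray_resolvent_point_trap alpha j : 0 < alpha -> ray_resolvent p alpha (rk_point j) None = 0.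
Proof.
move=> al0; rewrite /= /resolvent_fun/= mulr0 addr0.
under eq_fun do rewrite (resolvent_none_some _ _ al0) mul0r.
exact: lim_series0.
Qed.

Lemma ray_resolvent_trap alpha i : 0 < alpha ->
  ray_resolvent p alpha rk_trap (Some (Some i)) =
  alpha^-1 - laplace alpha (fun t => tm_mass p t i).
Proof.
move=> al0; rewrite /= /resolvent_fun/= mulr1 (resolvent_some_none tp sp)//.
under eq_fun do rewrite mulr0.
by rewrite lim_series0 add0r.
Qed.

(* The bound is uniform in [i], hence passes to the limit at oo in [ray_property]. *)
Lemma resv_shift_uniform alpha i j h : 0 < alpha -> 0 <= h ->
  `|laplace alpha (fun t => p (t + h) i j) - resv p alpha i j| <= Num.min h alpha^-1.
Proof.
move=> al0 h0; have B := tm_bounded tp sp i j.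
have g0 t : 0 <= t -> 0 <= p t i j by exact: tm_ge0.
have Bh := bounded_shift h0 B.
have /andP[] := laplace_shift_bounds al0 h0 B g0; rewrite -/(resv p alpha i j).
have x0 : 0 <= laplace alpha (fun t => p (t + h) i j).
  by apply: (laplace_ge0 al0 Bh) => t t0; exact/g0/addr_ge0.
have x1 : laplace alpha (fun t => p (t + h) i j) <= alpha^-1.
  by rewrite -div1r; apply: (laplace_le_cst al0 Bh) => t t0; exact/tm_le1/addr_ge0.
have r0 := resv_ge0 tp sp i j al0; have r1 := resv_le tp sp i j al0.
move: x0 x1 r0 r1; set x := laplace alpha _; set r := resv p alpha i j => x0 x1 r0 r1.
have e0 := expR_gt0 (alpha * h).
have d1 : 0 <= 1 - expR (- (alpha * h)).
  by rewrite subr_ge0 -expR0 ler_expR oppr_le0 mulr_ge0// ltW.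
rewrite -{1}[x]mul1r -{1}(mulfV (lt0r_neq0 e0)) -expRN => H1 H2.
have {H1 H2}[H1 H2] : 0 <= r - expR (- (alpha * h)) * x /\ r - expR (- (alpha * h)) * x <= h.
  split; first by rewrite -(pmulr_rge0 _ e0) mulrBr mulrA.
  by rewrite -(ler_pM2l e0) mulrBr mulrA expRN mulfV ?lt0r_neq0// mul1r.
have H3 : (1 - expR (- (alpha * h))) * x <= h.
  by apply: le_trans (head_le al0 h0); rewrite ler_wpM2l.
have H4 : 0 <= (1 - expR (- (alpha * h))) * x by rewrite mulr_ge0.
rewrite le_min !ler_norml; apply/andP; split; apply/andP; split; lra.
Qed.

(** The identity Pbar_0 R_alpha = R_alpha at oo. With g the Ray resolvent of a point indicator, beta
    R_beta g at oo has two limits as beta grows: the integral of g by [ray_limit], and g at oo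
    because beta R_beta g - g is small uniformly in the starting state. *)
Lemma ray_property alpha j : 0 < alpha ->
  (resv p alpha ^~ j) @ \oo --> ray_resolvent p alpha (rk_point j) rk_infty ->
  \int[Pbar 0 rk_infty]_y ray_resolvent p alpha (rk_point j) y =
  ray_resolvent p alpha (rk_point j) rk_infty.
Proof.
move=> al0; set g := ray_resolvent p alpha (rk_point j); set F := g rk_infty => cF.
have cg : continuous g by apply: (rk_resolvent_continuous Pbar_ray) => //; exact: rk_point_continuous.
have gN k : g (Some (Some k)) = resv p alpha k j by exact: ray_resolvent_point.
have gT : g None = 0 by exact: ray_resolvent_point_trap.
have g0C x : 0 <= g x <= alpha^-1.
  case: x => [[k|]|]; first by rewrite gN (resv_ge0 tp sp)// (resv_le tp sp).
    rewrite -/rk_infty -/F -(cvg_lim _ cF)//; apply/andP; split.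
      apply: limr_ge; first by apply/cvg_ex; eexists; exact: cF.
      by near=> n; exact: resv_ge0.
    apply: limr_le; first by apply/cvg_ex; eexists; exact: cF.
    by near=> n; exact: resv_le.
  by rewrite gT lexx invr_ge0 ltW.
pose om h := Num.min h alpha^-1.
have iv0 : 0 < alpha^-1 by rewrite invr_gt0.
have Bom : bounded_on_half_line alpha^-1 om.
  split; first by apply: measurable_minr => //; exact: measurable_cst.
  by move=> h h0; rewrite ger0_norm ?le_min ?h0 ?(ltW iv0)// ge_min lexx orbT.
(* beta R_beta g at i is the exponential average, over the time shift h, of the shifted resolvents
   [G h], each within [om h] of g at i. *)
have bound beta i : 0 < beta ->
    `|beta * resolvent_fun p beta g (Some i) - resv p alpha i j| <= beta * laplace beta om.
  move=> be0.
  pose G h := laplace alpha (fun t => p (t + h) i j).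
  have v0 k : 0 <= resv p alpha k j by exact: resv_ge0.
  have vC k : resv p alpha k j <= alpha^-1 by exact: resv_le.
  have mpk k : measurable_fun (`[(0:R), +oo[%classic : set (measurableTypeR R))
      (fun h => p h i k * resv p alpha k j).
    by apply: measurable_funM; [exact: tm_measurable|exact: measurable_cst].
  have pk0 k h : 0 <= h -> 0 <= p h i k * resv p alpha k j.
    by move=> h0; rewrite mulr_ge0 ?(tm_ge0 tp).
  have pkM n h : 0 <= h -> \sum_(0 <= k < n) p h i k * resv p alpha k j <= alpha^-1.
    by move=> h0; exact: tm_avg_sum_le.
  have GE h : 0 <= h -> limn (series (fun k => p h i k * resv p alpha k j)) = G h.
    by move=> h0; apply: cvg_lim => //; exact: (@resv_shift _ _ tp sp alpha h i j al0 h0).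
  have BG : bounded_on_half_line alpha^-1 G.
    have [m1 m2] := bounded_series mpk pk0 pkM; split.
      apply: eq_measurable_fun m1 => h; rewrite inE/= in_itv/= andbT; exact: GE.
    by move=> h h0; rewrite -GE// m2.
  have -> : resolvent_fun p beta g (Some i) = laplace beta G.
    rewrite /resolvent_fun gT mulr0 addr0.
    under eq_fun do rewrite (resolvent_some tp) gN.
    rewrite -(eq_laplace beta GE); apply: cvg_lim => //.
    rewrite (_ : (fun k => _) = fun k => laplace beta (fun h => p h i k * resv p alpha k j)).
      exact: (laplace_series mpk pk0 pkM be0).
    apply/funext => k; under eq_laplace do rewrite mulrC.
    by rewrite (laplaceZ _ be0 (tm_bounded tp sp i k)) mulrC.
  have Bc := bounded_cst (resv p alpha i j).
  have -> : beta * laplace beta G - resv p alpha i j = beta * laplace beta (fun h => G h - resv p alpha i j).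
    by rewrite (laplaceB be0 BG Bc) laplace_cst// mulrBr mulrCA divff ?mulr1// gt_eqF.
  rewrite normrM gtr0_norm// ler_pM2l//.
  by apply: (laplace_norm be0 (boundedB BG Bc) Bom) => h h0; exact: resv_shift_uniform.
(* The bound does not depend on i, so it survives the limit at oo. *)
have boundoo beta : 0 < beta ->
    `|beta * ray_resolvent p beta g rk_infty - F| <= beta * laplace beta om.
  move=> be0.
  have cr : resolvent_fun p beta g (Some i) @[i --> \oo] --> ray_resolvent p beta g rk_infty.
    have := rk_resolvent_continuous Pbar_ray be0 cg.
    by move=> /(_ rk_infty) cc; exact: (@continuous_cvg _ _ _ _ _ _ _ _ cc rk_cvg_infty).
  have L : `|beta * resolvent_fun p beta g (Some i) - resv p alpha i j| @[i --> \oo] -->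
      `|beta * ray_resolvent p beta g rk_infty - F|.
    by apply: cvg_norm; apply: cvgB => //; apply: cvgM => //; exact: cvg_cst.
  rewrite -(cvg_lim _ L)//; apply: limr_le; first by apply/cvg_ex; eexists; exact: L.
  by near=> i; exact: bound.
have L1 := ray_limit cg g0C.
have L2 : beta * ray_resolvent p beta g rk_infty @[beta --> +oo] --> F.
  have L3 : beta * laplace beta om @[beta --> +oo] --> om 0.
    apply: (laplace_abelian Bom); rewrite {2}/om min_l ?(ltW iv0)//.
    have : h @[h --> (0:R)^'+] --> (0 : R) by apply: cvg_at_right_filter; exact: cvg_id.
    apply: cvg_trans; apply: near_eq_cvg; near=> h; rewrite /om min_l//.
    by near: h; exact: nbhs_right_le.
  rewrite /om min_l ?(ltW iv0)// in L3.
  apply/cvgrPdist_le => e e0; move/cvgrPdist_le : L3 => /(_ e e0) L3.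
  near=> beta; rewrite distrC; apply: (le_trans (boundoo beta _)) => //.
  apply: le_trans (ler_norm _) _; rewrite -normrN -sub0r.
  by near: beta.
exact: (cvg_unique _ L1 L2).
Unshelve. all: by end_near. Qed.

End RayProcess.

(** * The Doob formula and the law of the Ray process started at oo *)

Section DoobRay.
Context {R : realType} (a b : nat -> R).
Hypothesis a0 : a 0%N = 0.
Hypothesis a_gt0 : forall k, (0 < k)%N -> 0 < a k.
Hypothesis b_gt0 : forall k, 0 < b k.
Hypothesis sfin : (bd_sigma a b < +oo)%E.
Variable pmin : R -> nat -> nat -> R.
Hypothesis pmin_min : minimal_Q_process a b pmin.
Let Qmin := pmin_min.1.
Let tmin := Qp_transition Qmin.
Let smin := Qp_standard Qmin.
Variable p : R -> nat -> nat -> R.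
Hypothesis Qp : Q_process a b p.
Let tp := Qp_transition Qp.
Let sp := Qp_standard Qp.
Variable pi : probability NatCemB R.

Local Notation w := (restart_weight pi).
Local Notation u := (flying_laplace pmin).
Local Notation Phi := (resv pmin).
Let w0 := restart_weight_ge0 pi.
Let w1 := restart_weight_sum pi.

Definition restart_resv alpha j : R := limn (series (fun k => w k * Phi alpha k j)).
Definition restart_flying alpha : R := limn (series (fun k => w k * u alpha k)).

Let u01 alpha : 0 < alpha -> forall k, 0 <= u alpha k <= 1.
Proof. by move=> al0 k; rewrite (flying_laplace_ge0 Qmin)//= (flying_laplace_le1 Qmin). Qed.

Let Phi01 alpha j : 0 < alpha -> forall k, 0 <= Phi alpha k j <= alpha^-1.
Proof. by move=> al0 k; rewrite (resv_ge0 tmin smin)//= (resv_le tmin smin). Qed.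

Lemma restart_flying_lt1 alpha : 0 < alpha -> restart_flying alpha < 1.
Proof.
move=> al0; apply: (weighted_lt1 w0 w1) => k.
by rewrite (flying_laplace_ge0 Qmin)//= (flying_laplace_lt1 pmin_min).
Qed.

Lemma restart_flying_neq alpha : 0 < alpha -> 1 - restart_flying alpha != 0.
Proof. by move=> al0; rewrite gt_eqF// subr_gt0 restart_flying_lt1. Qed.

Lemma doob_processP : doob_process pmin pi p <-> forall alpha i j, 0 < alpha ->
  resv p alpha i j = Phi alpha i j +
    u alpha i * (restart_resv alpha j / (1 - restart_flying alpha)).
Proof.
rewrite /doob_process /=; split=> H alpha i j al0; move: (H alpha i j al0);
  by rewrite (resolvent_some tp).
Qed.

Lemma doob_boundaryP : doob_process pmin pi p <-> forall alpha j, 0 < alpha ->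
  boundary_resv pmin p alpha j = restart_resv alpha j / (1 - restart_flying alpha).
Proof.
rewrite doob_processP; split=> H => [alpha j al0|alpha i j al0].
  have ug0 := flying_laplace0_gt0 a0 a_gt0 b_gt0 sfin pmin_min al0.
  rewrite /boundary_resv H// [Phi _ _ _ + _]addrC addrK [u _ _ * _]mulrC.
  by rewrite mulfK// gt_eqF.
by rewrite (resv_decomposition a0 a_gt0 b_gt0 sfin pmin_min Qp)// H.
Qed.

(** Averaging the decomposition gives pi R = pi Phi + (pi u) F. Thus F = pi R is a scalar linear
    equation for F whose solution is the Doob quotient, pi u being less than 1. *)
Lemma doob_fixpointP alpha j : 0 < alpha ->
  (boundary_resv pmin p alpha j = restart_resv alpha j / (1 - restart_flying alpha)) <->
  boundary_resv pmin p alpha j = limn (series (fun k => w k * resv p alpha k j)).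
Proof.
move=> al0.
have -> : limn (series (fun k => w k * resv p alpha k j)) =
    restart_resv alpha j + boundary_resv pmin p alpha j * restart_flying alpha.
  rewrite -(weighted_lin w0 w1 _ (Phi01 j al0) (u01 al0)); congr (limn (series _)).
  apply/funext => k; congr (_ * _).
  by rewrite (resv_decomposition a0 a_gt0 b_gt0 sfin pmin_min Qp)// [u _ _ * _]mulrC.
have n0 := restart_flying_neq al0.
split=> [->|H]; first by field.
apply: (mulIf n0); rewrite divfK// mulrBr mulr1 {1}H; ring.
Qed.

Let cvg_abel0 k j : alpha * Phi alpha k j @[alpha --> +oo] --> ((k == j)%:R : R).
Proof.
rewrite -(std_at0 smin); apply: (laplace_abelian (tm_bounded tmin smin k j)).
by apply: (tm_right_continuous tmin smin).
Qed.

Let cvg_flying k : u alpha k @[alpha --> +oo] --> (0 : R).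
Proof.
have -> : 0 = 1 - tm_mass pmin 0 k.
  apply/esym/eqP; rewrite subr_eq0 eq_sym eq_le (tm_mass_le1 tmin)//=.
  by apply: le_trans (tm_le_mass tmin k k (lexx 0)); rewrite (std_at0 smin) eqxx.
have : 1 - alpha * laplace alpha (fun t => tm_mass pmin t k) @[alpha --> +oo] --> 1 - tm_mass pmin 0 k.
  apply: cvgB; first exact: cvg_cst.
  apply: (laplace_abelian (tm_mass_bounded tmin smin k)); exact: tm_mass_right0.
apply: cvg_trans; apply: near_eq_cvg; near=> alpha.
by rewrite (flying_laplaceE Qmin).
Unshelve. all: by end_near. Qed.

Lemma restart_flying_cvg : restart_flying alpha @[alpha --> +oo] --> (0 : R).
Proof.
rewrite /restart_flying (_ : 0 = limn (series (fun k => w k * 0))).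
  apply: (weighted_dominated w0 w1 (C := 1)) => //.
  - by near=> alpha; exact: u01.
  - by move=> k; rewrite lexx ler01.
by under eq_fun do rewrite mulr0; rewrite lim_series0.
Unshelve. all: by end_near. Qed.

Lemma restart_resv_cvg j : alpha * restart_resv alpha j @[alpha --> +oo] --> w j.
Proof.
have : limn (series (fun k => w k * (alpha * Phi alpha k j))) @[alpha --> +oo] -->
    limn (series (fun k => w k * (k == j)%:R)).
  apply: (weighted_dominated w0 w1 (x := fun alpha k => alpha * Phi alpha k j) (C := 1)).
  - near=> alpha => k; have al0 : 0 < alpha by [].
    have /andP[H1 H2] := Phi01 j al0 k.
    by rewrite mulr_ge0 ?(ltW al0)//= mulrC -ler_pdivlMr// div1r.
  - by move=> k; case: (k == j); rewrite ?lexx ler01.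
  - by move=> k; exact: cvg_abel0.
rewrite lim_series_delta; apply: cvg_trans; apply: near_eq_cvg; near=> alpha.
have al0 : 0 < alpha by [].
rewrite /restart_resv.
have -> : alpha * limn (series (fun k => w k * Phi alpha k j)) =
  limn (fun n => alpha * series (fun k => w k * Phi alpha k j) n).
  apply/esym/cvg_lim => //; apply: cvgM; first exact: cvg_cst.
  exact: (weighted_cvg w0 w1 (Phi01 j al0)).
congr (limn _); apply/funext => n; rewrite /series/= mulr_sumr.
by apply: eq_bigr => k _; rewrite mulrCA.
Unshelve. all: by end_near. Qed.

Variable Pbar : R -> R.-pker RKSpaceB ~> RKSpaceB.
Hypothesis Pbar_ray : ray_knight_semigroup p Pbar.

Let boundary_cvg alpha j : 0 < alpha ->
  resv p alpha i j @[i --> \oo] --> boundary_resv pmin p alpha j.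
Proof. exact: (@boundary_resv_cvg _ _ _ a0 a_gt0 b_gt0 sfin _ pmin_min _ Qp). Qed.

Let ray_point_infty alpha j : 0 < alpha ->
  ray_resolvent p alpha (rk_point j) rk_infty = boundary_resv pmin p alpha j.
Proof.
move=> al0; apply: cvg_lim => //.
rewrite (_ : (fun i => _) = resv p alpha ^~ j); first exact: boundary_cvg.
by apply/funext => i; exact: (ray_resolvent_point tp).
Qed.

Let ray_point_limit j : alpha * boundary_resv pmin p alpha j @[alpha --> +oo] -->
  \int[Pbar 0 rk_infty]_y rk_point j y.
Proof.
have := ray_limit Pbar_ray (@rk_point_continuous _ j) (rk_point_bounds j).
apply: cvg_trans; apply: near_eq_cvg; near=> alpha.
by rewrite ray_point_infty.
Unshelve. all: by end_near. Qed.

Local Notation ray_law := (forall A : set RKSpaceB, measurable A ->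
  Pbar 0 rk_infty A = pi (rk_incl @^-1` A)).

(** Both total masses are 1, so no mass is left at oo; the remaining points exhaust a countable
    space. *)
Lemma ray_law_points : Pbar 0 rk_infty [set None] = pi [set None] ->
  (forall k, Pbar 0 rk_infty [set Some (Some k)] = pi [set Some k]) -> ray_law.
Proof.
move=> HN HS.
have inclS k : rk_incl @^-1` [set Some (Some k)] = [set Some k].
  by apply/seteqP; split=> -[l|]//= [->].
have inclN : rk_incl @^-1` [set None] = [set None].
  by apply/seteqP; split=> -[l|].
have inclI : rk_incl @^-1` [set rk_infty] = set0.
  by apply/seteqP; split=> -[l|].
have HI : Pbar 0 rk_infty [set rk_infty] = 0%E.
  have := @rk_integral R (Pbar 0 rk_infty) (fun=> 1%E) (fun _ => lee01).
  have -> : (\int[Pbar 0 rk_infty]_x 1 = 1)%E.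
    by rewrite integral_cst//= mul1e; exact: (@prob_kernel _ _ _ _ _ (Pbar 0) rk_infty).
  rewrite !mul1e HN.
  under eq_eseriesr do rewrite mul1e HS -restart_weightE.
  rewrite addeCA restart_weight_total.
  have := ray_kernel_fin Pbar 0 [set rk_infty].
  case: (Pbar 0 rk_infty [set rk_infty]) => // r _ [].
  by move=> E; congr EFin; lra.
move=> A _.
rewrite (enum_measureE rk_measurable rk_enum_inj rk_enum_surj (Pbar 0 rk_infty)).
pose nu := pushforward pi (rk_incl : NatCemB -> RKSpaceB).
have mincl : measurable_fun setT (rk_incl : NatCemB -> RKSpaceB).
  exact: measurable_fun_discrete natcem_measurable.
transitivity (nu A) => //.
rewrite /nu (enum_measureE rk_measurable rk_enum_inj rk_enum_surj (pushforward pi (rk_incl : NatCemB -> RKSpaceB))).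
apply: eq_eseriesr => n _.
have E : Pbar 0 rk_infty [set rk_enum n] = nu [set rk_enum n].
  rewrite /nu /pushforward; case: n => [|[|n]] /=.
  - by rewrite inclN.
  - by rewrite -/rk_infty inclI measure0.
  - by rewrite inclS.
have [An|An] := pselect (A (rk_enum n)).
  by rewrite setIidr; [exact: E|move=> _ ->].
by rewrite (_ : _ `&` _ = set0) ?measure0//; apply/seteqP; split=> // x [Ax xn]; apply: An; rewrite -xn.
Qed.

(** Knowing the masses of the states alone would not tell how the rest is shared between oo and the
    trap, so the mass at the trap is computed too, by summing the resolvents over the target
    state. *)
Lemma doob_ray_law : doob_process pmin pi p -> ray_law.
Proof.
move=> /doob_boundaryP H.
have c1 : (1 - restart_flying alpha)^-1 @[alpha --> +oo] --> (1 : R).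
  rewrite -[X in _ --> X]invr1; apply: cvgV; first exact: oner_neq0.
  rewrite -[X in _ --> X]subr0; apply: cvgB; first exact: cvg_cst.
  exact: restart_flying_cvg.
apply: ray_law_points => [|j].
- rewrite -(integral_rk_trap Pbar) restart_trapE; congr EFin.
  have := ray_limit Pbar_ray (@rk_trap_continuous _) (@rk_trap_bounds _) => /cvg_unique; apply => //.
  set W := limn (series w).
  (* This expression is alpha times the Ray resolvent of the trap indicator at oo; its limit 1 - W
     is the mass of pi at the trap. *)
  have : 1 - (W - restart_flying alpha) * (1 - restart_flying alpha)^-1 @[alpha --> +oo] -->
      1 - (W - 0) * 1.
    apply: cvgB; first exact: cvg_cst; apply: cvgM => //.
    by apply: cvgB; [exact: cvg_cst|exact: restart_flying_cvg].
  rewrite subr0 mulr1; apply: cvg_trans; apply: near_eq_cvg; near=> alpha.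
  have al0 : 0 < alpha by [].
  pose L i := laplace alpha (fun t => tm_mass pmin t i).
  have Lu k : alpha * L k = 1 - u alpha k by rewrite (flying_laplaceE Qmin)// subKr.
  have L01 k : 0 <= L k <= alpha^-1.
    have B := tm_mass_bounded tmin smin k.
    rewrite -div1r (laplace_le_cst al0 B) ?andbT; last by move=> t; exact: tm_mass_le1.
    by apply: (laplace_ge0 al0 B) => t; exact: tm_mass_ge0.
  pose wL := limn (series (fun k => w k * L k)).
  (* The average over pi of alpha L = 1 - u. *)
  have wLE : alpha * wL = W - restart_flying alpha.
    have := weighted_lin w0 w1 (- alpha) (fun k => andb_true_intro (conj ler01 (lexx 1))) L01.
    rewrite -/wL; under eq_fun do rewrite mulNr Lu opprB addrCA subrr addr0.
    rewrite -/(restart_flying alpha) => ->.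
    by under [in RHS]eq_fun do rewrite mulr1; rewrite -/W; ring.
  have sF : series (boundary_resv pmin p alpha) @ \oo --> wL / (1 - restart_flying alpha).
    have ex := weighted_exchange w0 w1 (x := Phi alpha) (C := alpha^-1).
    have {}ex : series (restart_resv alpha) @ \oo --> wL.
      rewrite /wL (_ : (fun k => w k * L k) = fun k => w k * limn (series (Phi alpha k))).
        apply: ex => [k j|k n]; first by have /andP[] := Phi01 j al0 k.
        apply: (@le_trans _ _ (L k)); last by have /andP[] := L01 k.
        rewrite /L -(cvg_lim _ (@resv_series _ _ tmin smin alpha k al0))//.
        apply: lim_series_ge; first by move=> j; have /andP[] := Phi01 j al0 k.
        by apply/cvg_ex; eexists; exact: resv_series.
      by apply/funext => k; rewrite (cvg_lim _ (@resv_series _ _ tmin smin alpha k al0)).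
    rewrite (_ : series _ = fun n => series (restart_resv alpha) n * (1 - restart_flying alpha)^-1).
      by apply: cvgM => //; exact: cvg_cst.
    by apply/funext => n; rewrite /series/= mulr_suml; apply: eq_bigr => j _; rewrite H.
  have Lp i : laplace alpha (fun t => tm_mass p t i) =
      L i + u alpha i * (wL / (1 - restart_flying alpha)).
    rewrite -(cvg_lim _ (@resv_series _ _ tp sp alpha i al0))//; apply: cvg_lim => //.
    rewrite (_ : series _ = fun n => series (Phi alpha i) n + u alpha i * series (boundary_resv pmin p alpha) n).
      apply: cvgD; first exact: resv_series.
      by apply: cvgM => //; exact: cvg_cst.
    apply/funext => n; rewrite /series/= mulr_sumr -big_split/=; apply: eq_bigr => j _.
    exact: (resv_decomposition a0 a_gt0 b_gt0 sfin pmin_min Qp).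
  have -> : ray_resolvent p alpha rk_trap rk_infty = alpha^-1 - (0 + 1 * (wL / (1 - restart_flying alpha))).
    apply: cvg_lim => //.
    rewrite (_ : (fun i => _) = fun i => alpha^-1 - (L i + u alpha i * (wL / (1 - restart_flying alpha)))).
      apply: cvgB; first exact: cvg_cst; apply: cvgD.
        exact: (@laplace_mass_cvg0 _ _ _ a0 a_gt0 b_gt0 sfin _ pmin_min).
      apply: cvgM; last exact: cvg_cst.
      exact: (@flying_laplace_cvg1 _ _ _ a0 a_gt0 b_gt0 sfin _ pmin_min).
    by apply/funext => i; rewrite -Lp; exact: (ray_resolvent_trap tp sp).
  rewrite add0r mul1r mulrBr divff ?gt_eqF// mulrA wLE.
  by [].
- rewrite -(integral_rk_point Pbar) -restart_weightE; congr EFin.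
  have /cvg_unique := @ray_point_limit j; apply => //.
  have : alpha * restart_resv alpha j * (1 - restart_flying alpha)^-1 @[alpha --> +oo] --> w j * 1.
    by apply: cvgM => //; exact: restart_resv_cvg.
  rewrite mulr1; apply: cvg_trans; apply: near_eq_cvg; near=> alpha.
  by rewrite -mulrA H.
Unshelve. all: by end_near. Qed.

(** The prescribed law does not charge oo, so the integral in [ray_property] runs over N and the
    trap, where the resolvent vanishes: it reads F = pi R. *)
Lemma ray_law_doob : ray_law -> doob_process pmin pi p.
Proof.
move=> law; apply/doob_boundaryP => alpha j al0; apply/doob_fixpointP => //.
have HN : Pbar 0 rk_infty [set rk_infty] = 0%E.
  rewrite law; last exact: rk_measurable.
  by rewrite (_ : _ @^-1` _ = set0) ?measure0//; apply/seteqP; split=> -[l|].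
have HS k : Pbar 0 rk_infty [set Some (Some k)] = (w k)%:E.
  rewrite law; last exact: rk_measurable.
  by rewrite restart_weightE; congr (pi _); apply/seteqP; split=> -[l|]//= [->].
have cF := @boundary_cvg alpha j al0; rewrite -(ray_point_infty j al0) in cF.
have := ray_property tp sp Pbar_ray al0 cF; rewrite ray_point_infty// => <-.
set g := ray_resolvent p alpha (rk_point j).
have gS k : g (Some (Some k)) = resv p alpha k j by exact: (ray_resolvent_point tp).
have gN : g None = 0 by exact: ray_resolvent_point_trap.
have gI : 0 <= g rk_infty.
  rewrite /g -(cvg_lim _ cF)//; apply: limr_ge; first by apply/cvg_ex; eexists; exact: cF.
  by near=> n; exact: (resv_ge0 tp sp).
have g0 x : (0 <= (g x)%:E)%E.
  rewrite lee_fin; case: x => [[k|]|] //; first by rewrite gS (resv_ge0 tp sp).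
  by rewrite gN.
rewrite /Rintegral (rk_integral (Pbar 0 rk_infty) g0) gN HN mul0e mule0 !add0e.
under eq_eseriesr do rewrite HS gS -EFinM mulrC.
rewrite nneseries_EFin//=; apply: (weighted_cvg w0 w1 (C := alpha^-1)) => k.
by rewrite (resv_ge0 tp sp)// (resv_le tp sp).
Unshelve. all: by end_near. Qed.

(** At a non-branching point each integral against [Pbar 0] is the value at oo, which is 0 for the
    indicators of states and of the trap. As oo has no mass either, the total mass would be 0. *)
Lemma ray_law_branching : ray_law -> branching_point p rk_infty.
Proof.
move=> law nb.
have HN : Pbar 0 rk_infty [set rk_infty] = 0%E.
  rewrite law; last exact: rk_measurable.
  by rewrite (_ : _ @^-1` _ = set0) ?measure0//; apply/seteqP; split=> -[l|].
have P0 (f : RKSpace -> R) (C : R) : continuous f -> (forall x, 0 <= f x <= C) -> \int[Pbar 0 rk_infty]_y f y = f rk_infty.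
  move=> cf fC; have /cvg_unique := ray_limit Pbar_ray cf fC; apply => //.
  exact: nb.
have HS k : Pbar 0 rk_infty [set Some (Some k)] = 0%E.
  by rewrite -(integral_rk_point Pbar) (P0 _ _ (@rk_point_continuous _ k) (rk_point_bounds k)).
have HT : Pbar 0 rk_infty [set None] = 0%E.
  by rewrite -(integral_rk_trap Pbar) (P0 _ _ (@rk_trap_continuous _) (@rk_trap_bounds _)).
have := @rk_integral R (Pbar 0 rk_infty) (fun=> 1%E) (fun _ => lee01).
have -> : (\int[Pbar 0 rk_infty]_x 1 = 1)%E.
  by rewrite integral_cst//= mul1e; exact: (@prob_kernel _ _ _ _ _ (Pbar 0) rk_infty).
rewrite HN HT !mule0 !add0e.
under eq_eseriesr do rewrite HS mule0.
by rewrite eseries0// => -[]/eqP; rewrite oner_eq0.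
Qed.

End DoobRay.

(** * The lifetime *)

Section Lifetime.
Context {R : realType} {d : measure_display} {Omega : measurableType d}.
Variable Y : process_data R Omega.
Hypothesis sY : rc_strong_markov Y.
Local Notation zeta := (lifetime Y).

Lemma lifetime_ge0 v : (0 <= zeta v)%E.
Proof. by apply: le_ereal_inf_tmp => _ [t [t0 _] <-]; rewrite lee_fin. Qed.

Lemma lifetime_age_ge0 v t : (zeta v <= t%:E)%E -> 0 <= t - fine (zeta v).
Proof.
move=> vt; rewrite subr_ge0 -lee_fin fineK// ge0_fin_numE ?lifetime_ge0//.
exact: le_lt_trans vt (ltry _).
Qed.

(** States of N are isolated, so right continuity applies. The trap is a limit point of [NatCem],
    but it is absorbing. *)
Lemma state_eventually_cst v t : 0 <= t ->
  \forall s \near t^'+, pd_state Y s v = pd_state Y t v.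
Proof.
move=> t0; case E : (pd_state Y t v) => [k|]; last first.
  near=> s; apply: (sm_trap sY t0 _ E).
  by apply: ltW; near: s; exact: nbhs_right_gt.
have := sm_right_continuous sY (w := v) t0; rewrite E => /(_ [set Some k]); apply.
by apply: open_nbhs_nbhs; split => //; exact: natcem_some_open.
Unshelve. all: by end_near. Qed.

(** The infimum defining the lifetime is attained: a path alive at t stays in its state for a
    positive time. *)
Lemma lifetime_leP v t : 0 <= t -> (zeta v <= t%:E)%E <-> pd_state Y t v = None.
Proof.
move=> t0; split=> [zt|tN]; last by apply: ereal_inf_lbound; exists t.
apply: contrapT => tn.
have [e /= e0 He] := state_eventually_cst v t0.
have : ((t + e)%:E <= zeta v)%E.
  apply: le_ereal_inf_tmp => _ [s [s0 sN] <-]; rewrite lee_fin leNgt; apply/negP => se.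
  apply: tn; have [st|ts] := leP s t; first exact: (sm_trap sY s0 st sN).
  rewrite -(He s) //= /ball_/= ltr_distlC; apply/andP; split => //.
  by apply: lt_trans ts; rewrite ltrBlDr ltrDl.
move=> /le_trans /(_ zt); rewrite lee_fin => ?; lra.
Unshelve. all: by end_near. Qed.

Lemma measurable_state t x : 0 <= t -> measurable [set v | pd_state Y t v = x].
Proof. by move=> t0; apply: (sm_sub sY t0); exact: sm_adapted. Qed.

Lemma measurable_lifetime : measurable_fun setT zeta.
Proof.
have H t : measurable [set v | (zeta v <= t%:E)%E].
  have [t0|t0] := leP 0 t.
    rewrite (_ : [set _ | _] = [set v | pd_state Y t v = None]); first exact: measurable_state.
    by apply/seteqP; split => v /= /(lifetime_leP v t0).
  rewrite (_ : [set _ | _] = set0) //; apply/seteqP; split => v //=.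
  by move=> /(le_trans (lifetime_ge0 v)); rewrite lee_fin leNgt t0.
apply: (measurability _ (ErealGenOInfty.measurableE R)) => _ [_ [t ->] <-].
rewrite setTI (_ : _ @^-1` _ = ~` [set v | (zeta v <= t%:E)%E]).
  exact: measurableC.
by apply/seteqP; split => v /=; rewrite in_itv/= andbT ltNge => /negP.
Qed.

Lemma measurable_lifetime_eq r : measurable [set v | zeta v = r].
Proof.
rewrite -[X in measurable X]setTI.
exact: (measurable_lifetime measurableT (emeasurable_set1 r)).
Qed.

Lemma measurable_lifetime_fin : measurable [set v | (zeta v < +oo)%E].
Proof.
rewrite -[X in measurable X]setTI.
exact: (emeasurable_fun_infty_o measurableT measurable_lifetime).
Qed.

Lemma measurable_state_joint x :
  measurable [set z : R * Omega | 0 <= z.1 /\ pd_state Y z.1 z.2 = x].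
Proof.
pose f (t : R) (v : Omega) : R := \1_[set v | pd_state Y t v = x] v.
have : measurable_fun (`[(0:R), +oo[%classic `*` setT) (fun z : R * Omega => f z.1 z.2).
  apply: right_continuous_measurable => [t t0|v t t0].
    exact: measurable_indic (measurable_state x t0).
  apply: cvg_trans (@cvg_cst _ (f t v) _ (t^'+) _).
  apply: near_eq_cvg; near=> s.
  have E : pd_state Y s v = pd_state Y t v.
    by near: s; exact: state_eventually_cst.
  rewrite /f !indicE; congr ((nat_of_bool _)%:R).
  by apply/idP/idP; rewrite !inE/= E.
have mD : measurable (`[(0:R), +oo[%classic `*` [set: Omega]).
  by apply: measurableX => //; exact: measurable_itv.
move=> /(_ mD [set 1] (measurable_set1 1)).
congr measurable; apply/seteqP; split => [[t v] [[/=]]|[t v] /= [t0 E]].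
  rewrite in_itv/= andbT => t0 _; rewrite /f/= indicE => b; split => //.
  by case: (boolP (v \in [set v | pd_state Y t v = x])) b => [/set_mem//|_ /= /eqP]; rewrite eq_sym oner_eq0.
split; first by split=> //=; rewrite in_itv/= andbT.
by rewrite /f/= indicE mem_set.
Unshelve. all: by end_near. Qed.

Lemma dead_pathP v : dead_path Y v <-> pd_state Y 0 v = None.
Proof.
split=> [|E t t0]; first exact.
exact: (sm_trap sY (lexx 0) t0 E).
Qed.

Variable p : R -> nat -> nat -> R.
Hypothesis tp : transition_matrix p.
Hypothesis sp : standard_matrix p.
Hypothesis Yp : has_transition_matrix Y p.

Lemma lifetime_gt_prob t i : 0 <= t ->
  pd_law Y (Some i) [set v | (t%:E < zeta v)%E] = (tm_mass p t i)%:E.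
Proof.
move=> t0; rewrite -(tm_massE tp)//.
rewrite (_ : [set _ | _] = \bigcup_j [set v | pd_state Y t v = Some j]).
  rewrite measure_semi_bigcup//; first by apply: eq_eseriesr => j _; exact: Yp.
  - by move=> j; exact: measurable_state.
  - by apply/trivIsetP => j k _ _ jk; apply/seteqP; split=> // v [/= ->] [] /eqP; apply/negP.
  - by apply: bigcupT_measurable => j; exact: measurable_state.
apply/seteqP; split => v /=.
  rewrite ltNge => /negP H; case E : (pd_state Y t v) => [j|]; first by exists j.
  by case: H; apply/lifetime_leP.
by move=> [j _ /= E]; rewrite ltNge; apply/negP => /(lifetime_leP v t0); rewrite E.
Qed.

Lemma lifetime_gt0_prob i : pd_law Y (Some i) [set v | (0 < zeta v)%E] = 1%E.
Proof.
rewrite lifetime_gt_prob//; congr EFin; apply/eqP; rewrite eq_le (tm_mass_le1 tp)//=.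
by apply: le_trans (tm_le_mass tp i i (lexx 0)); rewrite (std_at0 sp) eqxx.
Qed.

Lemma measurable_lifetime_lt (t : R) : measurable [set v | (t%:E < zeta v)%E].
Proof.
rewrite -[X in measurable X]setTI.
exact: (emeasurable_fun_o_infty measurableT measurable_lifetime).
Qed.

Lemma measurable_lifetime_le (t : R) : measurable [set v | (zeta v <= t%:E)%E].
Proof.
rewrite -[X in measurable X]setTI.
exact: (emeasurable_fun_infty_c measurableT measurable_lifetime).
Qed.

(** With S the survival probability, S(t) is at least p_ii(h) S(t - h), so an atom at t has mass at
    most 1 - p_ii(h), which tends to 0; at t = 0 the lifetime is almost surely positive. The
    instants where one piece gives way to the next are thus negligible. *)
Lemma lifetime_eq_prob t i : 0 <= t ->
  pd_law Y (Some i) [set v | zeta v = t%:E] = 0%E.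
Proof.
move=> t0; have mE := measurable_lifetime_eq t%:E.
case: (eqVneq t 0) mE t0 => [->|tn] mE t0.
  apply/eqP; rewrite eq_le measure_ge0 andbT.
  apply: (@le_trans _ _ (pd_law Y (Some i) (~` [set v | (0 < zeta v)%E]))).
    apply: le_measure; rewrite ?inE//.
      by apply: measurableC; exact: (measurable_lifetime_lt 0).
    by move=> v /= ->; rewrite ltxx.
  rewrite probability_setC; last exact: (measurable_lifetime_lt 0).
  by rewrite lifetime_gt0_prob subee.
have {tn}t0 : 0 < t by rewrite lt_neqAle eq_sym tn.
set P := pd_law _ _ _.
have Pfin : P \is a fin_num by exact: fin_num_measure.
have Ple h : 0 < h <= t -> fine P <= 1 - p h i i.
  move=> /andP[h0 ht]; rewrite -lee_fin fineK//.
  apply: (@le_trans _ _ (pd_law Y (Some i) ([set v | ((t - h)%:E < zeta v)%E] `\` [set v | (t%:E < zeta v)%E]))).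
    apply: le_measure; rewrite ?inE//.
      by apply: measurableD; exact: measurable_lifetime_lt.
    by move=> v /= ->; rewrite lte_fin ltxx; split => //; rewrite ltrBlDr ltrDl.
  rewrite measureD; [|exact: measurable_lifetime_lt..|]; last first.
    by rewrite ltey_eq fin_num_measure//; exact: measurable_lifetime_lt.
  rewrite setIidr; last first.
    by move=> v /=; apply: le_lt_trans; rewrite lee_fin; lra.
  have th : 0 <= t - h by rewrite subr_ge0.
  rewrite [X in (X - _)%E](lifetime_gt_prob i th) [X in (_ - X)%E](lifetime_gt_prob i (ltW t0)).
  rewrite -EFinB lee_fin.
  have := tm_mass_diag tp i (ltW h0) th; rewrite [h + _]addrC subrK.
  have := tm_mass_le1 tp i th; have := tm_le1 tp i i (ltW h0); have := tm_ge0 tp i i (ltW h0).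
  nra.
have P0 : fine P <= 0.
  have c : 1 - p h i i @[h --> 0^'+] --> (0 : R).
    rewrite -[X in _ --> X](subrr 1); apply: cvgB; first exact: cvg_cst.
    by have := @std_lim _ _ sp i i; rewrite eqxx.
  rewrite -(cvg_lim _ c)//; apply: limr_ge; first by apply/cvg_ex; eexists; exact: c.
  near=> h; apply: Ple; apply/andP; split => //.
  by near: h; exact: nbhs_right_le.
by apply/eqP; rewrite eq_le measure_ge0 andbT -(fineK Pfin) lee_fin.
Unshelve. all: by end_near. Qed.

End Lifetime.

(** * Independence of the first piece and the following ones *)

Section CylinderMeasures.
Context {R : realType} {d : measure_display} {Omega : measurableType d}.
Local Notation W := (Omega * NatCemB)%type.
Local Notation Seq := (g_sigma_algebraType (@cylinders d Omega)).

Definition path_shift (w : Seq) : Seq := fun n => w n.+1.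

Lemma measurable_piece n : measurable_fun setT (fun w : Seq => w n : W).
Proof.
move=> _ A mA; rewrite setTI; apply: sub_sigma_algebra.
by exists n; exists A.
Qed.

Lemma measurable_path_shift : measurable_fun setT path_shift.
Proof.
apply: (@measurability _ _ Seq Seq setT path_shift (@cylinders d Omega)) => //.
move=> _ [_ [n [A mA ->]] <-]; rewrite setTI.
by apply: sub_sigma_algebra; exists n.+1; exists A.
Qed.

Lemma measurable_first_path (D : set Omega) : measurable D ->
  measurable [set x : Seq | D (x 0%N).1].
Proof.
move=> mD; have mf : measurable_fun setT (fun x : Seq => (x 0%N).1).
  exact: measurableT_comp measurable_fst (measurable_piece 0).
by rewrite -[X in measurable X]setTI; exact: mf.
Qed.

Lemma measurable_first_shift :
  measurable_fun setT (fun x : Seq => ((x 0%N).1, path_shift x)).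
Proof.
apply/measurable_fun_pairP; split => /=; last exact: measurable_path_shift.
exact: measurableT_comp measurable_fst (measurable_piece 0).
Qed.

Definition rectangle (n : nat) (A : nat -> set W) : set Seq :=
  [set w | forall k, (k < n)%N -> A k (w k)].

Definition rectangles : set (set Seq) :=
  [set B | exists n A, (forall k, measurable (A k)) /\ B = rectangle n A].

Lemma measurable_rectangle n (A : nat -> set W) : (forall k, measurable (A k)) ->
  measurable (rectangle n A).
Proof.
move=> mA; rewrite (_ : rectangle n A = \bigcap_(k in `I_n) [set w | A k (w k)]).
  apply: bigcap_measurableType => k _; rewrite -[X in measurable X]setTI.
  exact: measurable_piece.
by apply/seteqP; split => w /= H k; exact: H.
Qed.

Lemma rectangles_generate : @measurable _ Seq = <<s rectangles >>.
Proof.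
apply/seteqP; split.
  apply: smallest_sub; first exact: smallest_sigma_algebra.
  move=> _ [n [A mA ->]]; apply: sub_sigma_algebra.
  exists n.+1, (fun k => if k == n then A else setT); split.
    by move=> k; case: ifP.
  apply/seteqP; split => w /= H; last by have := H n (ltnSn n); rewrite eqxx.
  by move=> k _; case: ifP => // /eqP ->.
apply: smallest_sub; first exact: sigma_algebra_measurable.
by move=> _ [n [A [mA ->]]]; exact: measurable_rectangle.
Qed.

Lemma rectangles_setI : setI_closed rectangles.
Proof.
move=> _ _ [n [A [mA ->]]] [m [B [mB ->]]].
exists (maxn n m), (fun k => (if (k < n)%N then A k else setT) `&` (if (k < m)%N then B k else setT)).
split; first by move=> k; apply: measurableI; case: ifP.
apply/seteqP; split => w /=.
  by move=> [HA HB] k _; split; case: ifP => // kn; [exact: HA|exact: HB].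
move=> H; split=> k kn.
  by have := H k; rewrite leq_max kn /= => /(_ isT) [].
by have := H k; rewrite leq_max kn orbT /= => /(_ isT) [].
Qed.

Lemma cylinder_measure_unique (m1 m2 : {measure set Seq -> \bar R}) :
  (m1 setT < +oo)%E ->
  (forall n A, (forall k, measurable (A k)) -> m1 (rectangle n A) = m2 (rectangle n A)) ->
  forall B, measurable B -> m1 B = m2 B.
Proof.
move=> fin1 H B mB.
apply: (measure_unique rectangles (fun=> setT)) => //.
- exact: rectangles_generate.
- exact: rectangles_setI.
- move=> _; exists 0%N, (fun=> setT); split=> //.
  by apply/seteqP; split.
- by rewrite bigcup_const.
- by move=> _ [n [A [mA ->]]]; exact: H.
Qed.

End CylinderMeasures.

(** Packs the image measure with its measure structure while exposing only its values. *)
Lemma pushforward_measure d d' (T1 : measurableType d) (T2 : measurableType d')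
    (R : realType) (m : {measure set T1 -> \bar R}) (f : T1 -> T2) :
  measurable_fun setT f ->
  exists m' : {measure set T2 -> \bar R}, forall A, m' A = m (f @^-1` A).
Proof. by move=> mf; unshelve eexists (pushforward m f); first exact: mf. Qed.

Section RestartLaw.
Context {R : realType} {d : measure_display} {Omega : measurableType d}.
Local Notation W := (Omega * NatCemB)%type.
Local Notation Seq := (g_sigma_algebraType (@cylinders d Omega)).
Variable Y : process_data R Omega.
Hypothesis sY : rc_strong_markov Y.
Variable pi : probability NatCemB R.
Variable Pt : NatCem -> probability Seq R.
Hypothesis Pt_law : piecing_out_law Y pi Pt.

Lemma piecing_rectangle x n (A : nat -> set W) : (forall k, measurable (A k)) ->
  Pt x (rectangle n A) = rectangle_prob Y pi (mkseq A n) x.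
Proof.
move=> mA; rewrite -Pt_law; last first.
  by move=> k; rewrite size_mkseq => kn; rewrite nth_mkseq.
congr (Pt x _); apply/seteqP; split => w /=; rewrite size_mkseq => H k kn.
  by rewrite nth_mkseq//; exact: H.
by have := H k kn; rewrite nth_mkseq.
Qed.

Lemma first_path_law x (A : set Omega) : measurable A ->
  Pt x [set w | A (w 0%N).1] = pd_law Y x A.
Proof.
move=> mA; have mB : measurable [set v : W | A v.1].
  by rewrite -[X in measurable X]setTI; exact: measurable_fst.
have := @Pt_law x [:: [set v : W | A v.1]].
rewrite (_ : [set w | _] = [set w | A (w 0%N).1]); last first.
  apply/seteqP; split => w /= H; first exact: (H 0%N).
  by case.
move=> ->; last by case.
rewrite /= -(setIT A) -integral_indic//; apply: eq_integral => v _.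
under eq_integral do rewrite mule1.
rewrite (eq_integral (fun=> (\1_A v)%:E)); last first.
  move=> y _; congr (EFin (nat_of_bool _)%:R).
  by rewrite setIT; apply/idP/idP => /set_mem H; exact/mem_set.
by rewrite integral_cst//= [X in (_ * X)%E]probability_setT mule1.
Qed.

Lemma measurable_dead : measurable [set v | dead_path Y v].
Proof.
rewrite (_ : [set v | _] = [set v | pd_state Y 0 v = None]).
  exact: measurable_state.
by apply/seteqP; split => v /= /(dead_pathP sY).
Qed.

Variable i : nat.

Lemma dead_prob : pd_law Y (Some i) [set v | dead_path Y v] = 0%E.
Proof.
apply/eqP; rewrite eq_le measure_ge0 andbT.
have m0 : measurable [set v | pd_state Y 0 v = Some i] by exact: measurable_state.
rewrite -[X in (_ <= X)%E](subee (x := 1%E))// -[X in (_ - X)%E](sm_start sY (Some i)).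
rewrite -probability_setC//; apply: le_measure; rewrite ?inE.
- exact: measurable_dead.
- exact: measurableC.
by move=> v /= /(dead_pathP sY) ->.
Qed.

Lemma rectangle_prob_ge0 (As : seq (set W)) x : (0 <= rectangle_prob Y pi As x)%E.
Proof.
elim: As x => [|B As IH] x //=.
apply: integral_ge0 => v _; apply: integral_ge0 => y _.
by rewrite mule_ge0// lee_fin.
Qed.

(** Fixing the restart position makes the inner integrals constant. Starting from a state of N the
    path is almost surely not dead, so [restart_law] may be replaced by pi. *)
Lemma first_rectangle (A : set Omega) (y : NatCemB) (As : seq (set W)) : measurable A ->
  rectangle_prob Y pi ((A `*` [set y]) :: As) (Some i) =
  (pi [set y] * pd_law Y (Some i) A * rectangle_prob Y pi As y)%E.
Proof.
move=> mA; rewrite /=; set c := rectangle_prob Y pi As y.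
have c0 : (0 <= c)%E := rectangle_prob_ge0 As y.
have inner (nu : probability NatCemB R) v :
    (\int[nu]_y' ((\1_(A `*` [set y]) (v, y'))%:E * rectangle_prob Y pi As y') =
     (\1_A v)%:E * (c * nu [set y]))%E.
  rewrite (eq_integral (fun y' => ((\1_A v)%:E * c) * (\1_[set y] y')%:E)%E); last first.
    move=> y' _; rewrite !indicE.
    have [->|yy] := eqVneq y' y.
      have -> : ((v, y) \in A `*` [set y]) = (v \in A).
        by apply/idP/idP => /set_mem H; apply/mem_set => //; case: H.
      by rewrite [y \in _]mem_set// mule1.
    have yn : y' <> y by exact/eqP.
    rewrite [(v, y') \in _]memNset; last by case.
  by rewrite [y' \in _]memNset// mule0 mul0e.
  rewrite ge0_integralZl//.
  - by rewrite integral_indic ?setIT ?muleA//; exact: natcem_measurable.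
  - exact: measurable_fun_discrete natcem_measurable.
  - by rewrite mule_ge0// lee_fin.
under eq_integral do rewrite inner.
have md := measurable_dead.
rewrite (ge0_negligible_integral (N := [set v | dead_path Y v]))//; first last.
- exact: dead_prob.
- by move=> v _; rewrite !mule_ge0// lee_fin.
- apply: emeasurable_funM; first exact/measurable_EFinP/measurable_indic.
  apply: emeasurable_funM => //.
  rewrite (_ : (fun v => _) = fun v => if `[< dead_path Y v >] then
    (dirac (None : NatCemB) [set y] : \bar R) else pi [set y]); last first.
    by apply/funext => v; rewrite /restart_law; case: ifP.
  apply: measurable_fun_ifT => //.
  apply: (measurable_fun_bool true); rewrite setTI (_ : _ @^-1` _ = [set v | dead_path Y v])//.
  by apply/seteqP; split => v /= /asboolP.
rewrite setTD.
rewrite (eq_integral (fun v => (pi [set y] * c) * (\1_A v)%:E)%E); last first.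
  move=> v /set_mem/= vn; rewrite /restart_law; case: ifP => [/asboolP//|_].
  by rewrite muleC [(c * _)%E]muleC.
rewrite ge0_integralZl//; first last.
- by rewrite mule_ge0.
- by apply/measurable_EFinP; exact: measurable_indic.
- exact: measurableC.
rewrite integral_indic//; last exact: measurableC.
rewrite [X in (pi [set y] * c * X)%E](_ : _ = pd_law Y (Some i) A); last first.
  rewrite -setDE measureD//; last by rewrite ltey_eq fin_num_measure.
  rewrite [X in (_ - X)%E](_ : _ = 0%E) ?sube0//; apply/eqP; rewrite eq_le measure_ge0 andbT.
  rewrite -dead_prob; apply: le_measure; rewrite ?inE//; first exact: measurableI.
by rewrite -!muleA; congr (_ * _)%E; rewrite muleC.
Qed.

(** As functions of C both sides are finite measures; they agree on rectangles, because a rectangle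
    preceded by A times {y} is again a rectangle. *)
Let shift_law (A : set Omega) (y : NatCemB) (C : set Seq) : measurable A -> measurable C ->
  Pt (Some i) [set w | (w 0%N).2 = y /\ (A (w 0%N).1 /\ C (path_shift w))] =
  (pi [set y] * pd_law Y (Some i) A * Pt y C)%E.
Proof.
move=> mA mC.
have mAy : measurable (A `*` [set y] : set W).
  by apply: measurableX => //; exact: natcem_measurable.
have mE : measurable [set w : Seq | (A `*` [set y]) (w 0%N)].
  rewrite -[X in measurable X]setTI; exact: measurable_piece.
have fr : (pi [set y] * pd_law Y (Some i) A)%E \is a fin_num.
  by rewrite fin_numM// fin_num_measure//; exact: natcem_measurable.
have r0 : 0 <= fine (pi [set y] * pd_law Y (Some i) A) by rewrite fine_ge0// mule_ge0.
have [m1 m1E] := pushforward_measure (mrestr (Pt (Some i)) mE) (@measurable_path_shift _ Omega).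
pose m2 := mscale (NngNum r0) (Pt y).
have m2E X : m2 X = (pi [set y] * pd_law Y (Some i) A * Pt y X)%E by rewrite /m2 /mscale/= fineK.
have /(_ C mC) : forall B, measurable B -> m1 B = m2 B.
  apply: cylinder_measure_unique => [|n B mB].
    apply: le_lt_trans (ltry 1); rewrite m1E.
    exact: (probability_le1 _ (measurableI _ _ measurableT mE)).
  rewrite -[RHS]/(m2 _) m1E m2E /mrestr.
  rewrite piecing_rectangle// -first_rectangle//.
  pose B' k := if k is l.+1 then B l else A `*` [set y].
  transitivity (Pt (Some i) (rectangle n.+1 B')); last first.
    rewrite piecing_rectangle; last by case.
    have -> // : mkseq B' n.+1 = (A `*` [set y]) :: mkseq B n.
    rewrite /mkseq/=; congr (_ :: _).
    by rewrite (iotaDl 1 0) -map_comp; exact: eq_map.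
  congr (Pt _ _); apply/seteqP; split => w /=.
    by move=> [H H0] [|k] kn; [exact: H0|exact: H].
  by move=> H; split => [k kn|]; [exact: (H k.+1)|exact: (H 0%N)].
rewrite m1E m2E /mrestr => <-.
congr (Pt _ _); apply/seteqP; split => w /=; tauto.
Qed.

(** Passes from product events to arbitrary joint events of the first path and the later pieces. The
    renewal argument needs this, since it observes the shifted sequence at a time depending on the
    first lifetime. *)
Lemma restart_law_product (y : NatCemB) (B : set (Omega * Seq)) : measurable B ->
  Pt (Some i) [set w | (w 0%N).2 = y /\ B ((w 0%N).1, path_shift w)] =
  (pi [set y] * (pd_law Y (Some i) \x Pt y) B)%E.
Proof.
move=> mB.
have mE : measurable [set w : Seq | [set v : W | v.2 = y] (w 0%N)].
  rewrite -[X in measurable X]setTI; apply: measurable_piece => //.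
  rewrite -[X in measurable X]setTI; apply: (@measurable_snd _ _ _ _ _ [set y]) => //.
  exact: natcem_measurable.
have fr : pi [set y] \is a fin_num by rewrite fin_num_measure//; exact: natcem_measurable.
have r0 : 0 <= fine (pi [set y]) by rewrite fine_ge0.
have mpsi := @measurable_first_shift _ Omega.
have [m1 m1E] := pushforward_measure (mrestr (Pt (Some i)) mE) mpsi.
pose m2 := mscale (NngNum r0) (pd_law Y (Some i) \x Pt y)%E.
have m2E X : m2 X = (pi [set y] * (pd_law Y (Some i) \x Pt y) X)%E by rewrite /m2 /mscale/= fineK.
suff : m1 B = m2 B.
  rewrite m1E m2E /mrestr => <-.
  congr (Pt _ _); apply/seteqP; split => w /=; tauto.
apply: (measure_unique [set A `*` C | A in measurable & C in measurable] (fun=> setT)) => //.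
- exact: measurable_prod_measurableType.
- move=> _ _ [A mA [C mC <-]] [A' mA' [C' mC' <-]].
  by rewrite -setXI; exists (A `&` A'); [exact: measurableI|exists (C `&` C') => //; exact: measurableI].
- by move=> _; exists setT => //; exists setT => //; rewrite setXTT.
- by rewrite bigcup_const.
- move=> _ [A mA [C mC <-]].
  rewrite -[RHS]/(m2 _) m1E m2E /mrestr product_measure1E// muleA -shift_law//.
  congr (Pt _ _); apply/seteqP; split => w /=; tauto.
- move=> _; apply: le_lt_trans (ltry 1); rewrite m1E.
  exact: (probability_le1 _ (measurableI _ _ measurableT mE)).
Qed.

End RestartLaw.

(** * Paths of the pieced-out process *)

Section PiecedPaths.
Context {R : realType} {d : measure_display} {Omega : measurableType d}.
Local Notation W := (Omega * NatCemB)%type.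
Local Notation Seq := (g_sigma_algebraType (@cylinders d Omega)).
Variable Y : process_data R Omega.
Implicit Types (w : Seq) (t : R) (n : nat).
Local Notation zeta := (lifetime Y).
Local Notation rev := (revival_time Y).

Let z0 w n : (0 <= zeta (w n).1)%E.
Proof. exact: lifetime_ge0. Qed.

Lemma revival_timeS w n : rev w n.+1 = (rev w n + zeta (w n).1)%E.
Proof. by rewrite /revival_time big_nat_recr. Qed.

Lemma revival_time_shift w n : rev w n.+1 = (zeta (w 0%N).1 + rev (path_shift w) n)%E.
Proof. by rewrite /revival_time big_nat_recl. Qed.

Lemma revival_time0 w : rev w 0 = 0%E.
Proof. by rewrite /revival_time big_geq. Qed.

Lemma revival_time_ge0 w n : (0 <= rev w n)%E.
Proof. exact: sume_ge0. Qed.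

Lemma revival_time_le w m n : (m <= n)%N -> (rev w m <= rev w n)%E.
Proof.
move=> /subnK <-; elim: (n - m)%N => [|k IH]; first by rewrite add0n.
by rewrite addSn revival_timeS (le_trans IH)// leeDl.
Qed.

Definition piece_at t w n : Prop :=
  (n = 0%N \/ (rev w n < t%:E)%E) /\ (t%:E <= rev w n.+1)%E.

Lemma piece_indexE t w n : piece_at t w n -> piece_index Y t w = n.
Proof.
move=> Hn; apply: xget_unique => // m Hm.
have lt k l : piece_at t w k -> piece_at t w l -> (k < l)%N -> False.
  move=> [_ tk] [[->//|lt] _] kl.
  by have := lt_le_trans lt (le_trans tk (revival_time_le w kl)); rewrite ltxx.
by case: (ltngtP m n) => // /lt H; case: H.
Qed.

Lemma le_first_zero w n : (n%:R%:E <= first_zero_lifetime Y w)%E <->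
  forall k, (k < n)%N -> zeta (w k).1 <> 0%E.
Proof.
split=> [H k kn zk|H].
  have : (n%:R%:E <= k%:R%:E :> \bar R)%E.
    by apply: le_trans H _; apply: ereal_inf_lbound; exists k.
  by rewrite lee_fin ler_nat leqNgt kn.
apply: le_ereal_inf_tmp => _ [k zk <-]; rewrite lee_fin ler_nat leqNgt.
by apply/negP => /H; apply.
Qed.

(** The condition on the index of summation in [final_time] is moved into the term, so that the
    series can be split and shifted. *)
Definition live_lifetime w n : \bar R :=
  if (n%:R%:E <= first_zero_lifetime Y w)%E then zeta (w n).1 else 0%E.

Lemma live_lifetime_ge0 w n : (0 <= live_lifetime w n)%E.
Proof. by rewrite /live_lifetime; case: ifP. Qed.

Lemma final_timeE w : final_time Y w = (\sum_(0 <= n <oo) live_lifetime w n)%E.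
Proof. exact: eseries_mkcond. Qed.

Lemma final_time_ge0 w : (0 <= final_time Y w)%E.
Proof. by rewrite final_timeE; apply: nneseries_ge0 => *; exact: live_lifetime_ge0. Qed.

Lemma final_time_shift w : zeta (w 0%N).1 <> 0%E ->
  final_time Y w = (zeta (w 0%N).1 + final_time Y (path_shift w))%E.
Proof.
move=> zn; rewrite !final_timeE nneseries_recl; last exact: live_lifetime_ge0.
congr (_ + _)%E.
  by rewrite /live_lifetime; case: ifPn => // /negP[]; apply/le_first_zero.
apply: eq_eseriesr => n _; rewrite /live_lifetime.
suff -> : (n.+1%:R%:E <= first_zero_lifetime Y w)%E = (n%:R%:E <= first_zero_lifetime Y (path_shift w))%E by [].
apply/idP/idP => /le_first_zero H; apply/le_first_zero.
  by move=> k kn; exact: (H k.+1).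
by move=> [|k] kn //; exact: (H k).
Qed.

Lemma final_time_zero w : zeta (w 0%N).1 = 0%E -> final_time Y w = 0%E.
Proof.
move=> zn; rewrite final_timeE eseries0// => -[|n] _ _.
  by rewrite /live_lifetime zn; case: ifP.
by rewrite /live_lifetime; case: ifPn => // /le_first_zero /(_ 0%N isT) [].
Qed.

Lemma piece_index_ex t w : (t%:E < final_time Y w)%E -> exists n, piece_at t w n.
Proof.
move=> tf; have [n Hn] : exists n, (t%:E <= rev w n.+1)%E.
  apply: contrapT => /forallNP H.
  move: tf; rewrite ltNge => /negP; apply; rewrite final_timeE.
  apply: lime_le; first by apply: is_cvg_nneseries => *; exact: live_lifetime_ge0.
  near=> n; apply: (@le_trans _ _ (rev w n)).
    apply: lee_sum => k _; rewrite /live_lifetime; case: ifP => // _; exact: z0.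
  apply: (@le_trans _ _ (rev w n.+1)); first exact: revival_time_le.
  by apply: ltW; rewrite ltNge; apply/negP.
have ex : exists n, (t%:E <= rev w n.+1)%E by exists n.
exists (ex_minn ex); case: ex_minnP => -[|m] tm min; split => //; [by left|right].
by rewrite ltNge; apply/negP => /min; rewrite ltnn.
Unshelve. all: by end_near. Qed.

Lemma pieced_zero t w : 0 <= t -> zeta (w 0%N).1 = 0%E -> pieced_state Y t w = None.
Proof. by move=> t0 zw; rewrite /pieced_state final_time_zero// lee_fin t0. Qed.

Lemma pieced_first t w : 0 <= t -> (t%:E < zeta (w 0%N).1)%E ->
  pieced_state Y t w = pd_state Y t (w 0%N).1.
Proof.
move=> tt tz; have zn : zeta (w 0%N).1 <> 0%E.
  by move=> E; move: tz; rewrite E lte_fin ltNge tt.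
rewrite /pieced_state ifN; last first.
  rewrite -ltNge; apply: lt_le_trans tz _.
  by rewrite final_time_shift// leeDl// final_time_ge0.
rewrite (@piece_indexE t w 0); last first.
  by split; [left|rewrite revival_timeS revival_time0 add0e ltW].
by rewrite revival_time0 subr0 /revived_state tz.
Qed.

(** Both inequalities are strict. A first lifetime 0 ends the whole path, and at t equal to the
    first lifetime the first piece is still current, so the state is the restart position rather
    than the start of the next path. *)
Lemma pieced_later t w : (0 < zeta (w 0%N).1)%E -> (zeta (w 0%N).1 < t%:E)%E ->
  pieced_state Y t w = pieced_state Y (t - fine (zeta (w 0%N).1)) (path_shift w).
Proof.
move=> zp zt; have zn : zeta (w 0%N).1 <> 0%E by move=> E; move: zp; rewrite E ltxx.
have zf : zeta (w 0%N).1 \is a fin_num by rewrite ge0_fin_numE// (lt_trans zt)// ltry.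
set s := t - _.
have tE : t%:E = (zeta (w 0%N).1 + s%:E)%E by rewrite /s -(fineK zf) -EFinD addrC subrK.
rewrite /pieced_state final_time_shift// tE leeD2lE//.
case: ifPn => //; rewrite -ltNge => /piece_index_ex [n Hn].
(* For n = 0 it is the strict inequality that places t after the first revival. *)
have Hn' : piece_at t w n.+1.
  case: Hn => Hn1 Hn2; split; last by rewrite tE revival_time_shift leeD2lE.
  right; rewrite tE revival_time_shift; case: Hn1 => [->|lt]; last by rewrite lteD2lE.
  by rewrite revival_time0 adde0 -tE.
rewrite (piece_indexE Hn) (piece_indexE Hn').
have rf : rev (path_shift w) n \is a fin_num.
  rewrite ge0_fin_numE ?revival_time_ge0//.
  case: Hn.1 => [->|lt]; first by rewrite revival_time0 ltry.
  by rewrite (lt_trans lt)// ltry.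
congr (revived_state _ _ _); rewrite revival_time_shift fineD// /s; ring.
Qed.

End PiecedPaths.

Section PiecedMeasurability.
Context {R : realType} {d : measure_display} {Omega : measurableType d}.
Local Notation W := (Omega * NatCemB)%type.
Local Notation Seq := (g_sigma_algebraType (@cylinders d Omega)).
Variable Y : process_data R Omega.
Hypothesis sY : rc_strong_markov Y.
Local Notation zeta := (lifetime Y).
Local Notation rev := (revival_time Y).

Lemma measurable_piece_lifetime n : measurable_fun setT (fun w : Seq => zeta (w n).1).
Proof.
apply: measurableT_comp (measurable_lifetime sY) _.
exact: measurableT_comp measurable_fst (measurable_piece n).
Qed.

Lemma measurable_revival_time n : measurable_fun setT (fun w : Seq => rev w n).
Proof. by apply: emeasurable_sum => k; exact: measurable_piece_lifetime. Qed.

Lemma measurable_final_time : measurable_fun setT (fun w : Seq => final_time Y w).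
Proof.
rewrite (_ : (fun w => _) = fun w => (\sum_(0 <= n <oo) live_lifetime Y w n)%E); last first.
  by apply/funext => w; exact: final_timeE.
apply: ge0_emeasurable_sum => [n w _ _|n _]; first exact: live_lifetime_ge0.
apply: measurable_fun_ifT; [|exact: measurable_piece_lifetime|exact: measurable_cst].
apply: (measurable_fun_bool true); rewrite setTI.
rewrite (_ : _ @^-1` _ = \bigcap_(k in `I_n) ~` [set w | zeta (w k).1 = 0%E]).
  apply: bigcap_measurableType => k _; apply: measurableC.
  by rewrite -[X in measurable X]setTI; exact: (measurable_piece_lifetime k measurableT (emeasurable_set1 0%E)).
by apply/seteqP; split => w /= /le_first_zero.
Qed.

Lemma measurable_revived j : measurable
  [set z : R * W | 0 <= z.1 /\ revived_state Y z.1 z.2 = Some j].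
Proof.
have mz : measurable_fun setT (fun z : R * W => zeta z.2.1).
  apply: measurableT_comp (measurable_lifetime sY) _.
  exact: measurableT_comp measurable_fst measurable_snd.
have mt : measurable_fun setT (fun z : R * W => z.1%:E).
  by apply/measurable_EFinP; exact: measurable_fst.
have mlt : measurable [set z : R * W | (z.1%:E < zeta z.2.1)%E].
  by rewrite -[X in measurable X]setTI; exact: emeasurable_fun_lt.
have mp : measurable_fun setT (fun z : R * W => (z.1, z.2.1)).
  apply/measurable_fun_pairP; split => /=; first exact: measurable_fst.
  exact: measurableT_comp measurable_fst measurable_snd.
have m1 : measurable [set z : R * W | 0 <= z.1 /\ pd_state Y z.1 z.2.1 = Some j].
  rewrite -[X in measurable X]setTI.
  exact: (mp measurableT _ (measurable_state_joint sY (Some j))).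
have m2 : measurable [set z : R * W | 0 <= z.1 /\ z.2.2 = Some j].
  rewrite (_ : [set _ | _] = `[(0:R), +oo[%classic `*` (setT `*` [set Some j])).
    apply: measurableX; first exact: measurable_itv.
    by apply: measurableX => //; exact: natcem_measurable.
  by apply/seteqP; split => -[t [v y]] /=; rewrite in_itv/= andbT; tauto.
rewrite (_ : [set _ | _] = ([set z : R * W | (z.1%:E < zeta z.2.1)%E] `&`
    [set z : R * W | 0 <= z.1 /\ pd_state Y z.1 z.2.1 = Some j]) `|`
  (~` [set z : R * W | (z.1%:E < zeta z.2.1)%E] `&` [set z : R * W | 0 <= z.1 /\ z.2.2 = Some j])).
  by apply: measurableU; apply: measurableI => //; exact: measurableC.
apply/seteqP; split => -[t [v y]] /=; rewrite /revived_state/=.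
  by move=> [t0]; case: ifP => H E; [left|right].
by move=> [[H [t0 E]]|[/negP/negbTE H [t0 E]]]; rewrite H.
Qed.

(** Joint measurability in time and sequence, obtained by splitting over the piece current at the
    given time; it allows evaluation at a random remaining time. *)
Lemma measurable_pieced j : measurable
  [set z : R * Seq | 0 <= z.1 /\ pieced_state Y z.1 z.2 = Some j].
Proof.
have mt : measurable_fun setT (fun z : R * Seq => z.1%:E).
  by apply/measurable_EFinP; exact: measurable_fst.
have mr n : measurable_fun setT (fun z : R * Seq => rev z.2 n).
  exact: measurableT_comp (measurable_revival_time n) measurable_snd.
have mf : measurable_fun setT (fun z : R * Seq => final_time Y z.2).
  exact: measurableT_comp measurable_final_time measurable_snd.
have mphi n : measurable_fun setT (fun z : R * Seq => (z.1 - fine (rev z.2 n), z.2 n : W)).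
  apply/measurable_fun_pairP; split => /=.
    apply: measurable_funB; first exact: measurable_fst.
    exact: measurableT_comp (mr n).
  exact: measurableT_comp (measurable_piece n) measurable_snd.
have lt (f g : R * Seq -> \bar R) : measurable_fun setT f -> measurable_fun setT g ->
    measurable [set z | (f z < g z)%E].
  by move=> ? ?; rewrite -[X in measurable X]setTI; exact: emeasurable_fun_lt.
have le (f g : R * Seq -> \bar R) : measurable_fun setT f -> measurable_fun setT g ->
    measurable [set z | (f z <= g z)%E].
  by move=> ? ?; rewrite -[X in measurable X]setTI; exact: emeasurable_fun_le.
have mat n : measurable [set z : R * Seq | piece_at Y z.1 z.2 n].
  rewrite (_ : [set _ | _] = ([set _ | n = 0%N] `|` [set z : R * Seq | (rev z.2 n < z.1%:E)%E]) `&`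
    [set z : R * Seq | (z.1%:E <= rev z.2 n.+1)%E]) //.
  apply: measurableI; last exact: le.
  apply: measurableU; last exact: lt.
  by have [->|n0] := eqVneq n 0%N;
    [rewrite (_ : [set _ | _] = setT) //; apply/seteqP; split|
     rewrite (_ : [set _ | _] = set0) //; apply/seteqP; split => // z /= /eqP; rewrite (negbTE n0)].
rewrite (_ : [set _ | _] = \bigcup_n ((([set z : R * Seq | 0 <= z.1] `&`
    [set z : R * Seq | (z.1%:E < final_time Y z.2)%E]) `&`
    [set z : R * Seq | piece_at Y z.1 z.2 n]) `&`
    [set z : R * Seq | 0 <= z.1 - fine (rev z.2 n) /\
       revived_state Y (z.1 - fine (rev z.2 n)) (z.2 n) = Some j])).
  apply: bigcupT_measurable => n; apply: measurableI; last first.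
    rewrite -[X in measurable X]setTI.
    exact: (mphi n measurableT _ (measurable_revived j)).
  apply: measurableI => //; apply: measurableI; last exact: lt.
  rewrite (_ : [set _ | _] = `[(0:R), +oo[%classic `*` setT).
    by apply: measurableX => //; exact: measurable_itv.
  by apply/seteqP; split => -[t w] /=; rewrite in_itv/= andbT; tauto.
apply/seteqP; split => [[t w] [/= t0]|[t w] [n _ [[[/= t0 tf] tn] [_ E]]]]; last first.
  split => //; rewrite /pieced_state ifN -?ltNge//.
  by rewrite (piece_indexE tn).
rewrite /pieced_state; case: ifPn => //; rewrite -ltNge => tf.
have [n tn] := piece_index_ex tf; rewrite (piece_indexE tn) => E.
exists n => //; split => //; split => //=.
case: tn.1 => [->|lt']; first by rewrite revival_time0 subr0.
rewrite subr_ge0 -lee_fin fineK ?(ltW lt')//.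
by rewrite ge0_fin_numE ?revival_time_ge0// (lt_trans lt')// ltry.
Qed.

End PiecedMeasurability.

(** * The renewal equation of the pieced-out process *)

Section PiecedRenewal.
Context {R : realType} {d : measure_display} {Omega : measurableType d}.
Local Notation W := (Omega * NatCemB)%type.
Local Notation Seq := (g_sigma_algebraType (@cylinders d Omega)).
Variable Y : process_data R Omega.
Hypothesis sY : rc_strong_markov Y.
Variable p : R -> nat -> nat -> R.
Hypothesis tp : transition_matrix p.
Hypothesis sp : standard_matrix p.
Hypothesis Yp : has_transition_matrix Y p.
Variable pi : probability NatCemB R.
Variable Pt : NatCem -> probability Seq R.
Hypothesis Pt_law : piecing_out_law Y pi Pt.
Variable j : nat.
Local Notation zeta := (lifetime Y).
Local Notation w := (restart_weight pi).

Let A := [set z : R * Seq | 0 <= z.1 /\ pieced_state Y z.1 z.2 = Some j].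
Let mA : measurable A := measurable_pieced sY j.

Let sectE t : xsection A t = [set x | 0 <= t /\ pieced_state Y t x = Some j].
Proof. by rewrite xsectionE. Qed.

Let msect t : measurable [set x : Seq | 0 <= t /\ pieced_state Y t x = Some j].
Proof. by rewrite -sectE; exact: measurable_xsection. Qed.

(** The clause [0 <= t] makes the event a section of the jointly measurable set [A], whence
    measurability in t over the whole line. *)
Definition pieced_prob (k : nat) (t : R) : R :=
  fine (Pt (Some k) [set x | 0 <= t /\ pieced_state Y t x = Some j]).

Lemma pieced_probE k t : (pieced_prob k t)%:E =
  Pt (Some k) [set x | 0 <= t /\ pieced_state Y t x = Some j].
Proof. by rewrite fineK//; apply: fin_num_measure; exact: msect. Qed.

Lemma pieced_prob_ge0 k t : 0 <= pieced_prob k t.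
Proof. by rewrite fine_ge0. Qed.

Lemma pieced_prob_le1 k t : pieced_prob k t <= 1.
Proof. by rewrite -lee_fin pieced_probE; apply: probability_le1; exact: msect. Qed.

Lemma measurable_pieced_prob k : measurable_fun setT (pieced_prob k).
Proof.
apply: measurableT_comp => //.
rewrite (_ : (fun t => _) = Pt (Some k) \o xsection A); first exact: measurable_fun_xsection.
by apply/funext => t /=; rewrite sectE.
Qed.

(** A restart at the trap contributes nothing, by [pieced_trap], so only the states of N enter the
    average. *)
Definition restart_average (h : nat -> R -> R) (t : R) : R :=
  limn (series (fun k => w k * h k t)).

Let w0 := restart_weight_ge0 pi.
Let w1 := restart_weight_sum pi.

Let g01 t k : 0 <= pieced_prob k t <= 1.
Proof. by rewrite pieced_prob_ge0 pieced_prob_le1. Qed.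

(** Started at the trap, the first piece almost surely has lifetime 0, which ends the path at
    once. *)
Lemma pieced_trap t : Pt None [set x | 0 <= t /\ pieced_state Y t x = Some j] = 0%E.
Proof.
apply/eqP; rewrite eq_le measure_ge0 andbT.
have m0 : measurable [set v | pd_state Y 0 v = None] by exact: measurable_state.
have mN : measurable [set x : Seq | pd_state Y 0 (x 0%N).1 = None].
  exact: (measurable_first_path m0).
have N1 : Pt None [set x | pd_state Y 0 (x 0%N).1 = None] = 1%E.
  by rewrite (first_path_law Pt_law None m0) sm_start.
rewrite -[X in (_ <= X)%E](subee (x := 1%E))// -[X in (_ - X)%E]N1.
rewrite -probability_setC//; apply: le_measure; rewrite ?inE//; [exact: msect|exact: measurableC|].
move=> x /= [t0 E] E0; move: E; rewrite pieced_zero//.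
by apply/eqP; rewrite eq_le lifetime_ge0 andbT; apply/(lifetime_leP sY _ (lexx 0)).
Qed.

Lemma measurable_age t : measurable_fun setT (fun v => t - fine (zeta v)).
Proof.
apply: measurable_funB; first exact: measurable_cst.
exact: measurableT_comp (measurable_lifetime sY).
Qed.

Variable i : nat.
Local Notation P := (pd_law Y (Some i)).

(** Both end points are left out: [pieced_later] needs the lifetime strictly between 0 and t, and
    the end points are null events. *)
Let inner t v : Prop := (0 < zeta v)%E /\ (zeta v < t%:E)%E.

Let minner t : measurable [set v | inner t v].
Proof.
rewrite (_ : [set v | _] = [set v | (0 < zeta v)%E] `&` [set v | (zeta v < t%:E)%E])//.
apply: measurableI; first exact: (measurable_lifetime_lt sY 0).
rewrite -[X in measurable X]setTI.
exact: (emeasurable_fun_infty_o measurableT (measurable_lifetime sY)).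
Qed.

Lemma integral_lifetime_lt t (f : Omega -> \bar R) : 0 <= t ->
  measurable_fun [set v | (zeta v <= t%:E)%E] f -> (forall v, (zeta v <= t%:E)%E -> (0 <= f v)%E) ->
  (\int[P]_(v in [set v | (zeta v <= t%:E)%E]) f v =
   \int[P]_(v in [set v | (0 < zeta v)%E /\ (zeta v < t%:E)%E]) f v)%E.
Proof.
move=> t0 mf f0.
have mz := measurable_lifetime_eq sY.
rewrite (ge0_negligible_integral (N := [set v | zeta v = 0%E] `|` [set v | zeta v = t%:E]))//.
- congr (integral _ _ _); apply/seteqP; split => v /=.
    move=> [zt /not_orP[z0 zn]]; rewrite !lt_neqAle lifetime_ge0 zt !andbT.
    by split; [rewrite eq_sym|]; exact/eqP.
  by move=> [z0 zt]; split; [exact: ltW|case=> E; [move: z0|move: zt]; rewrite E ltxx].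
- exact: measurableU.
- exact: (measurable_lifetime_le sY).
- apply/eqP; rewrite eq_le measure_ge0 andbT.
  apply: le_trans (measureU2 (pd_law Y (Some i)) (mz _) (mz _)) _.
  have null := lifetime_eq_prob sY tp sp Yp i.
  by rewrite [X in (X + _)%E](null 0 (lexx 0)) [X in (_ + X)%E](null t t0) adde0.
Qed.

Let B t := [set z : Omega * Seq | inner t z.1 /\ pieced_state Y (t - fine (zeta z.1)) z.2 = Some j].

Let mB t : measurable (B t).
Proof.
have mphi : measurable_fun setT (fun z : Omega * Seq => (t - fine (zeta z.1), z.2)).
  apply/measurable_fun_pairP; split => /=; last exact: measurable_snd.
  exact: measurableT_comp (measurable_age t) measurable_fst.
rewrite (_ : B t = ([set v | inner t v] `*` setT) `&` ((fun z : Omega * Seq => (t - fine (zeta z.1), z.2)) @^-1` A)).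
  apply: measurableI; first exact: measurableX.
  by rewrite -[X in measurable X]setTI; exact: mphi.
apply/seteqP; split => -[v x]; rewrite /B /A /=; last by tauto.
by move=> [iv E]; split=> //; split => //; apply: lifetime_age_ge0; exact: (ltW iv.2).
Qed.

Let mB_shift t : measurable [set x : Seq | B t ((x 0%N).1, path_shift x)].
Proof. by rewrite -[X in measurable X]setTI; exact: measurable_first_shift. Qed.

Let B_section t k : ((P \x Pt (Some k)) (B t) =
  \int[P]_(v in [set v | inner t v]) (pieced_prob k (t - fine (zeta v)))%:E)%E.
Proof.
rewrite [RHS]integral_mkcond; apply: eq_integral => v _ /=.
rewrite patchE pieced_probE; case: ifPn => [/set_mem/= iv|/negP iv].
  congr (Pt _ _); rewrite xsectionE; apply/seteqP; split => x; rewrite /B /=; last by tauto.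
  by move=> [_ E]; split => //; apply: lifetime_age_ge0; exact: (ltW iv.2).
rewrite (_ : xsection (B t) v = set0) ?measure0// xsectionE.
by apply/seteqP; split => // x [/= iv' _]; apply: iv; exact/mem_set.
Qed.

Let B_trap t : ((P \x Pt None) (B t) = 0)%E.
Proof.
apply: integral0_eq => v _ /=.
apply/eqP; rewrite eq_le measure_ge0 andbT -(pieced_trap (t - fine (zeta v))).
apply: le_measure; rewrite ?inE//.
- exact: measurable_xsection.
- exact: msect.
rewrite xsectionE => x; rewrite /B /= => -[iv E]; split => //.
by apply: lifetime_age_ge0; exact: (ltW iv.2).
Qed.

(** [m] is the distribution of the first restart position on the event. Its total mass is the sum of
    its atoms, each given by [restart_law_product], and the sum is then taken under the integral. *)
Let B_total t : Pt (Some i) [set x | B t ((x 0%N).1, path_shift x)] =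
  (\int[P]_(v in [set v | inner t v]) (restart_average pieced_prob (t - fine (zeta v)))%:E)%E.
Proof.
have mC := mB_shift t.
have m2 : measurable_fun setT (fun x : Seq => (x 0%N).2 : NatCemB).
  exact: measurableT_comp measurable_snd (measurable_piece 0).
have [m mE] := pushforward_measure (mrestr (Pt (Some i)) mC) m2.
have mpt y : m [set y] = (pi [set y] * (P \x Pt y) (B t))%E.
  by rewrite mE -(restart_law_product sY Pt_law i y (mB t)).
have := @natcem_integral R m (fun=> 1%E) (fun _ => lee01).
rewrite integral_cst// mul1e mE => H.
transitivity (mrestr (Pt (Some i)) mC ((fun x : Seq => (x 0%N).2) @^-1` [set: NatCemB])).
  by rewrite /mrestr preimage_setT setTI.
rewrite H !mul1e mpt B_trap mule0 add0e.
have mg k : measurable_fun [set v | inner t v] (fun v => (pieced_prob k (t - fine (zeta v)))%:E).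
  apply/measurable_EFinP; apply: measurable_funS measurableT _ _ => //.
  exact: measurableT_comp (measurable_pieced_prob k) (measurable_age t).
transitivity (\sum_(0 <= k <oo) \int[P]_(v in [set v | inner t v])
    ((w k)%:E * (pieced_prob k (t - fine (zeta v)))%:E))%E.
  apply: eq_eseriesr => k _; rewrite mul1e mpt -restart_weightE B_section ge0_integralZl//.
    by move=> v _; rewrite lee_fin pieced_prob_ge0.
  by rewrite lee_fin.
rewrite -integral_nneseries//.
- apply: eq_integral => v _; under eq_eseriesr do rewrite -EFinM.
  apply: nneseries_EFin; exact: (weighted_cvg w0 w1 (g01 _)).
- by move=> k; apply: measurable_funeM.
- by move=> k v _; rewrite mule_ge0// lee_fin ?pieced_prob_ge0.
Qed.

Lemma measurable_restart_average (h : nat -> R -> R) (D : set R) :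
  (forall k, measurable_fun D (h k)) -> (forall k t, D t -> 0 <= h k t <= 1) ->
  measurable_fun D (restart_average h).
Proof.
move=> mh h01 mD.
apply: (@measurable_realfun.measurable_fun_cvg _ _ _ _ (fun n t => series (fun k => w k * h k t) n)) => //.
  by move=> n; apply: measurable_sum => k; apply: measurable_funM => //; exact: measurable_cst.
by move=> t Dt; apply: (weighted_cvg w0 w1) => k; exact: h01.
Qed.

(** If the first path is in j at time t, it is still alive and gives the first term. The rest of the
    event is, up to a null set, that the first lifetime lies strictly between 0 and t and the
    shifted sequence is in j after the remaining time. *)
Lemma pieced_renewal t : 0 <= t -> ((pieced_prob i t)%:E = (p t i j)%:E +
  \int[P]_(v in [set v | (zeta v <= t%:E)%E])
     (restart_average pieced_prob (t - fine (zeta v)))%:E)%E.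
Proof.
move=> t0; rewrite integral_lifetime_lt//; first last.
- by move=> v _; rewrite lee_fin; exact: (weighted_ge0 w0 w1 (g01 _)).
- apply/measurable_EFinP; apply: measurable_funS measurableT _ _ => //.
  apply: measurableT_comp (measurable_age t).
  apply: measurable_restart_average => [k|k s _]; first exact: measurable_pieced_prob.
  exact: g01.
rewrite -B_total pieced_probE.
set D := [set x | _].
have mD : measurable (D : set Seq) := msect t.
pose D1 := [set x : Seq | pd_state Y t (x 0%N).1 = Some j].
have mst : measurable [set v | pd_state Y t v = Some j] by exact: measurable_state.
have mD1 : measurable D1.
  exact: (measurable_first_path mst).
have D1D : D1 `<=` D.
  move=> x E; split => //; rewrite pieced_first// ltNge; apply/negP => /(lifetime_leP sY _ t0).
  by rewrite E.
have -> : Pt (Some i) D = (Pt (Some i) D1 + Pt (Some i) (D `\` D1))%E.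
  rewrite -measureU//; last by rewrite setDIK.
    by rewrite setDUK.
  exact: measurableD.
rewrite {1}/D1 (first_path_law Pt_law _ mst) Yp//; congr (_ + _)%E.
have mC := mB_shift t.
have mz := measurable_lifetime_eq sY.
have mzp r : measurable [set x : Seq | zeta (x 0%N).1 = r].
  exact: (measurable_first_path (mz r)).
have null r : 0 <= r -> Pt (Some i) [set x | zeta (x 0%N).1 = r%:E] = 0%E.
  by move=> r0; rewrite (first_path_law Pt_law _ (mz _)) (lifetime_eq_prob sY tp sp Yp).
apply/eqP; rewrite eq_le; apply/andP; split; last first.
  apply: le_measure; rewrite ?inE//; first exact: measurableD.
  move=> x [[/= z0 zt] E]; split.
    by split => //; rewrite pieced_later.
  move=> /= E1; move: zt; rewrite ltNge => /negP; apply.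
  by rewrite leNgt; apply/negP => zt; have /(lifetime_leP sY _ t0) := ltW zt; rewrite E1.
(* The two inclusions differ only where the first lifetime is 0 or t. *)
apply: (@le_trans _ _ (Pt (Some i) ([set x : Seq | B t ((x 0%N).1, path_shift x)] `|`
    ([set x | zeta (x 0%N).1 = 0%E] `|` [set x | zeta (x 0%N).1 = t%:E])))).
  apply: le_measure; rewrite ?inE//; first exact: measurableD.
    by apply: measurableU => //; exact: measurableU.
  move=> x [[_ E] nE1].
  have [zt|zt|zt] := ltgtP (zeta (x 0%N).1) t%:E; last by right; right.
    have [z0|z0] := eqVneq (zeta (x 0%N).1) 0%E; first by right; left.
    have zp : (0 < zeta (x 0%N).1)%E by rewrite lt_neqAle eq_sym z0 lifetime_ge0.
    by left; split => //=; rewrite -pieced_later.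
  by case: nE1; rewrite /D1/= -(pieced_first t0 zt).
apply: le_trans (measureU2 _ mC (measurableU _ _ (mzp _) (mzp _))) _.
rewrite -[X in (_ <= X)%E]adde0 leeD2l//.
apply: le_trans (measureU2 _ (mzp _) (mzp _)) _.
by rewrite [X in (X + _)%E](null 0 (lexx 0)) [X in (_ + X)%E](null t t0) adde0.
Qed.

End PiecedRenewal.

(** * The renewal equation *)

Section RenewalOperator.
Context {R : realType} {d : measure_display} {Omega : measurableType d}.
Local Notation mu := (@lebesgue_measure R).
Local Notation D := (`[(0:R), +oo[%classic : set (measurableTypeR R)).
Variable Y : process_data R Omega.
Hypothesis sY : rc_strong_markov Y.
Local Notation zeta := (lifetime Y).

Definition renewal (i : nat) (h : R -> R) (t : R) : \bar R :=
  (\int[pd_law Y (Some i)]_(v in [set v | (zeta v <= t%:E)%E]) (h (t - fine (zeta v)))%:E)%E.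

Let dead_by := [set z : measurableTypeR R * Omega | (zeta z.2 <= z.1%:E)%E].

Let mdead_by : measurable dead_by.
Proof.
rewrite -[X in measurable X]setTI; apply: emeasurable_fun_le => //.
  exact: measurableT_comp (measurable_lifetime sY) measurable_snd.
by apply/measurable_EFinP; exact: measurable_fst.
Qed.

Let time_ge0 v t : (zeta v <= t%:E)%E -> 0 <= t.
Proof. by move=> vt; rewrite -lee_fin (le_trans _ vt)// lifetime_ge0. Qed.

Section Kernel.
Variables (h : R -> R) (C : R).
Hypothesis mh : measurable_fun D h.
Hypothesis h0 : forall t, 0 <= t -> 0 <= h t.

(** One function on time and paths, set to 0 before the lifetime, so that Tonelli's theorem applies;
    alpha = 0 gives the integrand of [renewal] itself. *)
Let kernel (alpha : R) : measurableTypeR R * Omega -> \bar R :=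
  (fun z => (expR (- (alpha * z.1)) * h (z.1 - fine (zeta z.2)))%:E) \_ dead_by.

Let mkernel alpha : measurable_fun setT (kernel alpha).
Proof.
apply/(measurable_restrictT _ mdead_by)/measurable_EFinP; apply: measurable_funM.
  apply: measurable_funS measurableT _ _ => //.
  apply: measurableT_comp => //; apply: measurableT_comp => //.
  by apply: measurable_funM; [exact: measurable_cst|exact: measurable_fst].
apply: (@measurable_comp _ _ _ _ _ _ D h _ (fun z : measurableTypeR R * Omega => z.1 - fine (zeta z.2))) => //.
- move=> _ [[t v] /= vt <-].
  by rewrite in_itv/= andbT; exact: lifetime_age_ge0.
apply: measurable_funS measurableT _ _ => //.
apply: measurable_funB; first exact: measurable_fst.
apply: measurableT_comp => //.
exact: measurableT_comp (measurable_lifetime sY) measurable_snd.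
Qed.

Let kernel_ge0 alpha z : (0 <= kernel alpha z)%E.
Proof.
apply: erestrict_ge0 => {}z /= vt; rewrite lee_fin mulr_ge0 ?expR_ge0// h0//.
exact: lifetime_age_ge0.
Qed.

Let kernel_patch alpha t v : kernel alpha (t, v) =
  ((fun v => (expR (- (alpha * t)) * h (t - fine (zeta v)))%:E) \_ [set v | (zeta v <= t%:E)%E]) v.
Proof.
rewrite /kernel !patchE; congr (if _ then _ else _).
Qed.

Let kernel_exp alpha t v : kernel alpha (t, v) = ((expR (- (alpha * t)))%:E * kernel 0 (t, v))%E.
Proof.
rewrite /kernel !patchE; case: ifP => _; last by rewrite mule0.
by rewrite mul0r oppr0 expR0 mul1r EFinM.
Qed.

Lemma renewalE i t : renewal i h t = (\int[pd_law Y (Some i)]_v kernel 0 (t, v))%E.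
Proof.
rewrite /renewal integral_mkcond; apply: eq_integral => v _.
by rewrite kernel_patch !patchE mul0r oppr0 expR0 mul1r.
Qed.

Lemma measurable_renewal i : measurable_fun setT (renewal i h : measurableTypeR R -> \bar R).
Proof.
rewrite (_ : (renewal i h : measurableTypeR R -> \bar R) = fubini_F (pd_law Y (Some i)) (kernel 0)).
  exact: measurable_fun_fubini_tonelli_F.
by apply/funext => t; rewrite renewalE.
Qed.

Lemma renewal_ge0 i t : (0 <= renewal i h t)%E.
Proof. by rewrite renewalE; apply: integral_ge0 => v _; exact: kernel_ge0. Qed.

Lemma measurable_renewal_integrand t :
  measurable_fun [set v | (zeta v <= t%:E)%E] (fun v => (h (t - fine (zeta v)))%:E).
Proof.
apply/measurable_EFinP; apply: (@measurable_comp _ _ _ _ _ _ D h _ (fun v => t - fine (zeta v))) => //.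
- move=> _ [v /= vt <-].
  by rewrite in_itv/= andbT; exact: lifetime_age_ge0.
apply: measurable_funS measurableT _ _ => //.
exact: measurable_age.
Qed.

Definition lifetime_laplace (alpha : R) (i : nat) : \bar R :=
  (\int[pd_law Y (Some i)]_(v in [set v | (zeta v < +oo)%E]) (expR (- (alpha * fine (zeta v))))%:E)%E.

Let kernel_time alpha v : (zeta v < +oo)%E ->
  (\int[mu]_t kernel alpha (t, v) =
   (expR (- (alpha * fine (zeta v))))%:E * \int[mu]_(t in D) (expR (- (alpha * t)) * h t)%:E)%E.
Proof.
move=> vfin; set z := fine (zeta v).
have zE : zeta v = z%:E by rewrite fineK// ge0_fin_numE ?lifetime_ge0.
have z0 : 0 <= z by rewrite fine_ge0// lifetime_ge0.
transitivity (\int[mu]_(t in `[z, +oo[) (expR (- (alpha * z)) * (expR (- (alpha * (t - z))) * h (t - z)))%:E)%E.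
  rewrite [RHS]integral_mkcond; apply: eq_integral => t _.
  rewrite kernel_patch !patchE /= zE.
  rewrite (_ : (t \in `[z, +oo[%classic) = (v \in [set v | (zeta v <= t%:E)%E])); last first.
    by apply/idP/idP => /set_mem/=; rewrite ?in_itv/= ?andbT ?zE ?lee_fin => H; apply/mem_set; rewrite /= ?in_itv/= ?andbT ?zE ?lee_fin.
  case: ifP => // _; congr EFin; rewrite -/z mulrA -expRD; congr (expR _ * _); ring.
have mf : measurable_fun D (fun t => (expR (- (alpha * t)) * h t)%:E).
  by apply/measurable_EFinP; apply: measurable_funM => //; exact: measurable_laplace_kernel.
rewrite (ge0_integral_shift z (f := fun t => (expR (- (alpha * z)) * (expR (- (alpha * t)) * h t))%:E)%E).
- under eq_integral do rewrite EFinM.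
  rewrite ge0_integralZl//; first by move=> t; rewrite /= in_itv/= andbT => t0; rewrite lee_fin mulr_ge0 ?expR_ge0 ?h0.
- by apply/measurable_EFinP; apply: measurable_funM; [exact: measurable_cst|exact/measurable_EFinP].
- by move=> t t0; rewrite lee_fin !mulr_ge0 ?expR_ge0 ?h0.
Qed.

(** The transform of a convolution is a product: after Tonelli, the time integral along a fixed path
    is translated by its lifetime z, which splits off the factor expR (- alpha z). *)
Lemma renewal_integral alpha i :
  (\int[mu]_(t in D) ((expR (- (alpha * t)))%:E * renewal i h t) =
   lifetime_laplace alpha i * \int[mu]_(t in D) (expR (- (alpha * t)) * h t)%:E)%E.
Proof.
transitivity (\int[mu]_t \int[pd_law Y (Some i)]_v kernel alpha (t, v))%E.
  rewrite [LHS]integral_mkcond; apply: eq_integral => t _; rewrite patchE.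
  case: ifPn => [_|/negP tD].
    rewrite renewalE -ge0_integralZl//; first last.
    - exact: measurableT_comp (mkernel 0) (measurable_pair1 _).
    by apply: eq_integral => v _; rewrite -kernel_exp.
  rewrite integral0_eq// => v _; rewrite kernel_patch patchE; case: ifPn => // /set_mem/= vt.
  by case: tD; apply/mem_set; rewrite /= in_itv/= andbT (time_ge0 vt).
rewrite (fubini_tonelli (kernel alpha))//.
set L := (\int[mu]_(t in D) _)%E.
have L0 : (0 <= L)%E.
  apply: integral_ge0 => t; rewrite /= in_itv/= andbT => t0.
  by rewrite lee_fin mulr_ge0 ?expR_ge0 ?h0.
have mfin := measurable_lifetime_fin sY.
rewrite /lifetime_laplace -ge0_integralZr//; last first.
  apply: measurable_funS measurableT _ _ => //; apply/measurable_EFinP.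
  apply: measurableT_comp => //; apply: measurableT_comp => //.
  apply: measurable_funM; first exact: measurable_cst.
  exact: measurableT_comp (measurable_lifetime sY).
rewrite [RHS]integral_mkcond; apply: eq_integral => v _; rewrite patchE.
case: ifPn => [/set_mem/= vfin|/negP vfin]; first exact: kernel_time.
rewrite integral0_eq// => t _; rewrite kernel_patch patchE; case: ifPn => // /set_mem/= vt.
by case: vfin; apply/mem_set; exact: le_lt_trans vt (ltry _).
Qed.

End Kernel.
End RenewalOperator.

Section MinimalRenewal.
Context {R : realType} {d : measure_display} {Omega : measurableType d}.
Local Notation mu := (@lebesgue_measure R).
Local Notation D := (`[(0:R), +oo[%classic : set (measurableTypeR R)).
Variable Y : process_data R Omega.
Hypothesis sY : rc_strong_markov Y.
Variables (a b : nat -> R) (p : R -> nat -> nat -> R).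
Hypothesis Qp : Q_process a b p.
Hypothesis Yp : has_transition_matrix Y p.
Let tp := Qp_transition Qp.
Let sp := Qp_standard Qp.
Local Notation zeta := (lifetime Y).

Let renewal1 i t : 0 <= t -> renewal Y i (fun=> 1) t = (1 - tm_mass p t i)%:E.
Proof.
move=> t0; rewrite /renewal integral_cst ?mul1e; last exact: (measurable_lifetime_le sY).
have mt := measurable_lifetime_lt sY t.
rewrite (_ : [set v | _] = ~` [set v | (t%:E < zeta v)%E]); last first.
  by apply/seteqP; split => v /=; rewrite leNgt => /negP.
rewrite -[LHS]/(pd_law Y (Some i) _) (probability_setC _ mt).
by rewrite (lifetime_gt_prob sY tp Yp).
Qed.

Let bounded1 : bounded_on_half_line 1 (fun=> 1 : R).
Proof. by split => // t _; rewrite normr1. Qed.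

(** The case h = 1 of [renewal_integral]: the renewal operator then yields 1 - S with S the survival
    probability, whose transform contains the defining formula of [flying_laplace]. *)
Lemma lifetime_laplaceE alpha i : 0 < alpha ->
  lifetime_laplace Y alpha i = (flying_laplace p alpha i)%:E.
Proof.
move=> al0; have bS := tm_mass_bounded tp sp i.
have := renewal_integral sY bounded1.1 (fun _ _ => ler01) alpha i.
rewrite -(laplaceE al0 bounded1) laplace_cst// div1r.
rewrite (_ : (\int[mu]_(t in D) _)%E = (alpha^-1 - laplace alpha (fun t => tm_mass p t i))%:E); last first.
  rewrite -div1r -(laplace_cst 1 al0) -(laplaceB al0 bounded1 bS).
  rewrite (laplaceE al0 (boundedB bounded1 bS)); apply: eq_integral => t.
  by move=> /set_mem; rewrite /= in_itv/= andbT => t0; rewrite renewal1// EFinM.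
move=> H; rewrite -[LHS]mule1 -[1%E]/(1%:E) -(mulVf (lt0r_neq0 al0)) EFinM muleA -H.
by rewrite -EFinM (flying_laplaceE Qp)// mulrBl mulVf ?gt_eqF// [alpha * _]mulrC.
Qed.

Section Bounded.
Variable h : R -> R.
Hypothesis mh : measurable_fun D h.
Hypothesis h01 : forall t, 0 <= t -> 0 <= h t <= 1.
Variable i : nat.

Let h0 t : 0 <= t -> 0 <= h t. Proof. by move=> /h01/andP[]. Qed.

Let bh : bounded_on_half_line 1 h.
Proof. by split=> // t t0; rewrite ger0_norm ?h0//; have /andP[] := h01 t0. Qed.

Lemma renewal_le1 t : (renewal Y i h t <= 1)%E.
Proof.
have mt := measurable_lifetime_le sY t.
apply: (@le_trans _ _ (\int[pd_law Y (Some i)]_(v in [set v | (zeta v <= t%:E)%E]) 1)%E).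
  apply: ge0_le_integral => //.
  - by move=> v vt; rewrite lee_fin h0// lifetime_age_ge0.
  - exact: (measurable_renewal_integrand sY mh).
  - by move=> v vt; rewrite lee_fin; have /andP[] := h01 (lifetime_age_ge0 vt).
by rewrite integral_cst// mul1e probability_le1.
Qed.

Lemma renewal_fin_num t : renewal Y i h t \is a fin_num.
Proof.
rewrite ge0_fin_numE; first exact: le_lt_trans (renewal_le1 t) (ltry 1).
exact: (renewal_ge0 Y h0).
Qed.

Lemma bounded_renewal : bounded_on_half_line 1 (fun t => fine (renewal Y i h t)).
Proof.
split=> [|t _].
  apply: measurableT_comp => //; apply: measurable_funS measurableT _ _ => //.
  exact: (measurable_renewal sY mh h0).
have H0 := renewal_ge0 Y h0 i t.
by rewrite ger0_norm ?fine_ge0// -lee_fin fineK ?renewal_fin_num ?renewal_le1.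
Qed.

Lemma laplace_renewal alpha : 0 < alpha ->
  laplace alpha (fun t => fine (renewal Y i h t)) = flying_laplace p alpha i * laplace alpha h.
Proof.
move=> al0; apply: EFin_inj; rewrite (laplaceE al0 bounded_renewal) EFinM.
rewrite (laplaceE al0 bh) -lifetime_laplaceE// -(renewal_integral sY mh h0).
by apply: eq_integral => t _; rewrite EFinM fineK// renewal_fin_num.
Qed.

(** Dominated convergence by 1. Along times decreasing to t, a path dead by t sees h converge from
    the right, and a path still alive at t contributes 0 eventually. *)
Lemma renewal_right_continuous t : 0 <= t ->
  (forall t, 0 <= t -> h s @[s --> t^'+] --> h t) ->
  fine (renewal Y i h s) @[s --> t^'+] --> fine (renewal Y i h t).
Proof.
move=> t0 ch; apply/cvg_at_rightP => s [ts scv].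
pose f (t : R) := (fun v => (h (t - fine (zeta v)))%:E) \_ [set v | (zeta v <= t%:E)%E].
have fE t' : renewal Y i h t' = (\int[pd_law Y (Some i)]_v f t' v)%E.
  by rewrite /renewal integral_mkcond.
have mf t' : measurable_fun setT (f t').
  apply/(measurable_restrictT _ (measurable_lifetime_le sY t')).
  exact: (measurable_renewal_integrand sY mh).
suff : (\int[pd_law Y (Some i)]_v f (s n) v @[n --> \oo] --> \int[pd_law Y (Some i)]_v f t v)%E.
  rewrite -fE -(fineK (renewal_fin_num t)) => /fine_cvgP[_].
  apply: cvg_trans; apply: near_eq_cvg; apply: nearW => n /=.
  by rewrite fE.
have [] := @dominated_convergence _ _ R (pd_law Y (Some i)) setT measurableT (fun n => f (s n)) (f t) (fun=> 1%E).
- by move=> n; exact: mf.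
- exact: mf.
- apply: aeW => v _; rewrite /f patchE; case: ifPn => [/set_mem/= vt|/negP vt].
    apply: cvg_EFin; first by near=> n; rewrite patchE; case: ifP.
    have := ch _ (lifetime_age_ge0 vt) => /cvg_at_rightP /(_ (fun n => s n - fine (zeta v))).
    move=> H; have {H} : h (s n - fine (zeta v)) @[n --> \oo] --> h (t - fine (zeta v)).
      apply: H; split; first by move=> n; rewrite ltrD2r.
      by apply: cvgB => //; exact: cvg_cst.
    apply: cvg_trans; apply: near_eq_cvg; near=> n; rewrite /= patchE mem_set//=.
    by apply: le_trans vt _; rewrite lee_fin ltW.
  apply: (@cvg_trans _ (0%E @[_ --> \oo])); last exact: cvg_cst.
  apply: near_eq_cvg.
  have {vt}vt : (t%:E < zeta v)%E by rewrite ltNge; apply/negP => vt'; apply: vt; exact/mem_set.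
  have [e e0 te] : exists2 e, 0 < e & ((t + e)%:E <= zeta v)%E.
    case: (zeta v) vt => [z| |] //=; last by exists 1 => //; rewrite leey.
    by rewrite lte_fin => tz; exists (z - t); rewrite ?subr_gt0// addrC subrK.
  near=> n; rewrite patchE memNset//=; apply/negP; rewrite -ltNge.
  apply: lt_le_trans te; rewrite lte_fin.
  near: n; apply: (cvgr_lt t) => //; rewrite ltrDl//.
- by apply/integrableP; split => //; rewrite integral_cst//= normr1 mul1e; apply: le_lt_trans (ltry 1); exact: probability_le1.
- apply: aeW => v n _; rewrite /f patchE; case: ifPn => [/set_mem/= vn|_]; last by rewrite abse0.
  by have /andP[H0 H1] := h01 (lifetime_age_ge0 vn); rewrite lee_fin ger0_norm.
by [].
Unshelve. all: by end_near. Qed.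

End Bounded.
End MinimalRenewal.

(** * Solutions of the renewal equation and the Doob formula *)

Section RenewalEquation.
Context {R : realType} {d : measure_display} {Omega : measurableType d}.
Local Notation D := (`[(0:R), +oo[%classic : set (measurableTypeR R)).
Variables (a b : nat -> R).
Hypothesis a0 : a 0%N = 0.
Hypothesis a_gt0 : forall k, (0 < k)%N -> 0 < a k.
Hypothesis b_gt0 : forall k, 0 < b k.
Hypothesis sfin : (bd_sigma a b < +oo)%E.
Variable pmin : R -> nat -> nat -> R.
Hypothesis pmin_min : minimal_Q_process a b pmin.
Let Qmin := pmin_min.1.
Let tmin := Qp_transition Qmin.
Let smin := Qp_standard Qmin.
Variable Y : process_data R Omega.
Hypothesis sY : rc_strong_markov Y.
Hypothesis Yp : has_transition_matrix Y pmin.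
Variable pi : probability NatCemB R.
Variable j : nat.
Local Notation zeta := (lifetime Y).
Local Notation w := (restart_weight pi).
Local Notation avg := (restart_average pi).
Let w0 := restart_weight_ge0 pi.
Let w1 := restart_weight_sum pi.

Record renewal_solution (g : nat -> R -> R) : Prop := {
  rs_measurable : forall k, measurable_fun D (g k);
  rs_bounds : forall k t, 0 <= t -> 0 <= g k t <= 1;
  rs_equation : forall k t, 0 <= t ->
    (g k t)%:E = ((pmin t k j)%:E + renewal Y k (avg g) t)%E }.

Lemma measurable_avg (g : nat -> R -> R) : (forall k, measurable_fun D (g k)) ->
  (forall k t, 0 <= t -> 0 <= g k t <= 1) -> measurable_fun D (avg g).
Proof.
move=> mg g01; apply: measurable_restart_average => // k t.
by rewrite /= in_itv/= andbT; exact: g01.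
Qed.

Lemma avg_bounds g t : (forall k t, 0 <= t -> 0 <= g k t <= 1) -> 0 <= t -> 0 <= avg g t <= 1.
Proof.
move=> g01 t0; rewrite (weighted_ge0 w0 w1 (C := 1))/=; last by move=> k; exact: g01.
by apply: (weighted_le w0 w1) => k; exact: g01.
Qed.

Lemma laplace_avg (g : nat -> R -> R) alpha : 0 < alpha -> (forall k, measurable_fun D (g k)) ->
  (forall k t, 0 <= t -> 0 <= g k t <= 1) ->
  laplace alpha (avg g) = limn (series (fun k => w k * laplace alpha (g k))).
Proof.
move=> al0 mg g01.
have bg k : bounded_on_half_line 1 (g k).
  by split=> // t t0; have /andP[H0 H1] := g01 k t t0; rewrite ger0_norm.
have := @laplace_series R 1 (fun k t => w k * g k t) _ _ _ alpha al0.
rewrite (_ : (fun k => laplace _ _) = fun k => w k * laplace alpha (g k)); last first.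
  by apply/funext => k; exact: (laplaceZ _ al0 (bg k)).
move=> H; apply/esym/cvg_lim => //; apply: H.
- by move=> k; apply: measurable_funM => //; exact: measurable_cst.
- by move=> k t t0; rewrite mulr_ge0//; have /andP[] := g01 k t t0.
- by move=> n t t0; apply: (weighted_sum_le w0 w1) => k; exact: g01.
Qed.

Lemma renewal_solution_resv g alpha k : renewal_solution g -> 0 < alpha ->
  laplace alpha (g k) = resv pmin alpha k j + flying_laplace pmin alpha k * laplace alpha (avg g).
Proof.
move=> [mg g01 eqg] al0.
have ma := measurable_avg mg g01; have a01 t := avg_bounds (t := t) g01.
rewrite -(laplace_renewal sY Qmin Yp ma a01)//.
rewrite -(laplaceD al0 (tm_bounded tmin smin k j) (bounded_renewal sY ma a01 k)).
apply: eq_laplace => t t0; apply: EFin_inj; rewrite eqg// EFinD fineK//.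
exact: (renewal_fin_num sY ma a01).
Qed.

(** Averaging [renewal_solution_resv] over pi closes into one scalar equation for the transform of
    the averaged solution, with coefficient [restart_flying] less than 1. *)
Lemma renewal_solution_doob g alpha k : renewal_solution g -> 0 < alpha ->
  laplace alpha (g k) = resv pmin alpha k j + flying_laplace pmin alpha k *
    (restart_resv pmin pi alpha j / (1 - restart_flying pmin pi alpha)).
Proof.
move=> sg al0; rewrite (renewal_solution_resv k sg al0); congr (_ + _ * _).
have [mg g01 _] := sg; set L := laplace alpha (avg g).
have LE : L = restart_resv pmin pi alpha j + L * restart_flying pmin pi alpha.
  rewrite {1}/L laplace_avg// -(weighted_lin w0 w1 (C := alpha^-1) (C' := 1)); first last.
  - by move=> l; rewrite (flying_laplace_ge0 Qmin)//= (flying_laplace_le1 Qmin).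
  - by move=> l; rewrite (resv_ge0 tmin smin)//= (resv_le tmin smin).
  congr (limn (series _)); apply/funext => l.
  by rewrite (renewal_solution_resv l sg al0) [L * _]mulrC.
have n0 := restart_flying_neq pmin_min pi al0.
apply: (mulIf n0); rewrite divfK// mulrBr mulr1 {1}LE; ring.
Qed.

Let rho := restart_flying pmin pi 1.

Let rho_bounds : 0 <= rho < 1.
Proof.
rewrite (restart_flying_lt1 pmin_min)// andbT; apply: (weighted_ge0 w0 w1 (C := 1)) => k.
by rewrite (flying_laplace_ge0 Qmin)//= (flying_laplace_le1 Qmin).
Qed.

(* With respect to the weight [expR (- t)], the restarted part of the renewal equation is a contraction of ratio [rho]. *)
Let renewal_contraction g h c : renewal_solution g -> renewal_solution h -> 0 <= c ->
  (forall t, 0 <= t -> avg g t <= avg h t + c * expR t) ->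
  forall t, 0 <= t -> avg g t <= avg h t + c * rho * expR t.
Proof.
move=> [mg g01 eqg] [mh h01 eqh] c0 gh t t0.
have ma := measurable_avg mg g01; have a01 s := avg_bounds (t := s) g01.
have mb := measurable_avg mh h01; have b01 s := avg_bounds (t := s) h01.
have u01 k : 0 <= flying_laplace pmin 1 k <= 1.
  by rewrite (flying_laplace_ge0 Qmin)//= (flying_laplace_le1 Qmin).
have mE := measurable_lifetime_le sY t.
have mz : measurable_fun setT (fun v => fine (zeta v)).
  exact: measurableT_comp (measurable_lifetime sY).
have mexp : measurable_fun setT (fun v => (expR (- (1 * fine (zeta v))))%:E).
  apply/measurable_EFinP; apply: measurableT_comp => //; apply: measurableT_comp => //.
  by apply: measurable_funM => //; exact: measurable_cst.
(* The assumed bound is inserted at the remaining time: expR (t - zeta) splits into expR t and expR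
   (- zeta), and integrating the latter over all finite lifetimes gives u at alpha = 1. Averaging
   over pi afterwards produces [rho]. *)
have step k : g k t <= h k t + c * expR t * flying_laplace pmin 1 k.
  rewrite -lee_fin eqg// EFinD eqh// -addeA leeD2l// EFinM -(lifetime_laplaceE sY Qmin Yp)//.
  apply: (@le_trans _ _ (\int[pd_law Y (Some k)]_(v in [set v | (zeta v <= t%:E)%E])
      ((avg h (t - fine (zeta v)))%:E + (c * expR t)%:E * (expR (- (1 * fine (zeta v))))%:E))%E).
    apply: ge0_le_integral => //.
    - by move=> v /= vt; rewrite lee_fin; have /andP[] := a01 _ (lifetime_age_ge0 vt).
    - exact: (measurable_renewal_integrand sY ma).
    - apply: emeasurable_funD; first exact: (measurable_renewal_integrand sY mb).
      by apply: measurable_funeM; exact: measurable_funS mexp.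
    - move=> v /= vt; rewrite -EFinM -EFinD lee_fin.
      by rewrite -mulrA -expRD mul1r gh// lifetime_age_ge0.
  rewrite ge0_integralD//; first last.
  - by apply: measurable_funeM; exact: measurable_funS mexp.
  - by move=> v _; rewrite lee_fin !mulr_ge0 ?expR_ge0.
  - exact: (measurable_renewal_integrand sY mb).
  - by move=> v /= vt; rewrite lee_fin; have /andP[] := b01 _ (lifetime_age_ge0 vt).
  rewrite leeD2l// ge0_integralZl//; first last.
  - by rewrite lee_fin mulr_ge0 ?expR_ge0.
  - exact: measurable_funS mexp.
  rewrite lee_wpmul2l ?lee_fin ?mulr_ge0 ?expR_ge0//; apply: ge0_subset_integral => //.
  - exact: (measurable_lifetime_fin sY).
  - exact: measurable_funS mexp.
  - by move=> v /= /le_lt_trans; apply; exact: ltry.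
rewrite -mulrA [rho * _]mulrC mulrA -(weighted_lin w0 w1 _ (fun k => h01 k t t0) u01).
apply: ler_lim.
- by apply: (weighted_cvg w0 w1) => k; exact: g01.
- apply: (weighted_cvg w0 w1 (C := 1 + c * expR t)) => k.
  have /andP[h0 h1] := h01 k t t0; have /andP[u0 u1] := u01 k.
  have ce : 0 <= c * expR t by rewrite mulr_ge0 ?expR_ge0.
  by rewrite addr_ge0 ?mulr_ge0//= lerD// ler_piMr.
- near=> n; rewrite /series/=; apply: ler_sum => k _.
  by rewrite ler_wpM2l.
Unshelve. all: by end_near. Qed.

(** The contraction is iterated from the crude bound avg g <= 1 <= expR t, and the powers of [rho]
    tend to 0. *)
Let renewal_avg_le g h : renewal_solution g -> renewal_solution h ->
  forall t, 0 <= t -> avg g t <= avg h t.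
Proof.
move=> sg sh t t0.
have [_ g01 _] := sg; have [_ h01 _] := sh; have /andP[r0 r1] := rho_bounds.
have H n : forall t, 0 <= t -> avg g t <= avg h t + rho ^+ n * expR t.
  elim: n => [s s0|n IH s s0].
    have /andP[_ g1] := avg_bounds g01 s0; have /andP[h0 _] := avg_bounds h01 s0.
    have e1 : 1 <= expR s by rewrite -expR0 ler_expR.
    by rewrite expr0 mul1r (le_trans g1)// (le_trans e1)// lerDr.
  by rewrite exprSr; apply: renewal_contraction => //; rewrite exprn_ge0.
have c : avg h t + rho ^+ n * expR t @[n --> \oo] --> avg h t + 0 * expR t.
  apply: cvgD; first exact: cvg_cst.
  by apply: cvgM; [apply: cvg_expr; rewrite ger0_norm|exact: cvg_cst].
have := cvg_lim _ c; rewrite mul0r addr0 => <- //.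
apply: limr_ge; first by apply/cvg_ex; eexists; exact: c.
by near=> n; exact: H.
Unshelve. all: by end_near. Qed.

(** A solution is determined by its average, through the right-hand side of the equation. *)
Lemma renewal_solution_unique g h : renewal_solution g -> renewal_solution h ->
  forall k t, 0 <= t -> g k t = h k t.
Proof.
move=> sg sh k t t0; apply: EFin_inj.
rewrite (rs_equation sg)// (rs_equation sh)//; congr (_ + _)%E.
apply: eq_integral => v /set_mem/= vt; congr EFin; apply/eqP.
by rewrite eq_le !renewal_avg_le// lifetime_age_ge0.
Qed.

Variable p : R -> nat -> nat -> R.
Hypothesis Qp : Q_process a b p.
Let tp := Qp_transition Qp.
Let sp := Qp_standard Qp.

(** Both sides are right continuous, the average by dominated convergence and the lifetime integral
    by [renewal_right_continuous], so equality of transforms gives equality at every time. The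
    transforms agree by the fixed point form F = pi R. *)
Lemma doob_renewal_solution : doob_process pmin pi p ->
  renewal_solution (fun k t => p t k j).
Proof.
move=> doob; set g := fun k t => p t k j.
have mg k : measurable_fun D (g k) by exact: (tm_measurable tp sp).
have g01 k t : 0 <= t -> 0 <= g k t <= 1.
  by move=> t0; rewrite (tm_ge0 tp)//= (tm_le1 tp).
split => // k.
have ma := measurable_avg mg g01; have a01 s := avg_bounds (t := s) g01.
have bf := bounded_renewal sY ma a01 k.
have bp := tm_bounded tp sp k j; have bm := tm_bounded tmin smin k j.
have ca t : 0 <= t -> avg g s @[s --> t^'+] --> avg g t.
  move=> t0; apply: (weighted_dominated w0 w1 (x := fun s k => g k s) (C := 1)).
  - by near=> s => l; apply: g01; apply: (le_trans t0); near: s; exact: nbhs_right_ge.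
  - by move=> l; exact: g01.
  - by move=> l; exact: (tm_right_continuous tp sp).
have E : forall t, 0 <= t -> p t k j = pmin t k j + fine (renewal Y k (avg g) t).
  apply: (laplace_inj bp (boundedD bm bf)) => [t t0|t t0|alpha al0].
  - exact: (tm_right_continuous tp sp).
  - apply: cvgD; first exact: (tm_right_continuous tmin smin).
    exact: (renewal_right_continuous sY ma a01).
  - rewrite (laplaceD al0 bm bf) (laplace_renewal sY Qmin Yp ma a01)// laplace_avg//.
    have := (doob_boundaryP a0 a_gt0 b_gt0 sfin pmin_min Qp pi).1 doob alpha j al0.
    move/(doob_fixpointP a0 a_gt0 b_gt0 sfin pmin_min Qp pi j al0).
    move=> H; rewrite -[X in _ + _ * X]H.
    exact: (resv_decomposition a0 a_gt0 b_gt0 sfin pmin_min Qp).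
move=> t t0; rewrite [g k t]E// EFinD fineK//.
exact: (renewal_fin_num sY ma a01).
Unshelve. all: by end_near. Qed.

Local Notation Seq := (g_sigma_algebraType (@cylinders d Omega)).
Variable Pt : NatCem -> probability Seq R.
Hypothesis Pt_law : piecing_out_law Y pi Pt.

Lemma pieced_renewal_solution : renewal_solution (pieced_prob Y Pt j).
Proof.
split=> [k|k t t0|k t t0].
- exact: measurable_funS (measurable_pieced_prob sY Pt j k).
- by rewrite pieced_prob_ge0 (pieced_prob_le1 sY).
- exact: (pieced_renewal sY tmin smin Yp Pt_law).
Qed.

End RenewalEquation.

(** * Doob processes and piecing out *)

Section DoobPiecing.
Context {R : realType} {d : measure_display} {Omega : measurableType d}.
Variables (a b : nat -> R).
Hypothesis a0 : a 0%N = 0.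
Hypothesis a_gt0 : forall k, (0 < k)%N -> 0 < a k.
Hypothesis b_gt0 : forall k, 0 < b k.
Hypothesis sfin : (bd_sigma a b < +oo)%E.
Variable pmin : R -> nat -> nat -> R.
Hypothesis pmin_min : minimal_Q_process a b pmin.
Variable Y : process_data R Omega.
Hypothesis sY : rc_strong_markov Y.
Hypothesis Yp : has_transition_matrix Y pmin.
Variable pi : probability NatCemB R.
Variable p : R -> nat -> nat -> R.
Hypothesis Qp : Q_process a b p.
Local Notation Seq := (g_sigma_algebraType (@cylinders d Omega)).
Variable Pt : NatCem -> probability Seq R.
Hypothesis Pt_law : piecing_out_law Y pi Pt.

Lemma is_piecing_outP : is_piecing_out Y Pt p <->
  forall i j t, 0 <= t -> pieced_prob Y Pt j i t = p t i j.
Proof.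
have E j t : 0 <= t -> [set x | 0 <= t /\ pieced_state Y t x = Some j] =
    [set x : Seq | pieced_state Y t x = Some j].
  by move=> t0; apply/seteqP; split=> x //= -[].
split=> H.
  move=> i j t t0; apply: EFin_inj; rewrite (pieced_probE sY) E//; exact: H.
by move=> t i j t0; rewrite -H// (pieced_probE sY) E.
Qed.

(** Both functions solve the same renewal equation; its uniqueness statement asks for measurability
    and bounds but no continuity in t of the pieced-out probabilities. *)
Lemma doob_piecing_out : doob_process pmin pi p -> is_piecing_out Y Pt p.
Proof.
move=> doob; apply/is_piecing_outP => i j t t0.
have sg := pieced_renewal_solution pmin_min sY Yp j Pt_law.
have sh := doob_renewal_solution a0 a_gt0 b_gt0 sfin pmin_min sY Yp j Qp doob.
exact: (renewal_solution_unique pmin_min sY Yp sg sh).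
Qed.

Lemma piecing_out_doob : is_piecing_out Y Pt p -> doob_process pmin pi p.
Proof.
move=> /is_piecing_outP H; apply/(doob_processP pmin Qp pi) => alpha i j al0.
rewrite -(renewal_solution_doob pmin_min sY Yp i _ al0 (g := pieced_prob Y Pt j)).
  by apply: eq_laplace => t t0; rewrite H.
exact: (pieced_renewal_solution pmin_min sY Yp).
Qed.

End DoobPiecing.

Theorem theorem5p1 (R : realType) (a b : nat -> R)
  (a0 : a 0%N = 0) (a_gt0 : forall k, (0 < k)%N -> 0 < a k)
  (b_gt0 : forall k, 0 < b k)
  (boundary : infty_regular a b \/ infty_exit a b)
  (p : R -> nat -> nat -> R) (Qp : Q_process a b p)
  (Pbar : R -> R.-pker RKSpaceB ~> RKSpaceB)
  (Pbar_ray : ray_knight_semigroup p Pbar)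
  (pmin : R -> nat -> nat -> R) (pmin_min : minimal_Q_process a b pmin)
  (d : measure_display) (Omega : measurableType d)
  (Xmin : process_data R Omega) (Xmin_markov : rc_strong_markov Xmin)
  (Xmin_trans : has_transition_matrix Xmin pmin)
  (pi : probability NatCemB R)
  (Pt : NatCem -> probability (g_sigma_algebraType (@cylinders d Omega)) R)
  (Pt_law : piecing_out_law Xmin pi Pt) :
  [<-> doob_process pmin pi p;
       is_piecing_out Xmin Pt p;
       branching_point p rk_infty /\
         forall A : set RKSpaceB, measurable A ->
           Pbar 0 rk_infty A = pi (rk_incl @^-1` A)].
Proof.
have sfin : (bd_sigma a b < +oo)%E by case: boundary => -[].
tfae.
- exact: (doob_piecing_out a0 a_gt0 b_gt0 sfin pmin_min Xmin_markov Xmin_trans Qp Pt_law).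
- move=> /(piecing_out_doob pmin_min Xmin_markov Xmin_trans Qp Pt_law) doob.
  have law := @doob_ray_law _ _ _ a0 a_gt0 b_gt0 sfin _ pmin_min _ Qp _ _ Pbar_ray doob.
  by split; [exact: (ray_law_branching Pbar_ray law)|exact: law].
- by move=> [_ law]; exact: (ray_law_doob a0 a_gt0 b_gt0 sfin pmin_min Qp Pbar_ray law).
Qed.
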